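(* Let $U$ be any $T(\mathfrak h)$-module, let $W$ be the associated induced $N(\hat{\mathfrak h}_{\mathbb Z})$-module with its weight grading and grading operator $\mathbf d_W$, let $V$ be the $\frac{\mathbb Z}{2}$-graded meromorphic open-string vertex algebra constructed from $\mathfrak h$, and let $Y_W(u,x)=\bar Y_W(\exp(\Delta(x))u,x)$ for $u\in V$ (all as defined in the context). Then $W$, together with the vertex operator map $Y_W$, is a canonically $\mathbb Z_2$-twisted $V$-module, that is, a $\theta$-twisted $V$-module for the parity involution $\theta$ of $V$.
   Context: Conventions: $\mathbb N=\{0,1,2,\dots\}$, $\mathbb Z_+=\{1,2,\dots\}$; hats over factors denote omission; $T(\cdot)$ is the tensor algebra. **$\frac{\mathbb Z}{2}$-graded MOSVA.** A $\frac{\mathbb Z}{2}$-graded meromorphic open-string vertex algebra is a graded space $V=\coprod_{n\in\frac12\mathbb Z}V_{(n)}$ with a linear map $Y_V:V\otimes V\to V[[x,x^{-1}]]$, $u\otimes v\mapsto Y_V(u,x)v$, and a vacuum $\mathbf 1\in V$ such that: $V_{(n)}=0$ for $n$ sufficiently negative; with $\mathbf d_Vv=nv$ for $v\in V_{(n)}$, $[\mathbf d_V,Y_V(u,x)]=Y_V(\mathbf d_Vu,x)+x\frac{d}{dx}Y_V(u,x)$; $Y_V(\mathbf 1,x)=1_V$; $Y_V(u,x)\mathbf 1\in V[[x]]$ with constant term $u$; with $D_Vu=\lim_{x\to0}\frac{d}{dx}Y_V(u,x)\mathbf 1$, $\frac{d}{dx}Y_V(u,x)=Y_V(D_Vu,x)=[D_V,Y_V(u,x)]$;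 and for all $u_1,v\in V$ there is $P\in\mathbb N$ such that for all $u_2\in V$, $(x_0+x_2)^PY_V(u_1,x_0+x_2)Y_V(u_2,x_2)v=(x_0+x_2)^PY_V(Y_V(u_1,x_0)u_2,x_2)v$. For homogeneous $v$, the parity $|v|$ is $1$ if $v\in V_1:=\coprod_{n\in\mathbb Z+1/2}V_{(n)}$ and $0$ if $v\in V_0:=\coprod_{n\in\mathbb Z}V_{(n)}$. **Twisted modules.** An involution $\theta$ of $V$ is a grading-preserving linear isomorphism with $\theta^2=1_V$ and $\theta(Y_V(u,x)v)=Y_V(\theta u,x)\theta v$. The parity involution is $\theta(v)=(-1)^iv$ for $v\in V_i$, $i=0,1$. A $\theta$-twisted $V$-module is a $\mathbb C$-graded space $W=\coprod_{n\in\mathbb C}W_{(n)}$ with a linear map $Y_W^\theta:V\otimes W\to W[[x^{1/2},x^{-1/2}]]$, $v\otimes w\mapsto Y_W^\theta(v,x)w=\sum_{n\in\frac12\mathbb Z}v_nw\,x^{-n-1}$, an operator $\mathbf d_W$ of weight $0$ and an operator $D_W$ of weight $1$ (no axiom is imposed on $D_W$), such that: (1) $W_{(m)}=0$ when $\mathrm{Re}(m)$ is sufficiently negative; $\mathbf d_Ww=mw$ for $w\in W_{(m)}$; $[\mathbf d_W,Y_W^\theta(u,x)]=Y_W^\theta(\mathbf d_Vu,x)+x\frac{d}{dx}Y_W^\theta(u,x)$ for $u\in V$; (2) $Y_W^\theta(\mathbf 1,x)=1_W$; (3) $\frac{d}{dx}Y_W^\theta(u,x)=Y_W^\theta(D_Vu,x)$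 for $u\in V$; (4) (weak associativity with pole-order condition) for every homogeneous $v_1\in V$ and $w\in W$ there is $P\in\mathbb N$ such that for every homogeneous $v_2\in V$, $$(x_0+x_2)^{P+|v_1|/2}x_2^{|v_2|/2}Y_W^\theta(v_1,x_0+x_2)Y_W^\theta(v_2,x_2)w=(x_0+x_2)^{P+|v_1|/2}x_2^{|v_2|/2}Y_W^\theta(Y_V(v_1,x_0)v_2,x_2)w$$ as series in $W((x_0,x_2))$ (on the left, powers of $x_0+x_2$ are expanded in nonnegative powers of $x_2$; on the right, in nonnegative powers of $x_0$). The twisted module is called canonically $\mathbb Z_2$-twisted when $\theta$ is the parity involution; then $Y_W^\theta$ is written $Y_W$. **The space $W$.** Let $\mathfrak h=\mathbb C^{2M}$ with a nondegenerate symmetric bilinear form $(\cdot,\cdot)$ and a polarization $\mathfrak h=\mathfrak p\oplus\mathfrak q$ into maximal isotropic subspaces. Let $\hat{\mathfrak h}_{\mathbb Z}=\mathfrak h\otimes\mathbb C[t,t^{-1}]\oplus\mathbb C\mathbf k$, $\hat{\mathfrak h}_{\mathbb Z}^{\pm}=\mathfrak h\otimes t^{\pm1}\mathbb C[t^{\pm1}]$. $N(\hat{\mathfrak h}_{\mathbb Z})$ is the quotient of $T(\hat{\mathfrak h}_{\mathbb Z})$ by the two-sided ideal generated by $(a\otimes t^m)\otimes(b\otimes t^n)+(b\otimes t^n)\otimes(a\otimes t^m)-(a,b)\delta_{m+n,0}\mathbf k$, $(a\otimes t^p)\otimes(b\otimes t^0)+(b\otimes t^0)\otimes(a\otimes t^p)$,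 $(a\otimes t^q)\otimes\mathbf k-\mathbf k\otimes(a\otimes t^q)$ for $a,b\in\mathfrak h$, $m>0>n$, $p\in\mathbb Z\setminus\{0\}$, $q\in\mathbb Z$. Given a $T(\mathfrak h)$-module $U$, let $\hat{\mathfrak h}_{\mathbb Z}^+$ act on $U$ by $0$, $\mathfrak h\otimes t^0$ as $\mathfrak h$, and $\mathbf k$ by $1$; put $W=N(\hat{\mathfrak h}_{\mathbb Z})\otimes_{T(\hat{\mathfrak h}_{\mathbb Z}^+)\otimes T(\mathfrak h\otimes t^0)\otimes T(\mathbb C\mathbf k)}U$. Let $h(m)$ be the action of $h\otimes t^m$ on $W$. $W$ is spanned by $h_1(-m_1)\cdots h_r(-m_r)u$ ($h_i\in\mathfrak h$, $m_i\in\mathbb Z_+$, $u\in U$, $r\in\mathbb N$), given weight $m_1+\dots+m_r$; $\mathbf d_W$ is the weight operator. Put $h(x)=\sum_{n\in\mathbb Z}h(n)x^{-n-1/2}$, $h^{(m)}(x)=\frac1{m!}\frac{d^m}{dx^m}h(x)$. **Normal ordering on $W$.** For zero modes define recursively (the empty product being $1$ and the normal ordering of a single mode being itself) $${\circ\atop\circ}a_1(0)\cdots a_r(0){\circ\atop\circ}=a_1(0){\circ\atop\circ}a_2(0)\cdots a_r(0){\circ\atop\circ}+\sum_{i=2}^r\tfrac{(-1)^{i+1}}2(a_1,a_i){\circ\atop\circ}a_2(0)\cdots\widehat{a_i(0)}\cdots a_r(0){\circ\atop\circ}.$$ In general ${\circ\atop\circ}h_1(m_1)\cdots h_r(m_r){\circ\atop\circ}$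 equals $(-1)^\sigma$ times the product of all negative modes ($m_i<0$), then all positive modes ($m_i>0$), then the normal ordering of all zero modes, each of the three groups keeping its original order, where $\sigma$ is the resulting permutation of the factors. It is extended to products of series $h_i^{(m_i)}(x_i)$ coefficientwise. **The algebra $V$.** Let $\hat{\mathfrak h}_{\mathbb Z+1/2}=\mathfrak h\otimes t^{1/2}\mathbb C[t,t^{-1}]\oplus\mathbb C\mathbf k$ and let $N(\hat{\mathfrak h}_{\mathbb Z+1/2})$ be the quotient of its tensor algebra by the relations $(a\otimes t^m)(b\otimes t^n)+(b\otimes t^n)(a\otimes t^m)=(a,b)\delta_{m+n,0}\mathbf k$ for $m>0>n$ in $\mathbb Z+\frac12$, and $\mathbf k$ commutes with everything. $V$ is the module induced from the one-dimensional space $\mathbb C\mathbf 1$ on which modes with positive $t$-exponent act by $0$ and $\mathbf k$ acts by $1$. It has (choosing the $h_i$ in a basis of $\mathfrak h$) a basis $h_1(-m_1-\frac12)\cdots h_r(-m_r-\frac12)\mathbf 1$, $m_i\in\mathbb N$, of weight $\sum_i(m_i+\frac12)$. Put $h(x)_V=\sum_{n\in\mathbb Z}h(n+\frac12)x^{-n-1}$, $h^{(m)}(x)_V=\frac1{m!}\frac{d^m}{dx^m}h(x)_V$. The normal ordering $:\ :$ on $V$ moves all negative modes to the left of all positive modes, keeping the order inside each group, with the sign of the permutation, and $Y_V(h_1(-m_1-\frac12)\cdots h_r(-m_r-\frac12)\mathbf 1,x)={:}h_1^{(m_1)}(x)_V\cdots h_r^{(m_r)}(x)_V{:}$. **Vertex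 operators on $W$.** The naïve vertex operator $\bar Y_W$ is the linear map with $\bar Y_W(\mathbf 1,x)=1_W$ and $\bar Y_W(h_1(-m_1-\frac12)\cdots h_r(-m_r-\frac12)\mathbf 1,x)={\circ\atop\circ}h_1^{(m_1)}(x)\cdots h_r^{(m_r)}(x){\circ\atop\circ}$. Let $e_1,\dots,e_M$ be a basis of $\mathfrak p$, $\bar e_1,\dots,\bar e_M$ a basis of $\mathfrak q$ with $(e_i,\bar e_j)=\delta_{ij}$, and $$\Delta(x)=\sum_{i=1}^M\sum_{m,n\ge0}C_{mn}\,e_i(m+\tfrac12)\bar e_i(n+\tfrac12)x^{-m-n-1},\qquad C_{mn}=\frac12\frac{m-n}{m+n+1}\binom{-1/2}{m}\binom{-1/2}{n},$$ acting on $V$. The actual vertex operator is $Y_W(u,x)=\bar Y_W(\exp(\Delta(x))u,x)$. *)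

(* Defs.v *)
From HB Require Import structures.
From mathcomp Require Import all_boot all_order all_algebra.
From mathcomp Require Import generic_quotient ring_quotient.
From mathcomp Require Import boolp classical_sets functions cardinality fsbigop.
From mathcomp Require Import reals complex finmap monalg.

Set Implicit Arguments.
Unset Strict Implicit.
Unset Printing Implicit Defensive.

Import Order.TTheory GRing.Theory Num.Theory.
Local Open Scope ring_scope.
Local Open Scope classical_set_scope.
Local Open Scope quotient_scope.

Section Span.
Variables (K : nzRingType) (X : lmodType K).

Inductive lspan (S : set X) : set X :=
| lspan_gen x of S x : lspan S x
| lspan0 : lspan S 0
| lspanD x y of lspan S x & lspan S y : lspan S (x + y)
| lspanZ c x of lspan S x : lspan S (c *: x).

Lemma lspanB S x y : lspan S x -> lspan S y -> lspan S (x - y).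
Proof.
by move=> Sx Sy; apply: lspanD => //; rewrite -scaleN1r; apply: lspanZ.
Qed.

Definition in_lspan (S : set X) (x : X) : bool := `[< lspan S x >].

Lemma in_lspan_zmod_closed S : zmod_closed (in_lspan S).
Proof.
split=> [|x y]; first by apply/asboolP/lspan0.
by move=> /asboolP Sx /asboolP Sy; apply/asboolP/lspanB.
Qed.
HB.instance Definition _ S :=
  GRing.isZmodClosed.Build X (in_lspan S) (in_lspan_zmod_closed S).

(* The quotient vector space X / span(S). *)
Definition lquot (S : set X) :=
  @Quotient.quot X (GRing.ZmodClosed.clone X (in_lspan S) _).

Section Quot.
Variable S : set X.
HB.instance Definition _ := GRing.Zmodule.on (lquot S).
HB.instance Definition _ := Quotient.on (lquot S).

Definition lquot_pi (x : X) : lquot S := \pi x.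

Lemma lquot_piP x y : lquot_pi x = lquot_pi y <-> lspan S (x - y).
Proof.
split=> [/eqP|Sxy]; first by rewrite -Quotient.idealrBE => /asboolP.
by apply/eqP; rewrite -Quotient.idealrBE; apply/asboolP.
Qed.

Lemma lquot_repr (w : lquot S) : lquot_pi (repr w) = w.
Proof. exact: reprK. Qed.

Lemma lquot_piD : {morph lquot_pi : x y / x + y}.
Proof. by move=> x y; rewrite /lquot_pi !piE. Qed.

Definition lquot_scale c (w : lquot S) : lquot S := lquot_pi (c *: repr w).

Lemma lquot_piZ c x : lquot_pi (c *: x) = lquot_scale c (lquot_pi x).
Proof.
apply/lquot_piP; rewrite -scalerBr; apply/lspanZ/lquot_piP.
by rewrite lquot_repr.
Qed.

Fact lquot_scaleA a b w :
  lquot_scale a (lquot_scale b w) = lquot_scale (a * b) w.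
Proof. by rewrite -(lquot_repr w) -!lquot_piZ scalerA. Qed.
Fact lquot_scale1 : left_id 1 lquot_scale.
Proof. by move=> w; rewrite -(lquot_repr w) -lquot_piZ scale1r. Qed.
Fact lquot_scaleDr : right_distributive lquot_scale +%R.
Proof.
move=> a u v; rewrite -(lquot_repr u) -(lquot_repr v).
by rewrite -lquot_piD -!lquot_piZ scalerDr lquot_piD.
Qed.
Fact lquot_scaleDl w : {morph lquot_scale^~ w : a b / a + b}.
Proof.
by move=> a b; rewrite -(lquot_repr w) -!lquot_piZ scalerDl lquot_piD.
Qed.
HB.instance Definition _ := GRing.Zmodule_isLmodule.Build K (lquot S)
  lquot_scaleA lquot_scale1 lquot_scaleDr lquot_scaleDl.

End Quot.
End Span.

Section LinearExtension.
Variables (K : nzRingType) (T : choiceType) (X : lmodType K).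

Definition lext (f : T -> X) (g : {malg K[T]}) : X :=
  \sum_(k <- msupp g) g@_k *: f k.

Lemma lextw f g (d : {fset T}) : fsubset (msupp g) d ->
  lext f g = \sum_(k <- d) g@_k *: f k.
Proof.
move=> /fsubsetP gd; rewrite /lext [RHS](bigID (mem (msupp g))) /=.
rewrite [X in _ = _ + X]big1 ?addr0; last first.
  by move=> k kg; rewrite mcoeff_outdom ?scale0r.
rewrite -[RHS]big_filter; apply: perm_big; apply: uniq_perm.
- exact: fset_uniq.
- by apply: filter_uniq; apply: fset_uniq.
by move=> k; rewrite mem_filter; case: (boolP (k \in msupp g)) => //= /gd ->.
Qed.

Lemma lext_is_linear f : linear (lext f).
Proof.
move=> c g1 g2; pose d := (msupp g1 `|` msupp g2 `|` msupp (c *: g1 + g2))%fset.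
rewrite !(@lextw f _ d).
- rewrite scaler_sumr -big_split /=; apply: eq_bigr => k _.
  by rewrite mcoeffD mcoeffZ scalerDl scalerA.
- by apply/fsubsetP => k; rewrite !inE => ->; rewrite !orbT.
- by apply/fsubsetP => k; rewrite !inE => ->.
- by apply/fsubsetP => k; rewrite !inE => ->; rewrite !orbT.
Qed.
HB.instance Definition _ f :=
  GRing.isLinear.Build K {malg K[T]} X *:%R (lext f) (lext_is_linear f).

Lemma lextU f k : lext f << k >> = f k.
Proof.
rewrite (@lextw f _ [fset k]%fset) ?msuppU_le // big_seq_fset1.
by rewrite mcoeffUU scale1r.
Qed.

End LinearExtension.

(* Modes are indexed by [int] in both sectors: [n] stands for a (x) t^n in the
   sector [IntModes] and for a (x) t^(n+1/2) in the sector [HalfModes]. *)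
Variant sector := IntModes | HalfModes.

Definition expo (s : sector) (n : int) : rat :=
  n%:~R + (if s is HalfModes then 2^-1 else 0).

(* (d/dx)^k x^a / k! = gbinom a k x^(a-k) *)
Definition gbinom (a : rat) (k : nat) : rat :=
  (\prod_(i < k) (a - i%:R)) / k`!%:R.

Section Fock.
Variables (R : realType).
Local Notation C := R[i].
Variables (h : lmodType C) (form : h -> h -> C).

(* [Some (a, n)] is the mode a (x) t^(expo n), [None] is the central k. *)
Definition generator : Type := option (h * int).
HB.instance Definition _ := Choice.on generator.

Section Sector.
Variables (s : sector) (U : lmodType C) (act0 : h -> U -> U).
Local Notation exp := (expo s).
Local Notation mode a n := (Some (a, n) : generator).
Local Notation kk := (None : generator).

Definition words : lmodType C := {malg C[(seq generator * U)%type]}.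
(* The symbol x_1 (x) ... (x) x_r (x) u. *)
Definition word (w : seq generator) (u : U) : words := << (w, u) >>.

(* Let B be the subalgebra of N generated by k and the modes with nonnegative
   exponent, acting on U as prescribed.  N (x)_B U is the space of words modulo
   - [rel_modeL], [rel_vectL]: linearity, giving T(h^) (x) U;
   - [rel_anti], [rel_zero], [rel_central]: the relations defining N, in any
     position;
   - [rel_pos], [rel_act0], [rel_k]: the balancing relations over B.
   In the sector [HalfModes] no exponent vanishes, so that [rel_zero] and
   [rel_act0] are void. *)
Inductive fock_rel : set words :=
| rel_modeL v w c a b n u :
    fock_rel (word (v ++ mode (c *: a + b) n :: w) u
              - (c *: word (v ++ mode a n :: w) u + word (v ++ mode b n :: w) u))
| rel_vectL w c u u' :
    fock_rel (word w (c *: u + u') - (c *: word w u + word w u'))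
| rel_anti v w a b m n u of 0 < exp m & exp n < 0 :
    fock_rel (word (v ++ mode a m :: mode b n :: w) u
              + word (v ++ mode b n :: mode a m :: w) u
              - (form a b *+ (exp m + exp n == 0)) *: word (v ++ kk :: w) u)
| rel_zero v w a b p z u of exp p != 0 & exp z = 0 :
    fock_rel (word (v ++ mode a p :: mode b z :: w) u
              + word (v ++ mode b z :: mode a p :: w) u)
| rel_central v w a n u :
    fock_rel (word (v ++ mode a n :: kk :: w) u
              - word (v ++ kk :: mode a n :: w) u)
| rel_pos v a n u of 0 < exp n : fock_rel (word (rcons v (mode a n)) u)
| rel_act0 v a z u of exp z = 0 :
    fock_rel (word (rcons v (mode a z)) u - word v (act0 a u))
| rel_k v u : fock_rel (word (rcons v kk) u - word v u).

Definition fock : lmodType C := lquot fock_rel.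

Definition fock_pi (f : words) : fock := lquot_pi fock_rel f.

Definition of_vect (u : U) : fock := fock_pi (word [::] u).

Definition cons_words (x : generator) : words -> words :=
  lext (fun p => word (x :: p.1) p.2).

Definition gen_weight (x : generator) : C :=
  if x is Some (_, n) then - ratr (exp n) else 0.

Definition word_weight (w : seq generator) : C := \sum_(x <- w) gen_weight x.

Definition weight_words : words -> words :=
  lext (fun p => word_weight p.1 *: word p.1 p.2).

Definition gen_op (x : generator) (w : fock) : fock :=
  fock_pi (cons_words x (repr w)).

Definition mode_op (a : h) (n : int) : fock -> fock := gen_op (mode a n).

Definition weight_op (w : fock) : fock := fock_pi (weight_words (repr w)).

(* [gen_op] and [weight_op] do not depend on the choice of representatives. *)
Lemma fock_descends (f : {linear words -> words}) :
  (forall r, fock_rel r -> lspan fock_rel (f r)) ->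
  forall g, fock_pi (f (repr (fock_pi g))) = fock_pi (f g).
Proof.
move=> frel g; apply/lquot_piP; rewrite -linearB.
have: lspan fock_rel (repr (fock_pi g) - g).
  by apply/lquot_piP; rewrite lquot_repr.
elim=> [r /frel//||x y _ Sx _ Sy|c x _ Sx].
- by rewrite linear0; apply: lspan0.
- by rewrite linearD; apply: lspanD.
- by rewrite linearZ; apply: lspanZ.
Qed.

Lemma gen_op_pi x g : gen_op x (fock_pi g) = fock_pi (cons_words x g).
Proof.
pose f : {linear words -> words} := lext (fun p => word (x :: p.1) p.2).
have fE w u : f (word w u) = word (x :: w) u by exact: lextU.
apply: (fock_descends (f := f)); clearbody f => r rel_r; apply: lspan_gen.
have [fB fD] := (linearB f, linearD f).
have fZ c v : f (c *: v) = c *: f v by exact: linearZ_LR.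
case: rel_r => [v w c a b n u|w c u u'|v w a b m n u m0 n0|v w a b p z u p0 z0
               |v w a n u|v a n u n0|v a z u z0|v u].
- by rewrite fB fD fZ !fE -!cat_cons; apply rel_modeL.
- by rewrite fB fD fZ !fE; apply rel_vectL.
- by rewrite fB fD fZ !fE -!cat_cons; apply rel_anti.
- by rewrite fD !fE -!cat_cons; apply rel_zero.
- by rewrite fB !fE -!cat_cons; apply rel_central.
- by rewrite fE -rcons_cons; apply rel_pos.
- by rewrite fB !fE -rcons_cons; apply rel_act0.
- by rewrite fB !fE -rcons_cons; apply rel_k.
Qed.

Lemma weight_op_pi g : weight_op (fock_pi g) = fock_pi (weight_words g).
Proof.
pose f : {linear words -> words} :=
  lext (fun p => word_weight p.1 *: word p.1 p.2).
have fE w u : f (word w u) = word_weight w *: word w u by exact: lextU.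
apply: (fock_descends (f := f)); clearbody f => r rel_r.
have [fB fD] := (linearB f, linearD f).
have fZ c v : f (c *: v) = c *: f v by exact: linearZ_LR.
suff [c ->] : exists c, f r = c *: r by exact/lspanZ/lspan_gen.
have wE v x w : word_weight (v ++ x :: w) = gen_weight x + word_weight (v ++ w).
  by rewrite /word_weight !big_cat big_cons /= addrCA.
have wrE v x : word_weight (rcons v x) = gen_weight x + word_weight v.
  by rewrite -cats1 wE cats0.
case: rel_r => [v w c a b n u|w c u u'|v w a b m n u m0 n0|v w a b p z u p0 z0
               |v w a n u|v a n u n0|v a z u z0|v u].
- exists (gen_weight (mode a n) + word_weight (v ++ w)).
  by rewrite fB fD fZ !fE !wE scalerBr scalerDr !scalerA mulrC.
- exists (word_weight w).
  by rewrite fB fD fZ !fE scalerBr scalerDr !scalerA mulrC.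
- set wm := gen_weight (mode a m); set wn := gen_weight (mode b n).
  set ww := word_weight (v ++ w); exists (wm + (wn + ww)).
  have kwt : (form a b *+ (exp m + exp n == 0)) * (gen_weight kk + ww)
           = (wm + (wn + ww)) * (form a b *+ (exp m + exp n == 0)).
    have [mn|_] := eqVneq; last by rewrite mulr0n mul0r mulr0.
    by rewrite addrA /wm /wn /= -opprD -rmorphD mn rmorph0 oppr0 mulrC.
  rewrite fB fD fZ !fE !wE -/wm -/wn -/ww [wn + (wm + ww)]addrCA.
  by rewrite scalerBr scalerDr !scalerA kwt.
- set wp := gen_weight (mode a p); set wz := gen_weight (mode b z).
  set ww := word_weight (v ++ w); exists (wp + (wz + ww)).
  rewrite fD !fE !wE -/wp -/wz -/ww [wz + (wp + ww)]addrCA.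
  by rewrite scalerDr.
- exists (gen_weight (mode a n) + word_weight (v ++ w)).
  have k0 c : gen_weight kk + c = c by rewrite add0r.
  by rewrite fB !fE !wE !k0 scalerBr.
- by exists (word_weight (rcons v (mode a n))); rewrite fE.
- exists (word_weight v).
  have w0 : gen_weight (mode a z) = 0 by rewrite /= z0 rmorph0 oppr0.
  by rewrite fB !fE wrE w0 add0r scalerBr.
- exists (word_weight v).
  have k0 : gen_weight kk = 0 by [].
  by rewrite fB !fE wrE k0 add0r scalerBr.
Qed.

Definition modes_op (l : seq (h * int)) (w : fock) : fock :=
  foldr (fun x => mode_op x.1 x.2) w l.

(* The weight space of weight z: the span of the h_1(-m_1)...h_r(-m_r) u with
   m_1 + ... + m_r = z, the m_i being positive exponents. *)
Definition weight_space (z : C) : set fock :=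
  lspan [set v | exists l : seq (h * int), exists u : U,
    [/\ all (fun x => exp x.2 < 0) l,
        \sum_(x <- l) - ratr (exp x.2) = z
      & v = modes_op l (of_vect u)]].

(* [j] is the position in the tail of the factor a_i contracted with a_1, so that
   i = j + 2 and the sign (-1)^(i+1) is (-1)^(j+1).  [k] bounds the number of
   factors, for structural recursion. *)
Fixpoint zero_nord_rec (k : nat) (l : seq h) (w : fock) : fock :=
  if k is k'.+1 then
    if l is a :: l' then
      mode_op a 0 (zero_nord_rec k' l' w)
      + \sum_(j < size l')
          ((-1) ^+ j.+1 / 2%:R * form a l'`_j)
          *: zero_nord_rec k' (take j l' ++ drop j.+1 l') w
    else w
  else w.

Definition zero_nord (l : seq h) : fock -> fock := zero_nord_rec (size l) l.

Definition mode_class (n : int) : nat :=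
  if exp n < 0 then 0%N else if 0 < exp n then 1%N else 2%N.

(* The sorting permutation of the modes has the parity of its inversions. *)
Fixpoint inversions (l : seq int) : nat :=
  if l is n :: l' then
    (count (fun n' => (mode_class n' < mode_class n)%N) l' + inversions l')%N
  else 0%N.

(* In the sector [HalfModes] there are no zero modes and this is the normal
   ordering : : on V. *)
Definition nord (l : seq (h * int)) (w : fock) : fock :=
  (-1) ^+ inversions (map snd l) *:
    modes_op [seq x <- l | exp x.2 < 0]
      (modes_op [seq x <- l | 0 < exp x.2]
        (zero_nord [seq x.1 | x <- l & exp x.2 == 0] w)).

(* In both sectors h(x) = \sum_n h(e) x^(-e-1/2) with e := exp n, whence
   h^(m)(x) = \sum_n gbinom (-e-1/2) m h(e) x^(-e-1/2-m).
   [nord_fields l q w] is the coefficient of x^q in the normal ordered product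
   of the h_i^(m_i)(x), for l = [:: (h_1, m_1); ...; (h_r, m_r)], applied to w.
   The sum is finitely supported. *)
Definition nord_fields (l : seq (h * nat)) (q : rat) (w : fock) : fock :=
  \sum_(n \in [set n : (size l).-tuple int |
       \sum_(p <- zip n l) (- exp p.1 - 2^-1 - p.2.2%:R) = q])
    (\prod_(p <- zip n l) ratr (gbinom (- exp p.1 - 2^-1) p.2.2))
      *: nord (zip (map fst l) n) w.

End Sector.

Definition vertex_space : lmodType C :=
  @fock HalfModes (C^o : lmodType C) (fun _ _ => 0).

Definition vacuum : vertex_space := of_vect HalfModes (fun _ _ => 0) (1 : C^o).

(* h_1(-m_1-1/2)...h_r(-m_r-1/2) 1 *)
Definition monomial (l : seq (h * nat)) : vertex_space :=
  modes_op [seq (x.1, - (x.2.+1)%:Z) | x <- l] vacuum.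

Section Vertex.
Variables (s : sector) (U : lmodType C) (act0 : h -> U -> U).
Local Notation W := (fock s act0).

(* [Y v q w] is the coefficient of x^q in Y(v, x) w. *)
Definition is_naive_vertex (Y : vertex_space -> rat -> W -> W) : Prop :=
  (forall q w, linear (fun v => Y v q w)) /\
  (forall l q w, Y (monomial l) q w = nord_fields l q w).

(* Definite description: [is_naive_vertex] has at most one solution, as V is
   spanned by the monomials. *)
Definition naive_vertex : vertex_space -> rat -> W -> W :=
  xget (fun _ _ _ => 0) is_naive_vertex.

End Vertex.

Definition vertex_V : vertex_space -> rat -> vertex_space -> vertex_space :=
  @naive_vertex HalfModes (C^o : lmodType C) (fun _ _ => 0).

Section Actual.
Variables (M : nat) (e ebar : M.-tuple h).

Definition coefC (m n : nat) : rat :=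
  2^-1 * ((m%:R - n%:R) / (m + n + 1)%:R)
  * gbinom (- 2^-1) m * gbinom (- 2^-1) n.

(* The coefficient of x^(-l) in Delta(x), i.e. the terms with m + n + 1 = l. *)
Definition Delta (l : nat) (v : vertex_space) : vertex_space :=
  \sum_(i < M) \sum_(m < l)
    ratr (coefC m (l - m.+1)) *:
      mode_op (tnth e i) m%:Z (mode_op (tnth ebar i) (l - m.+1)%:Z v).

(* The coefficient of x^(-l) in Delta(x)^j. *)
Fixpoint Delta_pow (j l : nat) (v : vertex_space) : vertex_space :=
  if j is j'.+1 then \sum_(i < l.+1) Delta i (Delta_pow j' (l - i) v)
  else if l is 0 then v else 0.

(* The coefficient of x^(-l) in exp(Delta(x)); Delta(x) has no constant term,
   so only the powers j <= l contribute. *)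
Definition exp_Delta (l : nat) (v : vertex_space) : vertex_space :=
  \sum_(j < l.+1) (j`!%:R)^-1 *: Delta_pow j l v.

Variables (U : lmodType C) (act0 : h -> U -> U).
Local Notation W := (fock IntModes act0).

(* exp(Delta(x)) v is a finite sum since Delta lowers weights. *)
Definition vertex_W (v : vertex_space) (q : rat) (w : W) : W :=
  \sum_(l \in [set: nat]) naive_vertex (exp_Delta l v) (q + l%:R) w.

End Actual.
End Fock.

Section Twisted.
Variable (R : realType).
Local Notation C := R[i].

Section Graded.
Variables (I : choiceType) (X : lmodType C) (gr : I -> set X).

(* X is the direct sum of the subspaces gr i. *)
Definition graded : Prop :=
  [/\ (forall i, gr i 0 /\ forall c x y, gr i x -> gr i y -> gr i (c *: x + y)),
      (forall x, exists (r : seq I) (f : I -> X),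
         (forall i, gr i (f i)) /\ x = \sum_(i <- r) f i)
    & (forall (r : seq I) (f : I -> X), uniq r -> (forall i, gr i (f i)) ->
         \sum_(i <- r) f i = 0 -> forall i, i \in r -> f i = 0)].
End Graded.

(* Formal series in real powers of x are functions from exponents to
   coefficients. *)
Definition dseries (X : lmodType C) (f : rat -> X) (q : rat) : X :=
  ratr (q + 1) *: f (q + 1).

(* f in X((x0,x2)) = X[[x0,x2]][x0^-1,x2^-1] *)
Definition laurent2 (X : lmodType C) (f : rat -> rat -> X) : Prop :=
  exists N : int, forall p q, f p q != 0 ->
    [/\ p \is a Num.int, q \is a Num.int, N%:~R <= p & N%:~R <= q].

(* The data of a (Z/2)-graded meromorphic open-string vertex algebra; the axioms
   of twisted modules involve nothing else.
   [va_gr n] is V_(n), with n in (1/2)Z, [va_d] is the grading operator d_V and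
   [va_Y u q v] is the coefficient of x^q in Y_V(u,x)v. *)
Record va_data := VaData {
  va_sort :> lmodType C;
  va_gr : rat -> set va_sort;
  va_vac : va_sort;
  va_d : va_sort -> va_sort;
  va_Y : va_sort -> rat -> va_sort -> va_sort }.

(* D_V u is the constant term of (d/dx) Y_V(u,x) 1. *)
Definition va_D (V : va_data) (u : V) : V :=
  dseries (fun q => va_Y u q (va_vac V)) 0.

(* The parity |v| of a vector of V_(n). *)
Definition parity (n : rat) : nat := ~~ (n \is a Num.int).

Definition involution (V : va_data) (theta : V -> V) : Prop :=
  [/\ linear theta,
      forall n v, va_gr n v -> va_gr n (theta v),
      forall v, theta (theta v) = v
    & forall u q v, theta (va_Y u q v) = va_Y (theta u) q (theta v)].

Definition parity_involution (V : va_data) (theta : V -> V) : Prop :=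
  linear theta /\
  forall n v, va_gr n v -> theta v = (-1) ^+ parity n *: v.

Section Associativity.
Variables (V : va_data) (W : lmodType C) (Y : V -> rat -> W -> W).
Variables (v1 v2 : V) (w : W) (P d1 d2 : nat).

(* The coefficient of x0^p x2^q in
   (x0+x2)^(P+d1/2) x2^(d2/2) Y(v1,x0+x2) Y(v2,x2) w,
   where (x0+x2)^r = \sum_k gbinom r k x0^(r-k) x2^k. *)
Definition assoc_product (p q : rat) : W :=
  \sum_(k \in [set: nat]) ratr (gbinom (p + k%:R) k) *:
     Y v1 (p + k%:R - P%:R - d1%:R / 2)
       (Y v2 (q - k%:R - d2%:R / 2) w).

(* The coefficient of x0^p x2^q in
   (x0+x2)^(P+d1/2) x2^(d2/2) Y(Y_V(v1,x0)v2,x2) w,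
   where (x0+x2)^r = \sum_k gbinom r k x0^k x2^(r-k). *)
Definition assoc_iterate (p q : rat) : W :=
  \sum_(k \in [set: nat]) ratr (gbinom (P%:R + d1%:R / 2) k) *:
     Y (va_Y v1 (p - k%:R) v2)
       (q - d2%:R / 2 - P%:R - d1%:R / 2 + k%:R) w.

End Associativity.

(* [Y v q w] is the coefficient of x^q in Y_W(v,x)w.  Apart from being an
   involution, theta does not enter: the |v_i| of weak associativity are the
   parities given by the grading of V.  The sums in [tw_assoc] are finitely
   supported, by [tw_lower] and lower truncation in V. *)
Record twisted_module (V : va_data) (theta : V -> V) (W : lmodType C)
    (gr : C -> set W) (d D : W -> W) (Y : V -> rat -> W -> W) : Prop := {
  tw_theta : involution theta;
  tw_graded : graded gr;
  tw_linearV : forall q w, linear (fun v => Y v q w);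
  tw_linearW : forall v q, linear (Y v q);
  tw_half_powers : forall v q w, Y v q w != 0 -> q *+ 2 \is a Num.int;
  tw_d_linear : linear d;
  tw_D_linear : linear D;
  tw_D_weight : forall m w, gr m w -> gr (m + 1) (D w);
  tw_lower : exists N : R, forall m w, complex.Re m < N -> gr m w -> w = 0;
  tw_d : forall m w, gr m w -> d w = m *: w;
  tw_d_bracket : forall u q w,
    d (Y u q w) - Y u q (d w) = Y (va_d u) q w + ratr q *: Y u q w;
  tw_vacuum : forall q w, Y (va_vac V) q w = if q == 0 then w else 0;
  tw_D : forall u q w, dseries (fun q' => Y u q' w) q = Y (va_D u) q w;
  tw_assoc : forall n1 (v1 : V) w, va_gr n1 v1 ->
    exists P : nat, forall n2 (v2 : V), va_gr n2 v2 ->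
      let lhs := assoc_product Y v1 v2 w P (parity n1) (parity n2) in
      let rhs := assoc_iterate Y v1 v2 w P (parity n1) (parity n2) in
      [/\ laurent2 lhs, laurent2 rhs & forall p q, lhs p q = rhs p q] }.

Definition canonically_Z2_twisted_module (V : va_data) (W : lmodType C)
    (gr : C -> set W) (d D : W -> W) (Y : V -> rat -> W -> W) : Prop :=
  exists2 theta : V -> V, parity_involution theta &
    twisted_module theta gr d D Y.

End Twisted.

Section VertexAlgebra.
Variables (R : realType) (h : lmodType R[i]) (form : h -> h -> R[i]).

Definition vertex_algebra : va_data R := {|
  va_sort := vertex_space form;
  va_gr := fun n => @weight_space R h form HalfModes _ _ (ratr n);
  va_vac := vacuum form;
  va_d := @weight_op R h form HalfModes _ _;
  va_Y := @vertex_V R h form |}.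

End VertexAlgebra.

Definition maximal_isotropic (K : fieldType) (h : vectType K)
    (form : {symmetric h}) (p : {vspace h}) : Prop :=
  (p <= orthov form p)%VS /\
  forall p' : {vspace h}, (p' <= orthov form p')%VS -> (p <= p')%VS -> p' = p.

(* Main.v *)
Require Import Defs.
From HB Require Import structures.
From mathcomp Require Import all_boot all_order all_algebra.
From mathcomp Require Import boolp classical_sets functions fsbigop.
From mathcomp Require Import reals complex monalg.
From mathcomp Require Import ring lra zify.

(* Every creation mode a(-m-1/2) of V acts on vertex operators by one recursion:
   Y(a(-m-1/2)v, x) is the m-th divided derivative of the field a(x), creation
   part to the left and annihilation part to the right of Y(v, x), plus
   \sum_i K_mi x^(-m-i-1) Y(a(i+1/2)v, x).  For Y_V the kernel K vanishes; for
   the naive operator it is -1/2 binom(-1/2,m) binom(-1/2,i), the contraction of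
   two zero modes; and since [Delta, a(-m-1/2)] is a sum of annihilation modes,
   the exponential of Delta shifts it by -C_mi.  The resulting kernel satisfies
     K_(m-1,n) - K_(m,n-1) = binom(-1/2,m) binom(1/2,n) - [m = n = 0],
     (m+1) K_(m+1,i) + (i+1) K_(m,i+1) = -(m+i+1) K_mi,
   which say that k = \sum_mn K_mn (x1-x)^m (x2-x)^n x^(-m-n-1) satisfies
   (x1 - x2) k = x1^(-1/2) x2^(1/2) - 1 and does not depend on x.
   The second identity gives the D-derivative property.  Weak associativity is
   proved by induction on the length of v1: both sides of it, for a(-m-1/2)v,
   split by the recursion (applied once on the product side, and in V and then
   in W on the iterate side) into four matching pieces: creation modes outside,
   annihilation modes on w, contractions with v2, and contractions with v.
   Each pair is associative by the induction hypothesis because associativity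
   is stable under multiplication by powers of x1 = x0 + x2 and by the
   contraction kernel; the latter holds since multiplying the kernel by
   x1 - x2 = x0 makes it elementary, by the first identity. *)

Set Implicit Arguments.
Unset Strict Implicit.
Unset Printing Implicit Defensive.

Import Order.TTheory GRing.Theory Num.Theory.
Local Open Scope ring_scope.

(** * Binomial coefficients and finitely supported sums *)

(** The kernel is forced. On W the annihilation part of a(x1) contracts with b(x2) to (a,b)
    x1^(-1/2) x2^(1/2) / (x1 - x2), on V to (a,b) / (x1 - x2). The iterate sees only the second, so
    its outer vertex operator must carry the difference, which is regular at x1 = x2. The symmetric
    part of the difference is -1/2 x1^(-1/2) x2^(-1/2), supplied by the factor 1/2 in the normal
    ordering of zero modes; its antisymmetric part has Taylor coefficients -C_mn and is supplied by
    Delta. The proof therefore peels off the leftmost creation mode of v1, leaves creation modes in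
    place, and moves annihilation modes to the right. Moreover P must not depend on v2, although
    contractions with v2 involve arbitrarily high x2-derivatives of the kernel. Cancelling x1 - x2 =
    x0 does not raise the exponent, so the exponent needed depends on the order of derivation in x1
    only. *)

Section Gbinom.
Implicit Types (a b : rat) (k m n j : nat).

Lemma gbinom0 a : gbinom a 0 = 1.
Proof. by rewrite /gbinom big_ord0 fact0 divr1. Qed.

Lemma gbinomS a k : k.+1%:R * gbinom a k.+1 = (a - k%:R) * gbinom a k.
Proof.
rewrite /gbinom big_ord_recr /= factS natrM.
have k0 : k.+1%:R != 0 :> rat by rewrite pnatr_eq0.
have f0 : k`!%:R != 0 :> rat by rewrite pnatr_eq0 -lt0n fact_gt0.
by field; rewrite f0 /= addrC natr1.
Qed.

Lemma natr_inj_mul k (x y : rat) : k.+1%:R * x = k.+1%:R * y -> x = y.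
Proof. by apply: mulfI; rewrite pnatr_eq0. Qed.

Lemma gbinomSl a k : k.+1%:R * gbinom (a + 1) k.+1 = (a + 1) * gbinom a k.
Proof.
elim: k => [|k IH]; first by rewrite gbinomS !gbinom0; ring.
apply: (@natr_inj_mul k).
rewrite [in RHS]mulrCA (gbinomS a k) (gbinomS (a + 1) k.+1) mulrCA IH.
by rewrite -natr1; ring.
Qed.

Lemma gbinom_pascal a k : gbinom (a + 1) k.+1 = gbinom a k.+1 + gbinom a k.
Proof.
apply: (@natr_inj_mul k); rewrite gbinomSl mulrDr gbinomS -natr1; ring.
Qed.

Lemma gbinom_nat n k : gbinom n%:R k = 'C(n, k)%:R.
Proof.
elim: n k => [|n IH] [|k]; rewrite ?gbinom0 ?bin0 //.
  by rewrite bin0n /gbinom big_ord_recl subrr !mul0r.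
by rewrite -natr1 gbinom_pascal !IH binS natrD.
Qed.

Lemma gbinom_vandermonde a b n :
  \sum_(i < n.+1) gbinom a i * gbinom b (n - i) = gbinom (a + b) n.
Proof.
elim: n => [|n IH]; first by rewrite big_ord1 !gbinom0 mulr1.
apply: (@natr_inj_mul n); rewrite gbinomS -IH !mulr_sumr.
(* The factor n+1 is split as i + (n+1-i). Each half is absorbed by [gbinomS], and the two resulting
   sums recombine with the factors a - i and b - (n-i), whose sum is a + b - n. *)
pose F (i : nat) := i%:R * gbinom a i * gbinom b (n.+1 - i).
pose G (i : nat) := gbinom a i * ((n.+1 - i)%:R * gbinom b (n.+1 - i)).
have -> : \sum_(i < n.+2) n.+1%:R * (gbinom a i * gbinom b (n.+1 - i))
        = \sum_(i < n.+2) F i + \sum_(i < n.+2) G i.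
  rewrite -big_split; apply: eq_bigr => i _; rewrite /F /G /= natrB; last first.
    by rewrite -ltnS.
  ring.
have F0 : F 0%N = 0 by rewrite /F !mul0r.
have GS : G n.+1 = 0 by rewrite /G subnn mul0r mulr0.
rewrite big_ord_recl F0 add0r [X in _ + X]big_ord_recr /= GS addr0.
rewrite -big_split; apply: eq_bigr => i _; rewrite /F /G /= /bump /= add1n.
have iN : (i <= n)%N by rewrite -ltnS.
rewrite gbinomS subSS subSn // gbinomS natrB //; ring.
Qed.

(** Composing divided derivatives: d^j/j! after d^m/m! is C(m+j,m) d^(m+j)/(m+j)!, here read on
    x^a. *)
Lemma gbinomM a m j :
  'C(m + j, m)%:R * gbinom a (m + j) = gbinom a m * gbinom (a - m%:R) j.
Proof.
elim: j => [|j IH]; first by rewrite addn0 binn gbinom0 mul1r mulr1.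
apply: (@natr_inj_mul j).
rewrite [RHS]mulrCA gbinomS [RHS]mulrCA -IH addnS.
have E : ('C((m + j).+1, m)%:R * j.+1%:R : rat)
       = (m + j).+1%:R * 'C(m + j, m)%:R.
  have := @mul_bin_left (m + j).+1 m; have := mul_bin_down (m + j).+1 m.
  rewrite -!natrM /= => h1 _; rewrite h1; congr (_%:R); rewrite mulnC; congr muln.
  lia.
rewrite mulrA [j.+1%:R * _]mulrC E mulrAC gbinomS natrD; ring.
Qed.

End Gbinom.

Section FiniteSums.
Variables (X : zmodType).

(** The library sum takes the value 0 when the support is infinite. Every manipulation below
    therefore carries a finite list outside which the summand vanishes. *)
Definition fsum (T : choiceType) (F : T -> X) : X :=
  \sum_(t \in [set: T]) F t.

Definition finsupp_in (T : choiceType) (s : seq T) (F : T -> X) :=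
  forall t, t \notin s -> F t = 0.

Lemma fsumE (T : choiceType) (s : seq T) (F : T -> X) :
  uniq s -> finsupp_in s F -> fsum F = \sum_(t <- s) F t.
Proof.
move=> us Fs; rewrite /fsum (fsbigE s) //; last by move=> t _; apply: Fs.
by apply: eq_bigl => t; rewrite in_setT.
Qed.

Lemma fsum_undup (T : choiceType) (s : seq T) (F : T -> X) :
  finsupp_in s F -> fsum F = \sum_(t <- undup s) F t.
Proof.
by move=> Fs; apply: fsumE; rewrite ?undup_uniq // => t; rewrite mem_undup => /Fs.
Qed.

Lemma eq_fsum (T : choiceType) (F G : T -> X) : F =1 G -> fsum F = fsum G.
Proof. by move=> FG; congr fsum; apply/funext. Qed.

Lemma fsum0 (T : choiceType) (F : T -> X) : (forall t, F t = 0) -> fsum F = 0.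
Proof. by move=> F0; rewrite (@fsumE _ [::]) ?big_nil // => t _. Qed.

Lemma fsum1 (T : choiceType) (t0 : T) (F : T -> X) :
  (forall t, t != t0 -> F t = 0) -> fsum F = F t0.
Proof.
move=> F0; rewrite (@fsumE _ [:: t0]) ?big_seq1 // => t.
by rewrite inE => /F0.
Qed.

Lemma fsumD (T : choiceType) (s : seq T) (F G : T -> X) :
  finsupp_in s F -> finsupp_in s G ->
  fsum (fun t => F t + G t) = fsum F + fsum G.
Proof.
move=> Fs Gs; rewrite !(@fsum_undup _ s) ?big_split // => t ts.
by rewrite Fs // Gs // addr0.
Qed.

Lemma fsum_exchange (T T' : choiceType) (s : seq T) (s' : seq T')
    (F : T -> T' -> X) :
  (forall t t', F t t' != 0 -> (t \in s) && (t' \in s')) ->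
  fsum (fun t => fsum (F t)) = fsum (fun t' => fsum (F^~ t')).
Proof.
move=> Fs.
have F0 t t' : ~~ ((t \in s) && (t' \in s')) -> F t t' = 0.
  by move=> h; apply/eqP; apply: contraNT h => /Fs.
rewrite (@fsum_undup _ s); last first.
  by move=> t ts; apply: fsum0 => t'; apply: F0; rewrite (negPf ts).
rewrite (@fsum_undup _ s'); last first.
  by move=> t ts; apply: fsum0 => t'; apply: F0; rewrite (negPf ts) andbF.
under eq_bigr => t _.
  rewrite (@fsum_undup _ s'); last first.
    by move=> t' ts'; apply: F0; rewrite (negPf ts') andbF.
  over.
rewrite exchange_big; apply: eq_bigr => t' _.
by rewrite (@fsum_undup _ s) // => t ts; apply: F0; rewrite (negPf ts).
Qed.

Lemma fsum_bigsum (T : choiceType) (I : Type) (r : seq I) (F : T -> I -> X) :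
  (forall i, exists s : seq T, finsupp_in s (F^~ i)) ->
  fsum (fun t => \sum_(i <- r) F t i) = \sum_(i <- r) fsum (F^~ i).
Proof.
move=> Fs; elim: r => [|i r IH].
  by rewrite big_nil; apply: fsum0 => t; rewrite big_nil.
rewrite big_cons -IH.
have [s1 s1P] := Fs i.
have [s2 s2P] : exists s, finsupp_in s (fun t => \sum_(i <- r) F t i).
  elim: r {IH} => [|j r [s2 s2P]].
    by exists [::] => t _; rewrite big_nil.
  have [s3 s3P] := Fs j; exists (s2 ++ s3) => t.
  by rewrite mem_cat negb_or big_cons => /andP[/s2P -> /s3P ->]; rewrite addr0.
transitivity (fsum (fun t => F t i + \sum_(j <- r) F t j)).
  by apply: eq_fsum => t; rewrite big_cons.
apply: (@fsumD _ (s1 ++ s2)) => t; rewrite mem_cat negb_or => /andP[].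
  by move=> /s1P.
by move=> _ /s2P.
Qed.

Lemma fsum_cons (T : choiceType) (s : seq (seq T)) (F : seq T -> X) :
  F [::] = 0 -> finsupp_in s F ->
  fsum F = fsum (fun x => fsum (fun t => F (x :: t))).
Proof.
move=> Fn Fs.
(* Heads and tails of the support span a finite box that contains it, and over a box the sum is
   iterated. *)
pose s0 := undup (pmap ohead s); pose s1 := undup (map behead s).
have F0 x t : ~~ ((x \in s0) && (t \in s1)) -> F (x :: t) = 0.
  move=> h; apply: Fs; apply: contra h => xts; rewrite !mem_undup.
  by rewrite mem_pmap (map_f ohead xts) (map_f behead xts).
rewrite (@fsumE _ [seq x :: t | x <- s0, t <- s1]); last first.
- move=> [|x t] //; move=> h; apply: F0; apply: contra h => /andP[xs ts].
  by apply/allpairsP; exists (x, t).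
- apply: allpairs_uniq; rewrite ?undup_uniq //.
  by move=> [x1 t1] [x2 t2] _ _ /= [-> ->].
rewrite big_allpairs_dep /= (@fsumE _ s0) ?undup_uniq //; last first.
  by move=> x xs; apply: fsum0 => t; apply: F0; rewrite (negPf xs).
apply: eq_bigr => x _; rewrite (@fsumE _ s1) ?undup_uniq // => t ts.
by apply: F0; rewrite (negPf ts) andbF.
Qed.

Implicit Types F G : nat -> X.

Definition vanish_from (N : nat) F := forall k, (N <= k)%N -> F k = 0.

Lemma vanish_finsupp N F : vanish_from N F -> finsupp_in (iota 0 N) F.
Proof. by move=> FN k; rewrite mem_iota -leqNgt => /FN. Qed.

Lemma nsumE N F : vanish_from N F -> fsum F = \sum_(k < N) F k.
Proof.
move=> FN; rewrite (@fsumE _ (iota 0 N)) ?iota_uniq //; last exact: vanish_finsupp.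
by rewrite -{1}(subn0 N) big_mkord.
Qed.

Lemma nsumS N F : vanish_from N F -> fsum F = F 0%N + fsum (fun k => F k.+1).
Proof.
move=> FN; rewrite (@nsumE N.+1); last by move=> k /ltnW /FN.
rewrite (@nsumE N) ?big_ord_recl //.
by move=> k Nk; apply: FN; apply: leqW.
Qed.

Lemma nsum_shift N m F : vanish_from N F -> (forall k, (k < m)%N -> F k = 0) ->
  fsum F = fsum (fun k => F (m + k)%N).
Proof.
elim: m N F => [|m IH] N F FN Fm; first by apply: eq_fsum => k; rewrite add0n.
rewrite (nsumS FN) Fm // add0r (IH N).
- by apply: eq_fsum => k.
- by move=> k Nk; apply: FN; apply: leqW.
- by move=> k km; apply: Fm.
Qed.

Lemma nsum_diag N (F : nat -> nat -> X) :
  (forall j l, (N <= j + l)%N -> F j l = 0) ->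
  fsum (fun j => fsum (F j)) =
  fsum (fun n => \sum_(j < n.+1) F j (n - j)%N).
Proof.
move=> FN; rewrite (@nsumE N); last first.
  by move=> j Nj; apply: fsum0 => l; apply: FN; apply: leq_trans Nj (leq_addr _ _).
rewrite (@nsumE N); last first.
  by move=> n Nn; apply: big1 => j _; apply: FN; rewrite subnKC // -ltnS.
transitivity (\sum_(j < N) \sum_(n < N | (j <= n)%N) F j (n - j)%N).
  apply: eq_bigr => j _; rewrite (@nsumE (N - j)%N); last first.
    by move=> l; rewrite leq_subLR => /FN.
  rewrite -(big_mkord (fun n => j <= n)%N (fun n => F j (n - j)%N)).
  rewrite (big_cat_nat _ (ltnW (ltn_ord j))) //=.
  rewrite [X in _ = X + _]big_nat_cond [X in _ = X + _]big1 ?add0r; last first.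
    by move=> i /andP[/andP[_ ij]]; rewrite leqNgt ij.
  rewrite -[X in \sum_(X <= _ < _ | _) _](add0n j) big_addn big_mkord.
  by apply: eq_big => i; rewrite ?leq_addl ?addnK.
rewrite (exchange_big_dep xpredT) //=; apply: eq_bigr => n _.
rewrite -(big_mkord (fun j => j <= n)%N (fun j => F j (n - j)%N)).
rewrite (big_cat_nat _ (ltn_ord n)) //= [X in _ + X = _]big_nat_cond.
rewrite [X in _ + X = _]big1 ?addr0; last first.
  by move=> i /andP[/andP[ni _]]; rewrite leqNgt ni.
by rewrite big_mkord; apply: eq_bigl => i; rewrite -ltnS ltn_ord.
Qed.

End FiniteSums.

Lemma fsum_additive (X X' : zmodType) (T : choiceType) (s : seq T)
    (L : X -> X') (F : T -> X) :
  {morph L : x y / x + y} -> L 0 = 0 -> finsupp_in s F ->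
  L (fsum F) = fsum (fun t => L (F t)).
Proof.
move=> LD L0 Fs; rewrite !(@fsum_undup _ _ s) //; last by move=> t /Fs ->.
by rewrite (big_morph L LD L0).
Qed.

(** * Spans and linear maps as plain predicates *)

Section SpanTheory.
Variables (K : nzRingType) (X X' : lmodType K).

(** Stated for arbitrary predicates, so that a whole assertion about a vector, such as an identity
    linear in it, can be proved on a spanning set and then extended. *)
Definition subspace (P : X -> Prop) :=
  P 0 /\ forall c x y, P x -> P y -> P (c *: x + y).

Lemma subspaceD P : subspace P -> forall x y, P x -> P y -> P (x + y).
Proof. by case=> _ PD x y Px Py; rewrite -[x]scale1r; apply: PD. Qed.

Lemma subspaceZ P : subspace P -> forall c x, P x -> P (c *: x).
Proof. by case=> P0 PD c x Px; rewrite -[_ *: _]addr0; apply: PD. Qed.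

Lemma subspaceN P : subspace P -> forall x, P x -> P (- x).
Proof. by move=> sP x Px; rewrite -scaleN1r; apply: subspaceZ. Qed.

Lemma subspaceB P : subspace P -> forall x y, P x -> P y -> P (x - y).
Proof. by move=> sP x y Px Py; apply: subspaceD => //; apply: subspaceN. Qed.

Lemma subspace_sum P (I : Type) (r : seq I) (Q : pred I) (F : I -> X) :
  subspace P -> (forall i, Q i -> P (F i)) -> P (\sum_(i <- r | Q i) F i).
Proof. by move=> sP PF; apply: (big_ind P) => //; [case: sP | apply: subspaceD]. Qed.

Lemma subspace_fsum P (T : choiceType) (F : T -> X) :
  subspace P -> (forall t, P (F t)) -> P (fsum F).
Proof. by move=> sP PF; apply: subspace_sum. Qed.

Lemma lspan_subspace (S : set X) : subspace (lspan S).
Proof.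
by split=> [|c x y Sx Sy]; [apply: lspan0 | apply: lspanD => //; apply: lspanZ].
Qed.

Lemma lspan_min (S : set X) (P : X -> Prop) :
  subspace P -> (forall x, S x -> P x) -> forall x, lspan S x -> P x.
Proof.
move=> sP SP x; elim=> {x} [x /SP//||x y _ Px _ Py|c x _ Px].
- by case: sP.
- exact: subspaceD.
- exact: subspaceZ.
Qed.

End SpanTheory.

Lemma linear_subspace_pre (K : nzRingType) (X X' : lmodType K) (L : X -> X')
    (P : X' -> Prop) :
  linear L -> subspace P -> subspace (fun x => P (L x)).
Proof.
move=> Llin [P0 PD]; split=> [|c x y Px Py]; last by rewrite Llin; apply: PD.
have -> : L 0 = 0; last by [].
by have := Llin (-1) 0 0; rewrite scaler0 addr0 scaleN1r addNr.
Qed.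

Section LinearFacts.
Variables (K : nzRingType) (X X' : lmodType K) (L : X -> X').
Hypothesis Llin : linear L.

Lemma lin0 : L 0 = 0.
Proof. by have := Llin (-1) 0 0; rewrite scaler0 addr0 scaleN1r addNr. Qed.
Lemma linD x y : L (x + y) = L x + L y.
Proof. by have := Llin 1 x y; rewrite !scale1r. Qed.
Lemma linZ c x : L (c *: x) = c *: L x.
Proof. by have := Llin c x 0; rewrite !addr0 lin0 addr0. Qed.
Lemma linN x : L (- x) = - L x.
Proof. by rewrite -scaleN1r linZ scaleN1r. Qed.
Lemma linB x y : L (x - y) = L x - L y.
Proof. by rewrite linD linN. Qed.
Lemma lin_sum (I : Type) (r : seq I) (P : pred I) (F : I -> X) :
  L (\sum_(i <- r | P i) F i) = \sum_(i <- r | P i) L (F i).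
Proof. by rewrite (big_morph L linD lin0). Qed.
Lemma lin_fsum (T : choiceType) (s : seq T) (F : T -> X) :
  finsupp_in s F -> L (fsum F) = fsum (fun t => L (F t)).
Proof. by move=> Fs; apply: (fsum_additive linD lin0 Fs). Qed.
End LinearFacts.

Lemma eq_lin_subspace (K : nzRingType) (X X' : lmodType K) (L1 L2 : X -> X') :
  linear L1 -> linear L2 -> subspace (fun x => L1 x = L2 x).
Proof.
move=> l1 l2; split=> [|c x y e1 e2]; first by rewrite !lin0.
by rewrite l1 l2 e1 e2.
Qed.

Lemma comp_linear (K : nzRingType) (X Y Z : lmodType K) (f : Y -> Z) (g : X -> Y) :
  linear f -> linear g -> linear (fun x => f (g x)).
Proof. by move=> lf lg c x y; rewrite lg lf. Qed.

Lemma scale_linear (K : comNzRingType) (X Y : lmodType K) d (f : X -> Y) :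
  linear f -> linear (fun x => d *: f x).
Proof.
by move=> lf c x y; rewrite lf scalerDr !scalerA mulrC.
Qed.

Lemma add_linear (K : nzRingType) (X Y : lmodType K) (f g : X -> Y) :
  linear f -> linear g -> linear (fun x => f x + g x).
Proof. by move=> lf lg c x y; rewrite lf lg scalerDr addrACA. Qed.

Lemma sum_linear (K : nzRingType) (X Y : lmodType K) (I : Type) (r : seq I)
    (f : I -> X -> Y) :
  (forall i, linear (f i)) -> linear (fun x => \sum_(i <- r) f i x).
Proof.
move=> lf c x y; rewrite scaler_sumr -big_split /=.
by apply: eq_bigr => i _; rewrite lf.
Qed.

Lemma id_linear (K : nzRingType) (X : lmodType K) : linear (fun x : X => x).
Proof. by []. Qed.

(** The powers of x in h(x) lie in Z - [hshift]: the creation part runs over x^(k - hshift) and the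
    annihilation part over x^(-(k+1+hshift)), for natural k. This lets both sectors share one
    recursion. *)
Definition hshift (s : sector) : rat := if s is IntModes then 2^-1 else 0.

(** * Fock modules *)

(* Creation modes (exponent at most 0) and annihilation modes (positive
   exponent), enumerated by natural numbers; the zero mode is a creation mode. *)
Definition cr (s : sector) (k : nat) : int :=
  if s is IntModes then - k%:Z else - k.+1%:Z.
Definition an (s : sector) (k : nat) : int :=
  if s is IntModes then k.+1%:Z else k%:Z.

Lemma expo_cr s k : expo s (cr s k) = - 2^-1 - (k%:R - hshift s).
Proof.
case: s; rewrite /expo /cr /hshift rmorphN /= ?addr0.
  by lra.
by lra.
Qed.

Lemma expo_an s k : expo s (an s k) = 2^-1 + (k%:R + hshift s).
Proof.
case: s; rewrite /expo /an /hshift /= ?addr0; lra.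
Qed.

Lemma expo_an_gt0 s k : 0 < expo s (an s k).
Proof.
rewrite expo_an; have : 0 <= k%:R :> rat by rewrite ler0n.
by case: s => /=; lra.
Qed.

Lemma cr_or_an s n : (exists k, n = cr s k) \/ (exists k, n = an s k).
Proof.
case: s; case: n => k.
- case: k => [|k]; [left; exists 0%N | right; exists k] => //.
- by left; exists k.+1; rewrite NegzE.
- by right; exists k.
- by left; exists k; rewrite NegzE.
Qed.

Lemma fsum_cr_an (X : zmodType) s (r : seq int) (F : int -> X) :
  finsupp_in r F ->
  fsum F = fsum (fun k => F (cr s k)) + fsum (fun k => F (an s k)).
Proof.
move=> Fr.
have crI : injective (cr s).
  by case: (s) => i j /eqP; rewrite /cr ?eqr_opp => /eqP[].
have anI : injective (an s) by case: (s) => i j /eqP /eqP [].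
have disj i j : cr s i != an s j by case: (s); apply/eqP; rewrite /cr /an; lia.
pose N := \max_(i <- r) (absz i).+1.
have Nr (i : int) : i \in r -> (absz i < N)%N.
  by move=> ir; rewrite /N (big_rem i) //= leq_maxl.
have vcr : vanish_from N (fun k => F (cr s k)).
  move=> k Nk; apply: Fr; apply/negP => /Nr; move: Nk; case: (s); rewrite /cr; lia.
have van : vanish_from N (fun k => F (an s k)).
  move=> k Nk; apply: Fr; apply/negP => /Nr; move: Nk; case: (s); rewrite /an; lia.
rewrite (@fsumE _ _ (map (cr s) (iota 0 N) ++ map (an s) (iota 0 N))); last first.
- move=> i; rewrite mem_cat negb_or => /andP[ic ia].
  have [ir|/Fr//] := boolP (i \in r).
  have iN := Nr _ ir; have [[k ik]|[k ik]] := cr_or_an s i.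
    suff : i \in map (cr s) (iota 0 N) by rewrite (negPf ic).
    rewrite ik mem_map // mem_iota /= add0n; move: iN; rewrite ik.
    by case: (s); rewrite /cr; lia.
  suff : i \in map (an s) (iota 0 N) by rewrite (negPf ia).
  rewrite ik mem_map // mem_iota /= add0n; move: iN; rewrite ik.
  by case: (s); rewrite /an; lia.
- rewrite cat_uniq !map_inj_uniq ?iota_uniq //= andbT.
  apply/hasPn => _ /mapP[j _ ->]; apply/mapP => -[i _ /eqP].
  by rewrite eq_sym (negPf (disj _ _)).
rewrite big_cat !big_map (fsumE (iota_uniq 0 N) (vanish_finsupp vcr)).
by rewrite (fsumE (iota_uniq 0 N) (vanish_finsupp van)).
Qed.

(* Sealing the module of words behind a record keeps unification from
   unfolding the quotient. *)
Record fock_module (R : realType) (h : lmodType R[i]) (form : h -> h -> R[i])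
    (s : sector) (U : lmodType R[i]) (act0 : h -> U -> U) := FockModule {
  fsort :> lmodType R[i];
  fmo : h -> int -> fsort -> fsort;
  fov : U -> fsort;
  fwt : fsort -> fsort;
  fmo_linear : forall a n, linear (fmo a n);
  fmo_linear_l : forall n w, linear (fmo ^~ n ^~ w);
  fov_linear : linear fov;
  fmo_anti : forall a b m n w, 0 < expo s m -> expo s n < 0 ->
    fmo a m (fmo b n w) =
    (form a b *+ (expo s m + expo s n == 0)) *: w - fmo b n (fmo a m w);
  fmo_anti_zero : forall a b p z w, expo s p != 0 -> expo s z = 0 ->
    fmo a p (fmo b z w) = - fmo b z (fmo a p w);
  fmo_vac : forall a n u, 0 < expo s n -> fmo a n (fov u) = 0;
  fmo_zero : forall a n u, expo s n = 0 -> fmo a n (fov u) = fov (act0 a u);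
  fwt_linear : linear fwt;
  fwt_mode : forall a n w,
    fwt (fmo a n w) = fmo a n (fwt w) - ratr (expo s n) *: fmo a n w;
  fwt_vect : forall u, fwt (fov u) = 0;
  fmodes_ind : forall P : fsort -> Prop, subspace P -> (forall u, P (fov u)) ->
    (forall a n w, P w -> P (fmo a n w)) -> forall w, P w }.

Section FockTheory.
Variables (R : realType).
Local Notation C := R[i].
Variables (h : lmodType C) (form : h -> h -> C).
Variables (s : sector) (U : lmodType C) (act0 : h -> U -> U).
Local Notation exp := (expo s).
Local Notation W := (fock form s act0).
Local Notation mo := (@mode_op R h form s U act0).
Local Notation ov := (@of_vect R h form s U act0).
Local Notation mode a n := (Some (a, n) : generator h).
Local Notation kk := (None : generator h).
Local Notation pi := (@fock_pi R h form s U act0).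
Local Notation gop := (@gen_op R h form s U act0).
Local Notation mops := (@modes_op R h form s U act0).

Lemma fock_pi_linear : linear pi.
Proof. by move=> c x y; rewrite /fock_pi lquot_piD lquot_piZ. Qed.

Lemma fock_pi_repr (w : W) : pi (repr w) = w.
Proof. exact: lquot_repr. Qed.

Lemma fock_pi_surj (w : W) : exists g, w = pi g.
Proof. by exists (repr w); rewrite fock_pi_repr. Qed.

Lemma descends_linear (f : words h U -> words h U) (L : W -> W) :
  linear f -> (forall g, L (pi g) = pi (f g)) -> linear L.
Proof.
move=> lf Lf c v w; have [g ->] := fock_pi_surj v; have [g' ->] := fock_pi_surj w.
transitivity (L (pi (c *: g + g'))).
  exact: (congr1 L (esym (fock_pi_linear c g g'))).
transitivity (pi (c *: f g + f g')); first by rewrite Lf lf.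
transitivity (c *: pi (f g) + pi (f g')); first exact: fock_pi_linear.
by rewrite (Lf g) (Lf g').

Qed.

Lemma gen_op_linear x : linear (gop x).
Proof. by apply: (descends_linear (lext_is_linear _)) => g; apply: gen_op_pi. Qed.

Lemma mode_op_linear a n : linear (mo a n).
Proof. exact: gen_op_linear. Qed.

Lemma weight_op_linear : linear (@weight_op R h form s U act0).
Proof. by apply: (descends_linear (lext_is_linear _)) => g; apply: weight_op_pi. Qed.

Lemma gen_op_word x l u : gop x (pi (word l u)) = pi (word (x :: l) u).
Proof. by rewrite gen_op_pi /cons_words lextU. Qed.

Lemma weight_op_word l u :
  weight_op (pi (word l u)) = word_weight s l *: pi (word l u).
Proof.
rewrite weight_op_pi /weight_words lextU.
by rewrite (linZ fock_pi_linear).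
Qed.

Lemma words_ind (P : W -> Prop) :
  subspace P -> (forall l u, P (pi (word l u))) -> forall w, P w.
Proof.
move=> sP Pw w; rewrite -(fock_pi_repr w).
have E := monalgE (repr w : @words R h U); rewrite E (lin_sum fock_pi_linear).
apply: subspace_sum => // -[l u] _.
have -> : << (repr w)@_(l, u) *g (l, u) >> = (repr w)@_(l, u) *: word l u.
  by apply/malgP => k; rewrite mcoeffZ !mcoeffU mulr_natr.
by rewrite (linZ fock_pi_linear); apply: subspaceZ.
Qed.

Lemma fock_pi_eq x y : @fock_rel R h form s U act0 (x - y) -> pi x = pi y.
Proof. by move=> rxy; apply/lquot_piP/lspan_gen. Qed.

Lemma fock_pi0 x : @fock_rel R h form s U act0 x -> pi x = 0.
Proof.
move=> rx; rewrite -(lin0 fock_pi_linear); apply: fock_pi_eq; by rewrite subr0.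
Qed.

Lemma eq_on_words (X : lmodType C) (L1 L2 : W -> X) :
  linear L1 -> linear L2 -> (forall l u, L1 (pi (word l u)) = L2 (pi (word l u))) ->
  L1 =1 L2.
Proof. by move=> l1 l2 e; apply: words_ind => //; apply: eq_lin_subspace. Qed.

Lemma mode_op_linear_l n w : linear (mo ^~ n ^~ w).
Proof.
move=> c a b; pose L v := c *: mo a n v + mo b n v.
apply: (@eq_on_words W (mo (c *: a + b) n) L).
- exact: mode_op_linear.
- by apply: add_linear; [apply: scale_linear|]; apply: mode_op_linear.
move=> l u; rewrite /L /mode_op !gen_op_word -fock_pi_linear.
by apply: fock_pi_eq; apply: (rel_modeL form s act0 [::]).
Qed.

Lemma of_vect_linear : linear ov.
Proof.
move=> c u u'; rewrite /of_vect -fock_pi_linear.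
by apply: fock_pi_eq; apply: rel_vectL.
Qed.

Lemma mode_op_word a n l u : mo a n (pi (word l u)) = pi (word (mode a n :: l) u).
Proof. exact: gen_op_word. Qed.

Lemma of_vectE u : ov u = pi (word [::] u).
Proof. by []. Qed.

(** The central element commutes with all modes, hence can be pushed to the right end, where it acts
    on U as 1. This is why [fock_module] mentions no central operator. *)
Lemma k_word l l' u : pi (word (l ++ kk :: l') u) = pi (word (l ++ l') u).
Proof.
elim: l' l => [|[[a n]|] l' IH] l.
- by rewrite cats0 cats1; apply: fock_pi_eq; apply: rel_k.
- transitivity (pi (word (l ++ mode a n :: kk :: l') u)).
    by apply/esym/fock_pi_eq; apply: rel_central.
  by rewrite -cat_rcons IH cat_rcons.
- by rewrite -cat_rcons IH cat_rcons.
Qed.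

Lemma mode_op_anti a b m n w : 0 < exp m -> exp n < 0 ->
  mo a m (mo b n w) =
  (form a b *+ (exp m + exp n == 0)) *: w - mo b n (mo a m w).
Proof.
move=> m0 n0; pose L v := (form a b *+ (exp m + exp n == 0)) *: v - mo b n (mo a m v).
apply: (@eq_on_words W (fun v => mo a m (mo b n v)) L).
- by apply: comp_linear; apply: mode_op_linear.
- apply: add_linear; first exact/scale_linear/id_linear.
  move=> c x y; rewrite (mode_op_linear a m c x y) (mode_op_linear b n c).
  by rewrite opprD scalerN.
move=> l u; rewrite /L !mode_op_word -[word l u]/(word ([::] ++ l) u) -k_word.
apply/eqP; rewrite eq_sym subr_eq eq_sym addrC -subr_eq0; apply/eqP.
rewrite -(linZ fock_pi_linear) -(linD fock_pi_linear) -(linB fock_pi_linear).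
apply: fock_pi0; rewrite [X in X - _]addrC.
exact: (rel_anti form act0 [::] l a b u m0 n0).
Qed.

Lemma mode_op_anti_zero a b p z w : exp p != 0 -> exp z = 0 ->
  mo a p (mo b z w) = - mo b z (mo a p w).
Proof.
move=> p0 z0; apply: (@eq_on_words W (fun v => mo a p (mo b z v)) (fun v => - mo b z (mo a p v))).
- by apply: comp_linear; apply: mode_op_linear.
- move=> c x y; rewrite (mode_op_linear a p c x y) (mode_op_linear b z c).
  by rewrite opprD scalerN.
move=> l u; rewrite !mode_op_word; apply/eqP; rewrite -subr_eq0 opprK; apply/eqP.
rewrite -(linD fock_pi_linear); apply: fock_pi0.
exact: (rel_zero form act0 [::] l a b u p0 z0).
Qed.

Lemma mode_op_vac a n u : 0 < exp n -> mo a n (ov u) = 0.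
Proof.
move=> n0; rewrite of_vectE mode_op_word; apply: fock_pi0.
exact: (rel_pos form act0 [::] a u n0).
Qed.

Lemma mode_op_zero a n u : exp n = 0 -> mo a n (ov u) = ov (act0 a u).
Proof.
move=> n0; rewrite !of_vectE mode_op_word; apply: fock_pi_eq.
exact: (rel_act0 form act0 [::] a u n0).
Qed.

Lemma weight_op_mode a n w :
  weight_op (mo a n w) = mo a n (weight_op w) - ratr (exp n) *: mo a n w.
Proof.
pose L v := mo a n (weight_op v) - ratr (exp n) *: mo a n v.
apply: (@eq_on_words W (fun v => weight_op (mo a n v)) L).
- apply: comp_linear; [exact: weight_op_linear | exact: mode_op_linear].
- apply: add_linear; first apply: comp_linear.
  + exact: mode_op_linear.
  + exact: weight_op_linear.
  + move=> c x y; rewrite mode_op_linear scalerDr opprD scalerN !scalerA.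
    by rewrite [_ * c]mulrC.
move=> l u; rewrite /L mode_op_word !weight_op_word (linZ (mode_op_linear a n)).
rewrite mode_op_word -scalerBl; congr (_ *: _).
by rewrite /word_weight big_cons /= addrC.
Qed.

Lemma weight_op_vect u : weight_op (ov u) = 0.
Proof. by rewrite of_vectE weight_op_word /word_weight big_nil scale0r. Qed.

Lemma modes_ind (P : W -> Prop) : subspace P -> (forall u, P (ov u)) ->
  (forall a n w, P w -> P (mo a n w)) -> forall w, P w.
Proof.
move=> sP Pv Pm; apply: words_ind => //; elim=> [|[[a n]|] l IH] u.
- exact: Pv.
- by rewrite -mode_op_word; apply: Pm.
- by rewrite (k_word [::] l).
Qed.

Definition concrete_fock : fock_module form s act0 := FockModule
  mode_op_linear mode_op_linear_l of_vect_linear mode_op_anti mode_op_anti_zero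
  mode_op_vac mode_op_zero weight_op_linear weight_op_mode weight_op_vect modes_ind.

End FockTheory.

Lemma eigen_independent (K : fieldType) (X : lmodType K) (d : X -> X)
    (r : seq K) (f : K -> X) :
  linear d -> (forall z, d (f z) = z *: f z) -> uniq r ->
  \sum_(z <- r) f z = 0 -> forall z, z \in r -> f z = 0.
Proof.
move=> ld; elim: r f => [|z0 r IH] f df //= /andP[z0r ur].
rewrite big_cons => fr.
have rz z : z \in r -> f z = 0.
  move=> zr; have z0z : z - z0 != 0.
    by rewrite subr_eq0; apply: contraNneq z0r => <-.
  (* Applying d - z0 to the relation kills the component at z0 and rescales the others by nonzero
     factors, which leaves a shorter relation. *)
  pose g z' := (z' - z0) *: f z'.
  suff : g z = 0 by move/eqP; rewrite scaler_eq0 (negPf z0z) => /eqP.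
  apply: IH zr => //; first by move=> z'; rewrite (linZ ld) df !scalerA mulrC.
  have : d (f z0 + \sum_(j <- r) f j) - z0 *: (f z0 + \sum_(j <- r) f j) = 0.
    by rewrite fr (lin0 ld) scaler0 subr0.
  rewrite (linD ld) df scalerDr opprD addrACA subrr add0r (lin_sum ld) scaler_sumr.
  rewrite -sumrB => E; rewrite -[RHS]E; apply: eq_bigr => z' _.
  by rewrite df /g scalerBl.
move=> z; rewrite inE => /orP[/eqP ->|]; last exact: rz.
by rewrite big_seq big1 ?addr0 // in fr.
Qed.

(** * Weights *)

Section Filtration.
Variables (R : realType).
Local Notation C := R[i].
Variables (h : lmodType C) (form : h -> h -> C).
Variables (s : sector) (U : lmodType C) (act0 : h -> U -> U).
Local Notation exp := (expo s).
Variable W : fock_module form s act0.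
Local Notation mo := (@fmo R h form s U act0 W).
Local Notation ov := (@fov R h form s U act0 W).

(** This and several later definitions, such as [wspace], [znord_rec] and [DeltaF], repeat the given
    ones over an abstract [fock_module]. At [concrete_fock] they are convertible with the originals,
    which is how the results are transferred at the end. *)
Definition mops (l : seq (h * int)) (w : W) : W :=
  foldr (fun x => mo x.1 x.2) w l.

Definition wspace (z : C) : set W :=
  lspan [set v | exists l : seq (h * int), exists u : U,
    [/\ all (fun x => exp x.2 < 0) l,
        \sum_(x <- l) - ratr (exp x.2) = z
      & v = mops l (ov u)]]%classic.

Lemma mops_cons a n l w : mops ((a, n) :: l) w = mo a n (mops l w).
Proof. by []. Qed.

(** Weight at most b. A filtration suffices for all truncation arguments and, unlike homogeneity,
    some degree is available for every vector, see [filt_ex]. *)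
Definition filt (b : rat) : W -> Prop :=
  lspan [set v | exists l u, [/\ all (fun x => exp x.2 < 0) l,
    \sum_(x <- l) - exp x.2 <= b & v = mops l (ov u)]]%classic.

Lemma filt_subspace b : subspace (filt b).
Proof. exact: lspan_subspace. Qed.

Lemma filt_mono b b' w : b <= b' -> filt b w -> filt b' w.
Proof.
move=> bb'; move: w; apply: lspan_min; first exact: filt_subspace.
move=> _ [l [u [la lb ->]]]; apply: lspan_gen; exists l, u; split=> //.
exact: le_trans lb bb'.
Qed.

Lemma filt_lt0 b w : b < 0 -> filt b w -> w = 0.
Proof.
move=> b0; move: w; apply: lspan_min.
  by split=> // c x y -> ->; rewrite scaler0 addr0.
move=> v [l [u [la lb _]]]; exfalso.
have : 0 <= \sum_(x <- l) - exp x.2.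
  rewrite big_seq; apply: sumr_ge0 => x xl; rewrite oppr_ge0 ltW //.
  exact: (allP la).
by move=> /le_trans /(_ lb); rewrite leNgt b0.
Qed.

Lemma filt_gen l u : all (fun x => exp x.2 < 0) l ->
  filt (\sum_(x <- l) - exp x.2) (mops l (ov u)).
Proof. by move=> la; apply: lspan_gen; exists l, u. Qed.

(** This contains the normal form of vectors. A nonnegative mode is moved to the right through the
    negative ones until it meets U, where it vanishes or acts as a zero mode; every relation used on
    the way preserves the total exponent. *)
Lemma filt_mode b a n w : filt b w -> filt (b - exp n) (mo a n w).
Proof.
have neg b' a' n' w' : exp n' < 0 -> filt b' w' -> filt (b' - exp n') (mo a' n' w').
  move=> n0; move: w'; apply: lspan_min.
    exact: (linear_subspace_pre (@fmo_linear R h form s U act0 W _ _) (filt_subspace _)).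
  move=> _ [l [u [la lb ->]]]; apply: lspan_gen; exists ((a', n') :: l), u.
  by split; rewrite //= ?n0 // big_cons addrC lerD2r.
move: w; apply: lspan_min.
  exact: (linear_subspace_pre (@fmo_linear R h form s U act0 W _ _) (filt_subspace _)).
move=> _ [l [u [la lb ->]]].
apply: (@filt_mono (\sum_(x <- l) - exp x.2 - exp n)); first by rewrite lerD2r.
have f0 b' := proj1 (filt_subspace b').
elim: l {b lb} la => [|[b k] l IH].
  move=> _; rewrite big_nil sub0r; case: (ltgtP (exp n) 0) => n0.
  - by apply: lspan_gen; exists [:: (a, n)], u; rewrite /= n0 big_seq1.
  - by rewrite (fmo_vac W a u n0).
  - rewrite (fmo_zero W a u n0) n0 oppr0.
    by apply: lspan_gen; exists [::], (act0 a u); rewrite /= big_nil.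
rewrite [all _ _]/= => /andP[k0 la].
have X := filt_gen u la; rewrite big_cons mops_cons [(b, k).2]/=.
have {IH} := IH la; move: X; move: (mops l (ov u)) => v.
move: (\sum_(x <- l) - exp x.2) => t X IH.
case: (ltgtP (exp n) 0) => n0.
- have -> : - exp k + t - exp n = t - exp k - exp n by ring.
  exact: (neg _ a n _ n0 (neg _ b k _ k0 X)).
- rewrite (fmo_anti a b v n0 k0).
  apply: (subspaceB (filt_subspace _)).
    have [nk|_] := eqVneq (exp n + exp k) 0; last by rewrite mulr0n scale0r.
    have -> : - exp k + t - exp n = t by lra.
    exact: (subspaceZ (filt_subspace _)).
  have -> : - exp k + t - exp n = t - exp n - exp k by ring.
  exact: (neg _ b k _ k0 IH).
- rewrite -[mo a n _]opprK -(fmo_anti_zero b a v (negbT (lt_eqF k0)) n0).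
  have -> : - exp k + t - exp n = t - exp n - exp k by ring.
  exact: (subspaceN (filt_subspace _) (neg _ b k _ k0 IH)).
Qed.

Lemma filt_vect u : filt 0 (ov u).
Proof. by apply: lspan_gen; exists [::], u; rewrite big_nil. Qed.

Lemma filt_ex w : exists b, filt b w.
Proof.
move: w; apply: fmodes_ind.
- split=> [|c x y [b1 x1] [b2 y2]]; first by exists 0; case: (filt_subspace 0).
  exists (Num.max b1 b2); apply: (proj2 (filt_subspace _)).
    by apply: filt_mono x1; rewrite le_max lexx.
  by apply: filt_mono y2; rewrite le_max lexx orbT.
- by move=> u; exists 0; apply: filt_vect.
- by move=> a n w [b wb]; exists (b - exp n); apply: filt_mode.
Qed.

Lemma fock_ind (P : W -> Prop) :
  subspace P -> (forall u, P (ov u)) ->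
  (forall a n w, exp n < 0 -> P w -> P (mo a n w)) -> forall w, P w.
Proof.
move=> sP Pv Pm w; have [b] := filt_ex w; move: w; apply: lspan_min => //.
move=> _ [l [u [la _ ->]]]; elim: l la => [|[a n] l IH] /= => [_|/andP[n0 /IH]].
  exact: Pv.
exact: Pm.
Qed.

(** The algebra has no relation between two positive modes. On W they anticommute nevertheless: both
    orders kill U, and moving both modes past a negative one produces the same contractions up to
    sign. *)
Lemma fmo_anti_pos a b m n w : 0 < exp m -> 0 < exp n ->
  mo a m (mo b n w) = - mo b n (mo a m w).
Proof.
move=> m0 n0.
have lm c k := @fmo_linear R h form s U act0 W c k.
move: w; apply: fock_ind.
- apply: eq_lin_subspace; first by apply: comp_linear.
  by move=> c x y; rewrite (lm a m c) (lm b n c) opprD scalerN.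
- by move=> u; rewrite !fmo_vac // !(lin0 (lm _ _)) oppr0.
move=> c k w k0 /= IH.
rewrite (fmo_anti b c w n0 k0).
rewrite (fmo_anti a c w m0 k0).
rewrite (linB (lm a m)).
rewrite (linB (lm b n)).
rewrite (linZ (lm a m)).
rewrite (linZ (lm b n)).
rewrite (fmo_anti a c (mo b n w) m0 k0).
rewrite (fmo_anti b c (mo a m w) n0 k0).
by rewrite IH (linN (lm c k)) !opprB addrA.
Qed.

Lemma fmo_large b a n w : filt b w -> b < exp n -> mo a n w = 0.
Proof. by move=> wb bn; apply: (filt_lt0 _ (filt_mode a n wb)); rewrite subr_lt0. Qed.

Lemma mops_linear l : linear (mops l).
Proof.
elim: l => [|[a n] l IH] c x y //=; rewrite /mops /= -!/(mops _ _).
by rewrite IH fmo_linear.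
Qed.

Lemma fwt_modes l u : fwt (mops l (ov u)) =
  (\sum_(x <- l) - ratr (exp x.2)) *: mops l (ov u).
Proof.
elim: l => [|[a n] l IH]; first by rewrite big_nil scale0r fwt_vect.
rewrite big_cons /= fwt_mode -/(mops l (ov u)) IH.
by rewrite (linZ (@fmo_linear R h form s U act0 W _ _)) scalerDl scaleNr addrC.
Qed.

Lemma wspace_eigen z (w : W) : wspace z w -> fwt w = z *: w.
Proof.
move: w; apply: lspan_min.
  apply: eq_lin_subspace; first exact: fwt_linear.
  exact/scale_linear/id_linear.
by move=> _ [l [u [_ <- ->]]]; apply: fwt_modes.
Qed.

Lemma wspace_graded : @graded R C W wspace.
Proof.
split.
- move=> z; split; first exact: lspan0.
  by move=> c x y Wx Wy; apply: (proj2 (lspan_subspace _)).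
- move=> x.
  suff [r [f [fr [fgr ->]]]] : exists r (f : C -> W), [/\ finsupp_in r f &
      (forall z, wspace z (f z)) /\ x = fsum f].
    by exists (undup r), f; split=> //; apply: fsum_undup.
  have [b] := filt_ex x; move: x; apply: lspan_min.
    split.
      exists [::], (fun _ => 0); split=> //; split=> [z|]; first exact: lspan0.
      by rewrite fsum0.
    move=> c x y [r [f [fr [fgr xE]]]] [r' [f' [fr' [fgr' yE]]]].
    exists (r ++ r'), (fun z => c *: f z + f' z); split=> [z|].
      by rewrite mem_cat negb_or => /andP[/fr -> /fr' ->]; rewrite scaler0 addr0.
    split=> [z|]; first exact: (proj2 (lspan_subspace _) c _ _ (fgr z) (fgr' z)).
    rewrite (@fsumD _ _ (r ++ r')); first last.
    + by move=> z; rewrite mem_cat negb_or => /andP[_ /fr' ->].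
    + by move=> z; rewrite mem_cat negb_or => /andP[/fr -> _]; rewrite scaler0.
    by rewrite xE yE (lin_fsum (scale_linear c (@id_linear _ W)) fr).
  move=> _ [l [u [la _ ->]]].
  pose z0 : C := \sum_(x <- l) - ratr (exp x.2).
  exists [:: z0], (fun z => if z == z0 then mops l (ov u) else 0); split.
    by move=> z; rewrite inE => /negPf ->.
  split=> [z|].
    have [->|_] := eqVneq z z0; last exact: lspan0.
    by apply: lspan_gen; exists l, u.
  rewrite (@fsum1 _ _ z0) ?eqxx // => z /negPf -> //.
move=> r f ur fgr f0 z zr.
apply: (eigen_independent (@fwt_linear R h form s U act0 W) _ ur f0 zr).
by move=> z'; apply: wspace_eigen.
Qed.

Lemma wspace_ge0 (z : C) (w : W) :
  complex.Re z < 0 -> wspace z w -> w = 0.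
Proof.
move=> z0; move: w; apply: lspan_min.
  by split=> // c x y -> ->; rewrite scaler0 addr0.
move=> v [l [u [la lz _]]]; exfalso.
have : 0 <= z.
  rewrite -lz big_seq; apply: sumr_ge0 => x xl; rewrite oppr_ge0 lerq0 ltW //.
  exact: (allP la).
by rewrite lecE /= => /andP[_]; rewrite leNgt z0.
Qed.

End Filtration.

(** * Alternating sums over the removal of one entry, and multilinearity *)

Section Contraction.
Variables (K : nzRingType) (T : Type) (X : lmodType K).
Implicit Types (f g : T -> seq T -> X) (l : seq T).

(* contr f l = \sum_j (-1)^j f l_j (l with its j-th entry removed) *)
Fixpoint contr f l : X :=
  if l is x :: l' then f x l' - contr (fun y l'' => f y (x :: l'')) l' else 0.

Lemma eq_contr f g l : (forall y l', f y l' = g y l') -> contr f l = contr g l.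
Proof. by move=> fg; congr contr; apply/funext => y; apply/funext => l'. Qed.

Lemma contr_lin c f1 f2 f3 l : (forall y l', f3 y l' = c *: f1 y l' + f2 y l') ->
  contr f3 l = c *: contr f1 l + contr f2 l.
Proof.
elim: l f1 f2 f3 => [|x l IH] f1 f2 f3 e /=; first by rewrite scaler0 addr0.
rewrite e (IH (fun y l'' => f1 y (x :: l'')) (fun y l'' => f2 y (x :: l''))) //.
by rewrite scalerBr opprD addrACA.
Qed.

Lemma contr0 f l : (forall y l', f y l' = 0) -> contr f l = 0.
Proof. by elim: l f => [|x l IH] f f0 //=; rewrite f0 IH ?subr0. Qed.

Lemma contrZ c f l : contr (fun y l' => c *: f y l') l = c *: contr f l.
Proof.
rewrite -[RHS]addr0 -(@contr0 (fun _ _ => 0) l) //.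
by apply: contr_lin => y l'; rewrite addr0.
Qed.

Lemma contrD f g l : contr (fun y l' => f y l' + g y l') l = contr f l + contr g l.
Proof. by rewrite -[contr f l]scale1r; apply: contr_lin => y l'; rewrite scale1r. Qed.

Lemma contrN f l : contr (fun y l' => - f y l') l = - contr f l.
Proof. by rewrite -scaleN1r -contrZ; apply: eq_contr => y l'; rewrite scaleN1r. Qed.

Lemma contr_cons f x l :
  contr f (x :: l) = f x l - contr (fun y l'' => f y (x :: l'')) l.
Proof. by []. Qed.

Lemma contr_subspace (P : X -> Prop) (Q : T -> seq T -> Prop) f l :
  subspace P ->
  (forall l1 y l2, l = l1 ++ y :: l2 -> P (f y (l1 ++ l2))) -> P (contr f l).
Proof.
move=> sP; elim: l f => [|x l IH] f Pf /=; first by case: sP.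
apply: subspaceB => //; first exact: (Pf [::]).
by apply: IH => l1 y l2 e; apply: (Pf (x :: l1)); rewrite e.
Qed.

Lemma eq_contr_in f g l :
  (forall l1 y l2, l = l1 ++ y :: l2 -> f y (l1 ++ l2) = g y (l1 ++ l2)) ->
  contr f l = contr g l.
Proof.
elim: l f g => [|x l IH] f g fg //=; rewrite (fg [::] x l) //; congr (_ - _).
by apply: IH => l1 y l2 e; apply: (fg (x :: l1)); rewrite e.
Qed.

(* Removing an entry changes the sign (-1)^(number of p-entries) exactly when
   the entry satisfies p. *)
Lemma contr_sign (p : pred T) (b : bool) f l :
  (forall y l', p y != b -> f y l' = 0) ->
  contr (fun y l' => (-1) ^+ count p l' *: f y l') l =
  (-1) ^+ (b + count p l)%N *: contr f l.
Proof.
elim: l f => [|x l IH] f f0 /=; first by rewrite scaler0.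
rewrite (eq_contr (g := fun y l' => (-1) ^+ count p l' *:
                      ((-1) ^+ p x *: f y (x :: l')))); last first.
  by move=> y l'; rewrite scalerA -exprD addnC.
rewrite IH; last by move=> y l' py; rewrite f0 ?scaler0.
rewrite contrZ scalerA -exprD scalerBr; congr (_ - _ *: _); last first.
  by congr (_ ^+ _); rewrite -addnA [(count _ _ + _)%N]addnC.
have [pb|pb] := eqVneq (p x) b; last by rewrite f0 // !scaler0.
by rewrite pb addnA addnn exprD -mul2n exprM expr2 mulrNN mul1r expr1n mul1r.
Qed.

End Contraction.

Lemma contr_comp (K : nzRingType) (T : Type) (X X' : lmodType K) (L : X -> X')
    (f : T -> seq T -> X) l :
  linear L -> L (contr f l) = contr (fun y l' => L (f y l')) l.
Proof.
move=> lL; elim: l f => [|x l IH] f /=; first exact: lin0.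
by rewrite (linB lL) IH.
Qed.

(** The finite support of the contracted family is proved together with the exchange, because the
    induction needs it to split the sum. *)
Lemma contr_fsum (K : nzRingType) (T : Type) (X : lmodType K) (I : choiceType)
    (f : I -> T -> seq T -> X) l :
  (forall y l', exists r, finsupp_in r (fun i => f i y l')) ->
  (exists r, finsupp_in r (fun i => contr (f i) l)) /\
  fsum (fun i => contr (f i) l) = contr (fun y l' => fsum (fun i => f i y l')) l.
Proof.
elim: l f => [|x l IH] f fr /=; first by split; [exists [::] | rewrite fsum0].
have [r1 r1P] := fr x l.
have [[r2 r2P] <-] := IH (fun i y l'' => f i y (x :: l'')) (fun y l' => fr y (x :: l')).
split.
  exists (r1 ++ r2) => i; rewrite mem_cat negb_or => /andP[/r1P -> /r2P ->].
  by rewrite subr0.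
rewrite (@fsumD _ _ (r1 ++ r2) _ (fun i => - contr (fun y l'' => f i y (x :: l'')) l)).
- congr (_ + _); rewrite (@fsum_additive _ _ _ r2 (-%R : X -> X)) ?oppr0 //.
  exact: opprD.
- by move=> i; rewrite mem_cat negb_or => /andP[/r1P].
- by move=> i; rewrite mem_cat negb_or => /andP[_ /r2P ->]; rewrite oppr0.
Qed.

Section Multilinear.
Variables (K : nzRingType) (V : lmodType K) (I : Type) (X : lmodType K).
Implicit Types f : seq (V * I) -> X.

Definition multilin f := forall c a b i l1 l2,
  f (l1 ++ (c *: a + b, i) :: l2) =
  c *: f (l1 ++ (a, i) :: l2) + f (l1 ++ (b, i) :: l2).

Lemma multilin_cons f x : multilin f -> multilin (fun l => f (x :: l)).
Proof. by move=> mf c a b i l1 l2; apply: (mf c a b i (x :: l1)). Qed.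

Lemma multilin_contr (f : V * I -> seq (V * I) -> X) :
  (forall y, multilin (f y)) ->
  (forall c a b i l, f (c *: a + b, i) l = c *: f (a, i) l + f (b, i) l) ->
  multilin (contr f).
Proof.
move=> mf lf c a b i l1; elim: l1 f mf lf => [|x l1 IH] f mf lf l2 /=.
  rewrite lf (@contr_lin _ _ _ c (fun y l'' => f y ((a, i) :: l''))
    (fun y l'' => f y ((b, i) :: l''))).
    by rewrite scalerBr opprD addrACA.
  by move=> y l''; apply: (mf y c a b i [::]).
rewrite mf IH; first by rewrite scalerBr opprD addrACA.
- by move=> y; apply: multilin_cons.
- by move=> c' a' b' i' l; apply: lf.
Qed.

Lemma multilinZ (a : X -> X) f : linear a -> multilin f -> multilin (fun l => a (f l)).
Proof. by move=> la mf c x y i l1 l2; rewrite mf la. Qed.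

End Multilinear.

(** * The space V and its universal property *)

Section HalfExponents.
Local Notation exp := (expo HalfModes).

Lemma half_ne0 n : exp n != 0.
Proof.
apply/negP => /eqP; rewrite /expo => e.
have e2 : (n * 2 + 1)%:~R = 0 :> rat by rewrite rmorphD rmorphM /=; lra.
by move/eqP: e2; rewrite intr_eq0; apply/negP/eqP; lia.
Qed.

Lemma half_pos (i : nat) : 0 < exp i%:Z.
Proof. by rewrite /expo; have : 0 <= i%:R :> rat := ler0n _ i; lra. Qed.

Lemma half_neg (m : nat) : exp (- m.+1%:Z) < 0.
Proof.
rewrite /expo rmorphN /=; have : 0 <= m%:R :> rat by rewrite ler0n.
by rewrite -addn1 PoszD rmorphD /=; lra.
Qed.

Lemma half_opp (i m : nat) : (exp i%:Z + exp (- m.+1%:Z) == 0) = (i == m).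
Proof.
rewrite /expo addrACA -rmorphD /= -(inj_eq (addIr (-1))) sub0r.
have -> : (2^-1 + 2^-1 : rat) = 1 by lra.
rewrite addrK; have -> : -1 = (-1)%:~R :> rat by [].
rewrite eqr_int; apply/eqP/eqP; lia.
Qed.

End HalfExponents.

Section VertexSpace.
Variables (R : realType).
Local Notation C := R[i].
Variables (h : lmodType C) (form : h -> h -> C).
Local Notation exp := (expo HalfModes).
Variable V : fock_module form HalfModes (U := C^o) (fun _ _ => 0).
Local Notation vac := (fov V (1 : C^o)).

Definition cre (a : h) (m : nat) : V -> V := fmo a (- m.+1%:Z).
Definition ann (a : h) (i : nat) : V -> V := fmo a i%:Z.
Definition mono (l : seq (h * nat)) : V :=
  mops [seq (x.1, - (x.2.+1)%:Z) | x <- l] vac.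

Lemma cre_linear a m : linear (cre a m).
Proof. exact: fmo_linear. Qed.
Lemma ann_linear a m : linear (ann a m).
Proof. exact: fmo_linear. Qed.

Lemma ann_cre a b i m v :
  ann a i (cre b m v) = (form a b *+ (i == m)) *: v - cre b m (ann a i v).
Proof. by rewrite /ann /cre fmo_anti ?half_pos ?half_neg // half_opp. Qed.

Lemma ann_anti a b i j v : ann a i (ann b j v) = - ann b j (ann a i v).
Proof. by rewrite /ann fmo_anti_pos ?half_pos. Qed.

Lemma ann_vac a i : ann a i vac = 0.
Proof. by rewrite /ann fmo_vac ?half_pos. Qed.

Lemma mono_cons a m l : mono ((a, m) :: l) = cre a m (mono l).
Proof. by []. Qed.

Lemma ann_mono a i l :
  ann a i (mono l) = contr (fun y l' => (form a y.1 *+ (i == y.2)) *: mono l') l.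
Proof.
elim: l => [|[b m] l IH]; first by rewrite ann_vac.
rewrite mono_cons ann_cre IH contr_cons; congr (_ - _).
by rewrite (contr_comp _ _ (cre_linear b m)); apply: eq_contr => y l';
   rewrite (linZ (cre_linear b m)).
Qed.

Lemma vertex_ind (P : V -> Prop) :
  subspace P -> P vac -> (forall a m v, P v -> P (cre a m v)) -> forall v, P v.
Proof.
move=> sP Pv Pc; apply: fock_ind => //.
- move=> u; have -> : fov V u = u *: vac.
    by rewrite -(linZ (fov_linear V)); congr fov; rewrite /GRing.scale /= mulr1.
  exact: subspaceZ.
move=> a n v; case: n => [i|m _].
  by rewrite ltNge ltW ?half_pos.
by rewrite NegzE; apply: Pc.
Qed.

Lemma mono_span (P : V -> Prop) :
  subspace P -> (forall l, P (mono l)) -> forall v, P v.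
Proof.
move=> sP Pm v; suff : lspan (range mono) v.
  by move: v; apply: lspan_min => // _ [l _ <-].
move: v; apply: vertex_ind; first exact: lspan_subspace.
  by apply: lspan_gen; exists [::].
move=> a m; apply: lspan_min.
  exact: (linear_subspace_pre (cre_linear a m) (lspan_subspace _)).
by move=> _ [l _ <-]; apply: lspan_gen; exists ((a, m) :: l).
Qed.

Lemma eq_on_mono (X : lmodType C) (L1 L2 : V -> X) :
  linear L1 -> linear L2 -> (forall l, L1 (mono l) = L2 (mono l)) -> L1 =1 L2.
Proof. by move=> l1 l2 e; apply: mono_span => //; apply: eq_lin_subspace. Qed.

End VertexSpace.

Section Lift.
Variables (R : realType).
Local Notation C := R[i].
Variables (h : lmodType C) (form : h -> h -> C).
Hypothesis formDr : forall a c b b', form a (c *: b + b') = c * form a b + form a b'.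
Hypothesis formDl : forall a a' c b, form (c *: a + a') b = c * form a b + form a' b.
Local Notation V := (vertex_space form).
Local Notation mono := (@monomial R h form).
Variable X : lmodType C.
Local Notation F := (seq (h * nat) -> X).
Local Notation mode a n := (Some (a, n) : generator h).
Local Notation kk := (None : generator h).

(* The transposes, on functions of monomials, of the actions of the modes. *)
Definition tmode (f : F) (g : generator h) : F :=
  match g with
  | None => f
  | Some (a, Posz i) => contr (fun y l => (form a y.1 *+ (i == y.2)) *: f l)
  | Some (a, Negz m) => fun l => f ((a, m) :: l)
  end.

Lemma tmode_multilin f g : multilin f -> multilin (tmode f g).
Proof.
case: g => [[a [i|m]]|] //= mf.
  apply: multilin_contr.
    by move=> y; apply: (multilinZ _ mf); apply/scale_linear/id_linear.
  move=> c x y j l /=; case: (i == j); last by rewrite !mulr0n !scale0r scaler0 addr0.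
  by rewrite !mulr1n formDr scalerDl scalerA.
exact: multilin_cons.
Qed.

Lemma tmodes_multilin f w : multilin f -> multilin (foldl tmode f w).
Proof. by elim: w f => [|g w IH] f mf //=; apply/IH/tmode_multilin. Qed.

Lemma tmodes_lin c f1 f2 f3 w : (forall l, f3 l = c *: f1 l + f2 l) ->
  forall l, foldl tmode f3 w l = c *: foldl tmode f1 w l + foldl tmode f2 w l.
Proof.
elim: w f1 f2 f3 => [|g w IH] f1 f2 f3 e //=; apply: IH => l.
case: g => [[a [i|m]]|] //=; apply: contr_lin => y l'.
by rewrite e scalerDr !scalerA mulrC.
Qed.

(** After transposition the anticommutation relation is precisely the cons case of [contr], so it
    holds by computation. *)
Lemma tmode_anti f a b i m l :
  tmode (tmode f (mode a (Posz i))) (mode b (Negz m)) l =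
  (form a b *+ (i == m)) *: f l -
  tmode (tmode f (mode b (Negz m))) (mode a (Posz i)) l.
Proof. by []. Qed.

(** A word of modes applied to the vacuum is evaluated from the left: each mode acts on [f] by its
    transpose, and the final function is read at the empty monomial, which stands for the vacuum. *)
Definition lift_word (f : F) (p : seq (generator h) * C^o) : X :=
  p.2 *: foldl tmode f p.1 [::].

Lemma lift_rel f r : multilin f ->
  @fock_rel R h form HalfModes C^o (fun _ _ => 0) r -> lext (lift_word f) r = 0.
Proof.
move=> mf rel_r.
have lw w (u : C) : lext (lift_word f) (word w u) = u *: foldl tmode f w [::].
  exact: lextU.
have lin := lext_is_linear (lift_word f).
have [[lB lD] lZ] := (linB lin, linD lin, linZ lin).
case: rel_r => [v w c a b n u|w c u u'|v w a b m n u m0 n0|v w a b p z u p0 z0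
               |v w a n u|v a n u n0|v a z u z0|v u].
- rewrite lB lD lZ !lw !foldl_cat /=.
  have mfv := tmodes_multilin v mf; set g := foldl tmode f v in mfv *.
  rewrite (@tmodes_lin c (tmode g (mode a n)) (tmode g (mode b n)));
    first by rewrite scalerDr !scalerA mulrC subrr.
  move=> l; case: n => [i|m] /=; last exact: (mfv c a b m [::]).
  apply: contr_lin => y l'; case: (i == _); last first.
    by rewrite !mulr0n !scale0r scaler0 addr0.
  by rewrite !mulr1n formDl scalerDl scalerA.
- set y := c *: word w u + word w u'.
  have e1 := lB (word w (c *: u + u')) y.
  have e2 : lext (lift_word f) y = (c * u + u') *: foldl tmode f w [::].
    by rewrite /y (lD (c *: word w u)) (lZ c) scalerDl -scalerA; congr (c *: _ + _); exact: lw.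
  by have e3 := lw w (c *: u + u'); rewrite e1 e2 e3 subrr.
- rewrite lB lD lZ !lw !foldl_cat.
  have fc (g' : F) x w' : foldl tmode g' (x :: w') = foldl tmode (tmode g' x) w' by [].
  rewrite !fc; set g := foldl tmode f v.
  case: m m0 => [i _|m m0]; last by exfalso; move: m0; rewrite NegzE ltNge ltW ?half_neg.
  case: n n0 => [n n0|m _]; first by exfalso; move: n0; rewrite ltNge ltW ?half_pos.
  have -> : (expo HalfModes (Posz i) + expo HalfModes (Negz m) == 0) = (i == m).
    by rewrite NegzE half_opp.
  rewrite (@tmodes_lin (-1) (tmode (tmode g (mode b (Negz m))) (mode a (Posz i)))
    (fun l => (form a b *+ (i == m)) *: g l)); last first.
    by move=> l; rewrite tmode_anti scaleN1r addrC.
  have -> : foldl tmode (fun l => (form a b *+ (i == m)) *: g l) w [::] =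
            (form a b *+ (i == m)) *: foldl tmode g w [::].
    rewrite (@tmodes_lin (form a b *+ (i == m)) g (fun => 0)).
      have -> : foldl tmode (fun => 0) w [::] = 0; last by rewrite addr0.
      have := @tmodes_lin (-1) (fun => 0) (fun => 0) (fun => 0) w.
      by move=> -> => [|l]; rewrite ?scaleN1r ?addNr ?scaler0 ?addr0.
    by move=> l; rewrite addr0.
  by rewrite -scalerDr scaleN1r [- _ + _]addrC subrK !scalerA mulrC subrr.
- by exfalso; move: (half_ne0 z); rewrite z0 eqxx.
- by rewrite lB !lw !foldl_cat /= subrr.
- rewrite lw foldl_rcons.
  case: n n0 => [i _|m m0] /=; first by rewrite scaler0.
  by exfalso; move: m0; rewrite NegzE ltNge ltW ?half_neg.
- by exfalso; move: (half_ne0 z); rewrite z0 eqxx.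
- by rewrite lB !lw foldl_rcons /= subrr.
Qed.

(** The monomials satisfy no linear relations beyond multilinearity. The evaluation of words defined
    by [f] kills each defining relation of the induced module, by [lift_rel], and so descends to the
    quotient. Both the naive vertex operators and the parity involution are obtained in this way. *)
Lemma mono_lift (f : F) : multilin f ->
  exists L : V -> X, linear L /\ forall l, L (mono l) = f l.
Proof.
move=> mf; pose L (v : V) := lext (lift_word f) (repr v).
have lin := lext_is_linear (lift_word f).
have Lpi g : L (@fock_pi R h form HalfModes C^o (fun _ _ => 0) g) = lext (lift_word f) g.
  apply/eqP; rewrite -subr_eq0 -(linB lin); apply/eqP.
  have : lspan (@fock_rel R h form HalfModes C^o (fun _ _ => 0))
     (repr (@fock_pi R h form HalfModes C^o (fun _ _ => 0) g) - g).
    by apply/lquot_piP; exact: fock_pi_repr.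
  move: (_ - g); apply: lspan_min; last by move=> r; apply: lift_rel.
  split=> [|c x y x0 y0]; first exact: lin0.
  by rewrite lin x0 y0 scaler0 addr0.
exists L; split.
  move=> c v w; have [g ->] := fock_pi_surj v; have [g' ->] := fock_pi_surj w.
  rewrite (Lpi g) (Lpi g') -(lin c g g') -Lpi; congr L.
  exact/esym/(@fock_pi_linear R h form HalfModes C^o (fun _ _ => 0)).
move=> l.
have -> : mono l = @fock_pi R h form HalfModes C^o (fun _ _ => 0)
    (word [seq mode x.1 (Negz x.2) | x <- l] 1).
  elim: l => [|[a m] l IH]; first exact: of_vectE.
  by rewrite /monomial /= -/(mono l) IH mode_op_word NegzE.
rewrite Lpi lextU /lift_word /= scale1r -[in RHS](cats0 l).
elim: l [::] f {mf lin L Lpi} => [|[a m] l IH] l' f //=.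
Qed.

End Lift.

(** * Normal ordering as a recursion on the leftmost mode *)

Lemma contr_nth (K : nzRingType) (T : Type) (X : lmodType K) x0
    (f : T -> seq T -> X) l :
  contr f l = \sum_(j < size l)
    (-1) ^+ j *: f (nth x0 l j) (take j l ++ drop j.+1 l).
Proof.
elim: l f => [|x l IH] f /=; first by rewrite big_ord0.
rewrite big_ord_recl /= scale1r drop0 IH -sumrN; congr (_ + _).
by apply: eq_bigr => j _; rewrite exprS mulN1r scaleNr.
Qed.

Lemma contr_map (K : nzRingType) (T T' : Type) (X : lmodType K) (g : T -> T')
    (f : T' -> seq T' -> X) l :
  contr f (map g l) = contr (fun y l' => f (g y) (map g l')) l.
Proof. by elim: l f => [|x l IH] f //=; rewrite IH. Qed.

Lemma expo0_ge0 s : 0 <= expo s 0.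
Proof. by case: s; rewrite /expo ?addr0 ?add0r. Qed.

Section NormalOrder.
Variables (R : realType).
Local Notation C := R[i].
Variables (h : lmodType C) (form : h -> h -> C).
Hypothesis formDr : forall a c b b', form a (c *: b + b') = c * form a b + form a b'.
Hypothesis formDl : forall a a' c b, form (c *: a + a') b = c * form a b + form a' b.
Variables (s : sector) (U : lmodType C) (act0 : h -> U -> U).
Local Notation exp := (expo s).
Variable W : fock_module form s act0.
Local Notation mo := (@fmo R h form s U act0 W).
Local Notation mops := (@mops R h form s U act0 W).
Local Notation mlin := (@fmo_linear R h form s U act0 W).
Local Notation listm := (seq (h * int)).

Lemma scaleC (a b : C) (v : W) : a *: (b *: v) = b *: (a *: v).
Proof. by rewrite !scalerA mulrC. Qed.

Lemma moZ a n c w : mo a n (c *: w) = c *: mo a n w.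
Proof. exact: linZ (mlin a n) c w. Qed.
Lemma moB a n v w : mo a n (v - w) = mo a n v - mo a n w.
Proof. exact: linB (mlin a n) v w. Qed.
Lemma moD a n v w : mo a n (v + w) = mo a n v + mo a n w.
Proof. exact: linD (mlin a n) v w. Qed.

Lemma contr_mo a n (T : Type) (f : T -> seq T -> W) l :
  mo a n (contr f l) = contr (fun y l' => mo a n (f y l')) l.
Proof. exact: (contr_comp (L := mo a n) _ _ (mlin a n)). Qed.

Fixpoint znord_rec (k : nat) (l : seq h) (w : W) : W :=
  if k is k'.+1 then
    if l is a :: l' then
      mo a 0 (znord_rec k' l' w)
      + \sum_(j < size l')
          ((-1) ^+ j.+1 / 2%:R * form a l'`_j)
          *: znord_rec k' (take j l' ++ drop j.+1 l') w
    else w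
  else w.

Definition znord (l : seq h) : W -> W := znord_rec (size l) l.

Definition fnord_def (l : listm) (w : W) : W :=
  (-1) ^+ inversions s (map snd l) *:
    mops [seq x <- l | exp x.2 < 0]
      (mops [seq x <- l | 0 < exp x.2]
        (znord [seq x.1 | x <- l & exp x.2 == 0] w)).

(* Locked, lest rewriting with [_ *: _] patterns expose the sign. *)
Fact fnord_key : unit. Proof. by []. Qed.
Definition fnord := locked_with fnord_key fnord_def.

Lemma fnord_unlock : fnord = fnord_def.
Proof. exact: locked_withE. Qed.

Lemma znord_rec_cons k a l w : znord_rec k.+1 (a :: l) w =
  mo a 0 (znord_rec k l w) - contr (fun y l' => (form a y / 2%:R) *: znord_rec k l' w) l.
Proof.
rewrite /= (contr_nth 0) -sumrN; congr (_ + _); apply: eq_bigr => j _.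
rewrite exprS mulN1r -scaleNr scalerA; congr (_ *: _).
by rewrite !mulNr mulrAC mulrA.
Qed.

Lemma znord_rec_irr k k' l w : (size l <= k)%N -> (size l <= k')%N ->
  znord_rec k l w = znord_rec k' l w.
Proof.
elim: k k' l => [|k IH] [|k'] [|a l] //= lk lk'.
rewrite (IH k') //; congr (_ + _); apply: eq_bigr => j _; congr (_ *: _).
have sj : (size (take j l ++ drop j.+1 l) <= size l)%N.
  by rewrite size_cat size_take size_drop ltn_ord; have := ltn_ord j; lia.
by apply: IH; apply: leq_trans sj _.
Qed.

Lemma znord_cons a l w : znord (a :: l) w =
  mo a 0 (znord l w) - contr (fun y l' => (form a y / 2%:R) *: znord l' w) l.
Proof.
rewrite {1}/znord [size _]/= znord_rec_cons; congr (_ - _).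
apply: eq_contr_in => l1 y l2 el; congr (_ *: _); apply: znord_rec_irr => //.
by rewrite el !size_cat /= addnS.
Qed.

Definition znordp (w : W) (l : listm) : W := znord (map fst l) w.

Lemma znordp_cons a n l w : znordp w ((a, n) :: l) =
  mo a 0 (znordp w l) -
  contr (fun y l' => (form a y.1 / 2%:R) *: znordp w l') l.
Proof. by rewrite /znordp [map _ _]/= znord_cons contr_map. Qed.

(* Truncating to lists of a given length makes the recursion hold for globally
   defined functions. *)
Lemma znordp_multilin w : multilin (znordp w).
Proof.
pose g k (l : listm) := if size l == k then znordp w l else 0.
pose gp k := if k is k'.+1 then g k' else fun _ => 0.
suff H : forall k, multilin (g k).
  move=> c a b n l1 l2; have := H (size l1 + (size l2).+1)%N c a b n l1 l2.
  by rewrite /g !size_cat /= eqxx.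
have gE k x l : g k.+1 (x :: l) = mo x.1 0 (g k l) -
    contr (fun y l' => (form x.1 y.1 / 2%:R) *: gp k l') l.
  case: x => a n; rewrite /g /= eqSS znordp_cons; have [sl|sl] := eqVneq (size l) k.
    congr (_ - _); apply: eq_contr_in => l1 y l2 el; congr (_ *: _).
    by rewrite /gp -sl el size_cat /= addnS /g size_cat eqxx.
  rewrite (lin0 (mlin a 0)) sub0r (@eq_contr_in _ _ _ _ (fun _ _ => 0)).
    by rewrite contr0 ?oppr0.
  move=> l1 y l2 el; rewrite /gp; case: k sl => [|k] sl; rewrite ?scaler0 //.
  rewrite /g; case: eqVneq => [sk|_]; last by rewrite scaler0.
  by case/negP: sl; rewrite -sk el !size_cat /= addnS.
move=> k; elim/ltn_ind: k => -[_|k IH].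
  by move=> c a b n l1 l2; rewrite /g !size_cat /= addnS scaler0 addr0.
have mgp : multilin (gp k).
  case: k IH => [|k] IH; last exact: IH.
  by move=> c a b n l1 l2; rewrite /= scaler0 addr0.
move=> c a b n [|x l1] l2; rewrite ?cat0s ?cat_cons !gE.
  rewrite (fmo_linear_l 0) scalerBr addrACA; congr (_ + _).
  rewrite -opprD -contrZ -contrD; congr (- _); apply: eq_contr => y l'.
  by rewrite formDl mulrDl scalerDl scalerA mulrA.
rewrite (IH k) // (mlin x.1 0) scalerBr addrACA; congr (_ + _).
rewrite -opprD; congr (- _).
rewrite (multilin_contr (f := fun y l' => (form x.1 y.1 / 2%:R) *: gp k l')) //.
  by move=> y; apply: (multilinZ _ mgp); apply/scale_linear/id_linear.
by move=> d a' b' i l /=; rewrite formDr mulrDl scalerDl scalerA mulrA.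
Qed.

Implicit Types Z : listm -> W.

Definition nz (l : listm) : nat := count (fun x => exp x.2 != 0) l.

(** Normal ordering with an arbitrary function [Z] of the sublist of zero modes. Peeling off a
    positive or a zero mode changes only what stands at the right end, that is [Z], so inductions on
    the list generalize over it. *)
Definition Sord Z (l : listm) : W :=
  (-1) ^+ inversions s (map snd l) *:
    mops [seq x <- l | exp x.2 < 0]
      (mops [seq x <- l | 0 < exp x.2] (Z [seq x <- l | exp x.2 == 0])).

Lemma fnordE l w : fnord l w = Sord (znordp w) l.
Proof. by rewrite fnord_unlock. Qed.

Lemma Sord_lin c Z1 Z2 Z3 l : (forall l', Z3 l' = c *: Z1 l' + Z2 l') ->
  Sord Z3 l = c *: Sord Z1 l + Sord Z2 l.
Proof.
move=> e; rewrite /Sord e !(mops_linear _ c) scalerDr !scalerA.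
by rewrite [c * _]mulrC.
Qed.

Lemma eq_Sord Z1 Z2 l : (forall l', Z1 l' = Z2 l') -> Sord Z1 l = Sord Z2 l.
Proof. by move=> e; rewrite /Sord e. Qed.

Lemma SordZ c Z l : Sord (fun l' => c *: Z l') l = c *: Sord Z l.
Proof. by rewrite /Sord !(linZ (mops_linear _)) !scalerA mulrC. Qed.

Lemma SordD Z1 Z2 l : Sord (fun l' => Z1 l' + Z2 l') l = Sord Z1 l + Sord Z2 l.
Proof.
rewrite -[Sord Z1 l]scale1r; apply: Sord_lin => l'; by rewrite scale1r.
Qed.

Lemma SordN Z l : Sord (fun l' => - Z l') l = - Sord Z l.
Proof. by rewrite -scaleN1r -SordZ; apply: eq_Sord => l'; rewrite scaleN1r. Qed.

Lemma class_lt n n' : (mode_class s n' < mode_class s n)%N =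
  if exp n < 0 then false else if 0 < exp n then exp n' < 0 else exp n' != 0.
Proof.
rewrite /mode_class; case: (ltgtP (exp n) 0) => n0; case: (ltgtP (exp n') 0) => n'0 //.
Qed.

Lemma inv_cons a n (l : listm) : inversions s (map snd ((a, n) :: l)) =
  (count (fun x => if exp n < 0 then false else if 0 < exp n then exp x.2 < 0
            else exp x.2 != 0)%R l
   + inversions s (map snd l))%N.
Proof.
by rewrite /= count_map; congr (_ + _)%N; apply: eq_count => x /=; rewrite class_lt.
Qed.

Lemma Sord_neg Z a n l : exp n < 0 -> Sord Z ((a, n) :: l) = mo a n (Sord Z l).
Proof.
move=> n0; rewrite /Sord inv_cons /= n0 count_pred0 add0n.
rewrite (@moZ a n) ltNge (ltW n0) /= (lt_eqF n0).
by [].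
Qed.

Lemma mops_past_pos a n l w : 0 < exp n -> all (fun x => 0 < exp x.2) l ->
  mo a n (mops l w) = (-1) ^+ size l *: mops l (mo a n w).
Proof.
move=> n0; elim: l => [|[b k] l IH] /= => [_|/andP[k0 la]]; first by rewrite scale1r.
rewrite fmo_anti_pos // IH // (@moZ b k).
by rewrite exprS mulN1r scaleNr.
Qed.

Lemma mops_past_zero a n l w : exp n = 0 -> all (fun x => exp x.2 != 0) l ->
  mo a n (mops l w) = (-1) ^+ size l *: mops l (mo a n w).
Proof.
move=> n0; elim: l => [|[b k] l IH] /= => [_|/andP[k0 la]]; first by rewrite scale1r.
rewrite -[LHS]opprK -(fmo_anti_zero b a _ k0 n0) IH // (@moZ b k).
by rewrite exprS mulN1r scaleNr.
Qed.

Lemma nzE l : nz l = (count (fun x => exp x.2 < 0)%R l +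
                     count (fun x => 0 < exp x.2)%R l)%N.
Proof.
rewrite /nz; elim: l => //= x l ->.
by case: (ltgtP (exp x.2) 0) => _ /=; lia.
Qed.

Lemma nz_zero l : (nz l + count (fun x => exp x.2 == 0)%R l)%N = size l.
Proof. by rewrite addnC; apply: (count_predC (fun x : h * int => exp x.2 == 0)). Qed.

(** The inversions count the negative modes that the leading mode passes. As positive modes
    anticommute on W, it may then move to the end of its own group, so that it passes all [nz l]
    nonzero modes. *)
Lemma Sord_pos Z a n l : 0 < exp n ->
  Sord Z ((a, n) :: l) = (-1) ^+ nz l *: Sord (fun l' => mo a n (Z l')) l.
Proof.
move=> n0; rewrite /Sord inv_cons /= ltNge (ltW n0) /= n0 (gt_eqF n0) /=.
rewrite mops_past_pos ?filter_all // (linZ (mops_linear _)) !scalerA size_filter.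
congr (_ *: _); rewrite -!exprD nzE; congr (_ ^+ _).
by rewrite [RHS]addnAC.
Qed.

Lemma Sord_zero Z a n l : exp n = 0 ->
  Sord Z ((a, n) :: l) = (-1) ^+ nz l *: Sord (fun l' => Z ((a, n) :: l')) l.
Proof. by move=> n0; rewrite /Sord inv_cons /= n0 ltxx eqxx /= scalerA -exprD. Qed.

Lemma Sord_past_zero Z a n l : exp n = 0 ->
  (-1) ^+ nz l *: Sord (fun l' => mo a n (Z l')) l = mo a n (Sord Z l).
Proof.
move=> n0; rewrite /Sord (@moZ a n).
rewrite mops_past_zero //; last first.
  by apply/allP => x; rewrite mem_filter => /andP[/lt_eqF ->].
rewrite mops_past_zero //; last first.
  by apply/allP => x; rewrite mem_filter => /andP[/gt_eqF ->].
rewrite (linZ (mops_linear _)) !scalerA !size_filter nzE; congr (_ *: _).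
by rewrite -!exprD; congr (_ ^+ _); lia.
Qed.

Lemma nz_cons a n l : nz ((a, n) :: l) = ((exp n != 0)%R + nz l)%N.
Proof. by []. Qed.

Lemma sign_sq n (v : W) : (-1) ^+ n *: ((-1) ^+ n *: v) = v.
Proof. by rewrite scalerA -exprMn mulrNN mulr1 expr1n scale1r. Qed.

(** A removed zero mode contributes a sign for the nonzero modes before it, through the alternation
    of [contr], and one for those after it, through the inversions. Together these are all [nz l] of
    them. *)
Lemma contr_Sord_zero (k : h * int -> C) Z l :
  (forall y, exp y.2 != 0 -> k y = 0) ->
  contr (fun y l' => k y *: Sord Z l') l =
  (-1) ^+ nz l *: Sord (contr (fun y l' => k y *: Z l')) l.
Proof.
move=> k0; elim: l Z => [|[a n] l IH] Z.
  by rewrite /Sord /= !scale1r.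
rewrite contr_cons nz_cons; case: (ltgtP (exp n) 0) => n0 /=.
- rewrite (k0 (a, n)) ?lt_eqF // scale0r sub0r Sord_neg //.
  rewrite exprD expr1 mulN1r scaleNr -(@moZ a n) -IH.
  rewrite contr_mo; congr (- _); apply: eq_contr => y l'.
  by rewrite Sord_neg // -(@moZ a n).
- rewrite (k0 (a, n)) ?gt_eqF // scale0r sub0r Sord_pos // exprD expr1 mulN1r scaleNr.
  rewrite sign_sq; congr (- _).
  rewrite (eq_contr (g := fun y l' => (-1) ^+ nz l' *:
      (k y *: Sord (fun l'' => mo a n (Z l'')) l'))); last first.
    by move=> y l'; rewrite Sord_pos // scaleC.
  rewrite (contr_sign (p := fun x => exp x.2 != 0) (b := false)); last first.
    by move=> y l'; rewrite eqbF_neg negbK => /k0 ->; rewrite scale0r.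
  rewrite add0n -/(nz l) IH sign_sq; apply: eq_Sord => l'.
  rewrite contr_mo; apply: eq_contr => y l''.
  by rewrite (@moZ a n).
- rewrite Sord_zero // add0n sign_sq.
  transitivity (k (a, n) *: Sord Z l - Sord (contr (fun y l' => k y *: Z ((a, n) :: l'))) l).
    congr (_ - _).
    rewrite (eq_contr (g := fun y l' => (-1) ^+ nz l' *:
        (k y *: Sord (fun l'' => Z ((a, n) :: l'')) l'))); last first.
      by move=> y l'; rewrite Sord_zero // scaleC.
    rewrite (contr_sign (p := fun x => exp x.2 != 0) (b := false)); last first.
      by move=> y l'; rewrite eqbF_neg negbK => /k0 ->; rewrite scale0r.
    by rewrite add0n -/(nz l) IH sign_sq.
  by rewrite -SordZ -SordN -SordD; apply: eq_Sord => l'; rewrite contr_cons.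
Qed.

Lemma ann_Sord a n Z l : 0 < exp n ->
  mo a n (Sord Z l) = (-1) ^+ nz l *: Sord (fun l' => mo a n (Z l')) l +
    contr (fun y l' => (form a y.1 *+ (exp n + exp y.2 == 0)) *: Sord Z l') l.
Proof.
move=> n0; elim: l Z => [|[b k] l IH] Z; first by rewrite /Sord /= !scale1r addr0.
pose d (y : h * int) := form a y.1 *+ (exp n + exp y.2 == 0).
have d0 (y : h * int) : (exp y.2 != 0) != true -> d y = 0.
  rewrite eqb_id negbK /d => /eqP ->.
  by rewrite addr0 gt_eqF.
rewrite contr_cons nz_cons; case: (ltgtP (exp k) 0) => k0 /=.
- rewrite !Sord_neg // fmo_anti // IH (@moD b k) (@moZ b k).
  rewrite exprD expr1 mulN1r scaleNr [X in _ - X]addrC opprD addrA addrC; congr (_ + (_ - _)).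
  rewrite contr_mo; apply: eq_contr => y l'.
  by rewrite Sord_neg // -(@moZ b k).
- rewrite Sord_pos // (@moZ a n) IH scalerDr sign_sq.
  rewrite (gt_eqF (addr_gt0 n0 k0)) mulr0n scale0r sub0r.
  congr (_ + _).
    rewrite Sord_pos // exprD expr1 mulN1r scaleNr sign_sq -SordN.
    apply: eq_Sord => l'.
    by rewrite fmo_anti_pos.
  rewrite [X in _ = - X](eq_contr (g := fun y l' => (-1) ^+ nz l' *: (d y *:
     Sord (fun l'' => mo b k (Z l'')) l'))); last first.
    by move=> y l'; rewrite Sord_pos // scaleC.
  rewrite (contr_sign (p := fun x => exp x.2 != 0) (b := true)); last first.
    by move=> y l' /d0 ->; rewrite scale0r.
  by rewrite exprD expr1 mulN1r scaleNr opprK.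
- rewrite Sord_zero // (@moZ a n) IH scalerDr sign_sq k0 addr0 (gt_eqF n0).
  rewrite mulr0n scale0r sub0r; congr (_ + _).
    by rewrite Sord_zero // add0n sign_sq.
  rewrite [X in _ = - X](eq_contr (g := fun y l' => (-1) ^+ nz l' *: (d y *:
     Sord (fun l'' => Z ((b, k) :: l'')) l'))); last first.
    by move=> y l'; rewrite Sord_zero // scaleC.
  rewrite (contr_sign (p := fun x => exp x.2 != 0) (b := true)); last first.
    by move=> y l' /d0 ->; rewrite scale0r.
  by rewrite exprD expr1 mulN1r scaleNr opprK.
Qed.

Lemma Sord_multilin Z : multilin Z -> multilin (Sord Z).
Proof.
move=> mZ c a b n l1; elim: l1 Z mZ => [|[x k] l1 IH] Z mZ l2; rewrite ?cat0s ?cat_cons.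
  case: (ltgtP (exp n) 0) => n0.
  - by rewrite !Sord_neg // (fmo_linear_l _).
  - rewrite !Sord_pos // [X in _ = X + _]scaleC -scalerDr; congr (_ *: _).
    by apply: Sord_lin => l'; rewrite (fmo_linear_l _).
  - rewrite !Sord_zero // [X in _ = X + _]scaleC -scalerDr; congr (_ *: _).
    by apply: Sord_lin => l'; apply: (mZ c a b n [::]).
have nzE' a' : nz (l1 ++ (a', n) :: l2) = nz (l1 ++ (0, n) :: l2).
  by rewrite /nz !count_cat.
case: (ltgtP (exp k) 0) => k0.
- by rewrite !Sord_neg // IH // (mlin x k).
- rewrite !Sord_pos // !nzE' IH; first by rewrite scalerDr [X in X + _ = _]scaleC.
  exact: (multilinZ (mlin x k)).
- rewrite !Sord_zero // !nzE' IH; first by rewrite scalerDr [X in X + _ = _]scaleC.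
  exact: multilin_cons.
Qed.

Lemma fnord_multilin w : multilin (fnord ^~ w).
Proof.
move=> c a b n l1 l2; rewrite !fnordE.
exact: (Sord_multilin (znordp_multilin w)).
Qed.

Lemma fnord_neg a n l w : exp n < 0 -> fnord ((a, n) :: l) w = mo a n (fnord l w).
Proof. by move=> n0; rewrite !fnordE Sord_neg. Qed.

Lemma expo_zero n : exp n = 0 -> n = 0.
Proof. by case: (s) (half_ne0 n) => [_|/eqP //]; rewrite /expo addr0 => /eqP; rewrite intr_eq0 => /eqP. Qed.

Lemma fnord_zero a n l w : exp n = 0 -> fnord ((a, n) :: l) w =
  mo a n (fnord l w) -
  contr (fun y l' => (form a y.1 / 2%:R *+ (exp y.2 == 0)) *: fnord l' w) l.
Proof.
move=> n0; rewrite !fnordE Sord_zero //.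
pose k (y : h * int) := form a y.1 / 2%:R *+ (exp y.2 == 0).
transitivity ((-1) ^+ nz l *: Sord (fun l' => mo a n (znordp w l')) l -
  (-1) ^+ nz l *: Sord (contr (fun y l' => k y *: znordp w l')) l).
  rewrite -scalerBr -SordN -SordD; congr (_ *: _).
  rewrite /Sord; congr (_ *: mops _ (mops _ _)).
  rewrite znordp_cons (expo_zero n0); congr (_ - _).
  apply: eq_contr_in => l1 y l2 el; congr (_ *: _).
  have : y \in [seq x <- l | exp x.2 == 0] by rewrite el mem_cat inE eqxx orbT.
  by rewrite mem_filter /k => /andP[-> _].
rewrite Sord_past_zero // -contr_Sord_zero //; last by move=> y y0; rewrite /k (negPf y0).
by congr (_ - _); apply: eq_contr => y l'; rewrite fnordE.
Qed.

(** In [HalfModes] the index 0 carries the exponent 1/2 and is a positive mode. Since [znord] refers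
    to index 0 in both sectors, both relations are needed. *)
Lemma ann_mode0 a b n w : 0 < exp n -> mo a n (mo b 0 w) = - mo b 0 (mo a n w).
Proof.
move=> n0; case: (ltgtP (exp 0) 0) => z0.
- by move: z0; rewrite ltNge expo0_ge0.
- by rewrite fmo_anti_pos.
- by rewrite fmo_anti_zero // gt_eqF.
Qed.

Lemma znordp_ann a n l w : 0 < exp n ->
  mo a n (znordp w l) = (-1) ^+ size l *: znordp (mo a n w) l.
Proof.
move=> n0; move sm : (size l) => m; elim/ltn_ind: m l sm => m IH [|[b k] l] sm; rewrite -{m}sm in IH *.
  by rewrite scale1r.
rewrite !znordp_cons (@moB a n) ann_mode0 // [size _]/= exprS mulN1r scaleNr scalerBr opprB.
rewrite (IH (size l)) ?ltnS // -[in RHS](@moZ b 0) addrC; congr (_ - _).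
rewrite contr_mo -contrZ -contrN.
apply: eq_contr_in => l1 y l2 el.
rewrite (@moZ a n) (IH (size (l1 ++ l2))) ?el ?size_cat ?ltnS ?leq_add //=.
  by rewrite addnS exprS mulN1r scaleNr scaleC.
by rewrite -/(size _) size_cat /= addnS ltnW.
Qed.

Lemma ann_fnord a n l w : 0 < exp n ->
  mo a n (fnord l w) = (-1) ^+ size l *: fnord l (mo a n w) +
    contr (fun y l' => (form a y.1 *+ (exp n + exp y.2 == 0)) *: fnord l' w) l.
Proof.
move=> n0; rewrite !fnordE ann_Sord //; congr (_ + _); last first.
  by apply: eq_contr => y l'; rewrite fnordE.
rewrite /Sord znordp_ann // !(linZ (mops_linear _)) !scalerA size_filter.
by congr (_ *: _); rewrite -(nz_zero l) exprD mulrAC.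
Qed.

(** The normal ordering puts zero modes to the right of positive ones, but a positive mode
    anticommutes with zero modes and with their half contractions untouched. It can thus act on [w]
    first, at the cost of one sign per remaining factor. *)
Lemma fnord_pos a n l w : 0 < exp n ->
  fnord ((a, n) :: l) w = (-1) ^+ size l *: fnord l (mo a n w).
Proof.
move=> n0; rewrite !fnordE Sord_pos //.
rewrite /Sord znordp_ann // !(linZ (mops_linear _)) !scalerA size_filter.
by congr (_ *: _); rewrite -(nz_zero l) exprD mulrAC.
Qed.

Lemma fnord_nil w : fnord [::] w = w.
Proof. by rewrite fnord_unlock /fnord_def /= scale1r. Qed.

End NormalOrder.

(** * Coefficients of normal ordered products of fields *)

Definition int_box (N : nat) : seq int := [seq i%:Z - N%:Z | i <- iota 0 (2 * N).+1].

Lemma mem_int_box N (n : int) : (`|n| <= N)%N -> n \in int_box N.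
Proof.
move=> nN; apply/mapP; exists (absz (n + N%:Z)); last by lia.
by rewrite mem_iota; lia.
Qed.

Fixpoint seq_box (N k : nat) : seq (seq int) :=
  if k is k'.+1 then [seq n :: t | n <- int_box N, t <- seq_box N k'] else [:: [::]].

Lemma mem_seq_box N ns : all (fun n : int => `|n| <= N)%N ns -> ns \in seq_box N (size ns).
Proof.
elim: ns => [|n ns IH] // /andP[nN nsN]; rewrite [size _]/=.
rewrite -[seq_box _ _]/([seq n :: t | n <- int_box N, t <- seq_box N (size ns)]).
by apply/allpairsP; exists (n, ns); rewrite mem_int_box ?IH.
Qed.

Definition neg_mode (s : sector) (n : int) : int :=
  if s is IntModes then - n else - n - 1.

Lemma expo_neg_mode s n : expo s (neg_mode s n) = - expo s n.
Proof.
case: s; rewrite /expo /neg_mode ?addr0 ?rmorphB ?rmorphN //=; lra.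
Qed.

Lemma expo_inj s : injective (expo s).
Proof. by move=> m n /addIr /eqP; rewrite eqr_int => /eqP. Qed.

Lemma expo_opp_eq s m n : (expo s m + expo s n == 0) = (n == neg_mode s m).
Proof. by rewrite addr_eq0 eq_sym eqr_oppLR -expo_neg_mode (inj_eq (@expo_inj s)). Qed.

Lemma expo_large s (b : rat) : exists N : nat, forall n, expo s n <= b -> - b <= expo s n ->
  (`|n| <= N)%N.
Proof.
exists (Num.bound b).+1 => n nb bn.
have [b0|b0] := ltP b 0; first by lra.
have bB := archi_boundP b0.
suff : `|n%:~R| <= (Num.bound b).+1%:R :> rat.
  rewrite -intr_norm -[(_.+1)%:R]mulrz_nat ler_int; lia.
rewrite ler_norml -natr1; move: nb bn; rewrite /expo; case: s; lra.
Qed.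

Section Fields.
Variables (R : realType).
Local Notation C := R[i].
Variables (h : lmodType C) (s : sector) (X : lmodType C).
Local Notation exp := (expo s).
Local Notation listm := (seq (h * int)).
Local Notation listn := (seq (h * nat)).
Implicit Types (G : listm -> X) (ll : listm) (l : listn) (q : rat) (ns : seq int).

Definition coef_fields ns l : C :=
  \prod_(p <- zip ns l) ratr (gbinom (- exp p.1 - 2^-1) p.2.2).

Definition expo_fields ns l : rat :=
  \sum_(p <- zip ns l) (- exp p.1 - 2^-1 - p.2.2%:R).

(** The term is defined on all lists of indices, with the length as a test instead of a tuple type,
    so that [fsum_cons] can split off the sum over the first index. *)
Definition fterm G l q ns : X :=
  if (size ns == size l) && (expo_fields ns l == q)
  then coef_fields ns l *: G (zip (map fst l) ns) else 0.

Definition nf G l q : X := fsum (fterm G l q).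

(** The one finiteness condition on normal ordered products: too large an annihilation mode gives
    0. *)
Definition bounded_above G :=
  exists B : rat, forall ll, has (fun x => B < exp x.2) ll -> G ll = 0.

Lemma bounded_above_le G : bounded_above G ->
  exists2 B : rat, 0 <= B & forall ll, has (fun x => B < exp x.2) ll -> G ll = 0.
Proof.
case=> B BG; exists (Num.max B 0); first by rewrite le_max lexx orbT.
move=> l /hasP[x xl]; rewrite gt_max => /andP[Bx _]; apply: BG.
by apply/hasP; exists x.
Qed.

Lemma bounded_above_cons G x : bounded_above G -> bounded_above (fun ll => G (x :: ll)).
Proof. by case=> B BG; exists B => l hl; apply: BG; rewrite /= hl orbT. Qed.

Lemma bounded_above_sub G G' : (forall ll, G ll = 0 -> G' ll = 0) ->
  bounded_above G -> bounded_above G'.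
Proof. by move=> GG' [B BG]; exists B => l /BG /GG'. Qed.

Lemma bounded_above_contr (k : h * int -> C) (nu : int) G :
  bounded_above G ->
  bounded_above (contr (fun y ll => (k y *+ (y.2 == nu)) *: G ll)).
Proof.
case/bounded_above_le => B B0 BG; exists (Num.max B (exp nu)) => l /hasP[x xl].
rewrite gt_max => /andP[Bx nux].
rewrite (@eq_contr_in _ _ _ _ (fun _ _ => 0)) ?contr0 // => l1 y l2 el.
have [ynu|_] := eqVneq y.2 nu; last by rewrite mulr0n scale0r.
rewrite BG ?scaler0 //; apply/hasP; exists x => //.
move: xl; rewrite el !mem_cat inE; case: eqVneq => [xy|_ //].
by move: nux; rewrite xy ynu ltxx.
Qed.

Lemma zip_map_fst_size l ns : size ns = size l ->
  map snd (zip (map fst l) ns) = ns.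
Proof. by elim: l ns => [|[a m] l IH] [|n ns] //= [sz]; rewrite IH. Qed.

Lemma has_zip (p : pred int) l ns : size ns = size l ->
  has (fun x => p x.2) (zip (map fst l) ns) = has p ns.
Proof. by move=> sz; rewrite -[in RHS](zip_map_fst_size sz) has_map. Qed.

Lemma sum_expo ns l : size ns = size l ->
  \sum_(n <- ns) - exp n = expo_fields ns l + \sum_(x <- l) (2^-1 + x.2%:R).
Proof.
rewrite /expo_fields; elim: l ns => [|x l IH] [|n ns] //=.
  by rewrite !big_nil addr0.
by case=> sz; rewrite !big_cons (IH _ sz) /=; ring.
Qed.

(** All exponents of a nonzero term are at most B, and the power [q] of x prescribes their sum.
    Hence each of them is also bounded below, and finitely many lists remain. *)
Lemma fterm_supp G l q : bounded_above G -> exists r, finsupp_in r (fterm G l q).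
Proof.
case/bounded_above_le => B B0 BG.
pose Q := q + \sum_(x <- l) (2^-1 + x.2%:R).
have [N NP] := expo_large s (Num.max B (Q + (size l)%:R * B)).
exists (seq_box N (size l)) => ns; rewrite /fterm.
case: andP => // -[/eqP sz /eqP eq] nsN.
have [hB|hB] := boolP (has (fun n => B < exp n) ns).
  by rewrite BG ?scaler0 // (has_zip (fun n => B < exp n) sz).
case/negP: nsN; rewrite -sz; apply: mem_seq_box; apply/allP => n nns.
have nB n' : n' \in ns -> exp n' <= B.
  by move=> n's; rewrite leNgt; apply: contraNN hB => h'; apply/hasP; exists n'.
apply: NP; first by rewrite le_max nB.
have sQ : \sum_(n' <- ns) - exp n' = Q.
  by rewrite /Q -eq -sum_expo.
rewrite lerNl le_max; apply/orP; right.
have -> : - exp n = Q - \sum_(n' <- rem n ns) - exp n'.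
  by rewrite -sQ (big_rem n) //= addrK.
rewrite lerD2l -sumrN; under eq_bigr do rewrite opprK.
apply: le_trans (_ : \sum_(n' <- rem n ns) B <= _).
  by rewrite big_seq [leRHS]big_seq; apply: ler_sum => n' /mem_rem /nB.
rewrite big_const_seq count_predT iter_addr addr0 -[B *+ _]mulr_natl ler_wpM2r //.
by rewrite ler_nat size_rem // -sz leq_pred.
Qed.

Lemma eq_nf G G' l q : (forall ll, size ll = size l -> G ll = G' ll) ->
  nf G l q = nf G' l q.
Proof.
move=> e; apply: eq_fsum => ns; rewrite /fterm; case: andP => // -[/eqP sz _].
by rewrite e // size_zip size_map sz minnn.
Qed.

Lemma nfD G G' l q : bounded_above G -> bounded_above G' ->
  nf (fun ll => G ll + G' ll) l q = nf G l q + nf G' l q.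
Proof.
move=> bG bG'; have [r rP] := fterm_supp l q bG; have [r' rP'] := fterm_supp l q bG'.
rewrite /nf -(@fsumD _ _ (r ++ r')); last 2 first.
- by move=> t; rewrite mem_cat negb_or => /andP[/rP].
- by move=> t; rewrite mem_cat negb_or => /andP[_ /rP'].
apply: eq_fsum => ns; rewrite /fterm.
by case: andP; rewrite ?scalerDr ?addr0.
Qed.

Lemma nfZ c G l q : bounded_above G -> nf (fun ll => c *: G ll) l q = c *: nf G l q.
Proof.
move=> bG; have [r rP] := fterm_supp l q bG.
rewrite /nf (lin_fsum (scale_linear c (@id_linear _ X)) rP).
apply: eq_fsum => ns; rewrite /fterm; case: andP; rewrite ?scaler0 //.
by rewrite !scalerA mulrC.
Qed.

Lemma nfN G l q : bounded_above G -> nf (fun ll => - G ll) l q = - nf G l q.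
Proof.
move=> bG; rewrite -scaleN1r -nfZ //; apply: eq_nf => l' _.
by rewrite scaleN1r.
Qed.

Lemma nf_nil G q : nf G [::] q = if q == 0 then G [::] else 0.
Proof.
rewrite /nf (@fsum1 _ _ [::]).
  rewrite /fterm /expo_fields /coef_fields /= !big_nil eq_sym.
  by rewrite scale1r.
by case=> // n ns _; rewrite /fterm.
Qed.

Lemma nf_cons G a m l q : bounded_above G ->
  nf G ((a, m) :: l) q =
  fsum (fun n => ratr (gbinom (- exp n - 2^-1) m) *:
    nf (fun ll => G ((a, n) :: ll)) l (q + exp n + 2^-1 + m%:R)).
Proof.
move=> bG; have [r rP] := fterm_supp ((a, m) :: l) q bG.
rewrite /nf (fsum_cons _ rP) //; apply: eq_fsum => n.
have [r' rP'] := fterm_supp l (q + exp n + 2^-1 + m%:R) (bounded_above_cons (a, n) bG).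
rewrite (lin_fsum (scale_linear _ (@id_linear _ X)) rP'); apply: eq_fsum => ns.
rewrite /fterm /= eqSS /expo_fields /coef_fields /= !big_cons /=.
have -> : (- exp n - 2^-1 - m%:R + \sum_(j <- zip ns l) (- exp j.1 - 2^-1 - j.2.2%:R) == q) =
  (\sum_(j <- zip ns l) (- exp j.1 - 2^-1 - j.2.2%:R) == q + exp n + 2^-1 + m%:R).
  by apply/eqP/eqP => e; lra.
by case: andP => _; rewrite ?scaler0 // scalerA.
Qed.

Lemma nf_cons_supp G a m l q : bounded_above G ->
  exists r, finsupp_in r (fun n => ratr (gbinom (- exp n - 2^-1) m) *:
    nf (fun ll => G ((a, n) :: ll)) l (q + exp n + 2^-1 + m%:R)).
Proof.
move=> bG; have [r rP] := fterm_supp ((a, m) :: l) q bG.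
exists (pmap ohead r) => n nr; apply/eqP; rewrite scaler_eq0; apply/orP.
case: (eqVneq (ratr (gbinom (- exp n - 2^-1) m) : C) 0) => [|c0]; [by left|right].
apply/eqP/fsum0 => ns; apply/eqP; move: (rP (n :: ns)).
rewrite /fterm /= eqSS /expo_fields /coef_fields /= !big_cons /=.
have -> : (- exp n - 2^-1 - m%:R + \sum_(j <- zip ns l) (- exp j.1 - 2^-1 - j.2.2%:R) == q) =
  (\sum_(j <- zip ns l) (- exp j.1 - 2^-1 - j.2.2%:R) == q + exp n + 2^-1 + m%:R).
  by apply/eqP/eqP => e; lra.
case: andP => // _ /(_ _)/eqP; rewrite -scalerA scaler_eq0 (negPf c0) /= => -> //.
by apply: contra nr => nsr; rewrite mem_pmap; apply/mapP; exists (n :: ns).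
Qed.

(** Contracting against one fixed mode [nu] collapses the sum over the index of the removed field:
    it leaves the coefficient of that field at [nu] and shifts the power of x accordingly. *)
Lemma nf_contr (k : h -> C) (nu : int) G l q : bounded_above G ->
  nf (contr (fun y ll => (k y.1 *+ (y.2 == nu)) *: G ll)) l q =
  contr (fun y l' => (ratr (gbinom (- exp nu - 2^-1) y.2) * k y.1) *:
    nf G l' (q + exp nu + 2^-1 + y.2%:R)) l.
Proof.
elim: l G q => [|[a m] l IH] G q bG; first by rewrite nf_nil /= if_same.
have bGn n := bounded_above_cons (a, n) bG.
rewrite nf_cons; last exact: (bounded_above_contr (fun y => k y.1) nu).
pose F1 n : X := ratr (gbinom (- exp n - 2^-1) m) *:
  nf (fun ll => (k a *+ (n == nu)) *: G ll) l (q + exp n + 2^-1 + m%:R).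
pose F2 n : X := - contr (fun y l' =>
   (ratr (gbinom (- exp nu - 2^-1) y.2) * k y.1) *:
   (ratr (gbinom (- exp n - 2^-1) m) *:
    nf (fun ll => G ((a, n) :: ll)) l' (q + exp nu + 2^-1 + y.2%:R + exp n + 2^-1 + m%:R))) l.
have F12 n : ratr (gbinom (- exp n - 2^-1) m) *:
    nf (fun ll => contr (fun y ll' => (k y.1 *+ (y.2 == nu)) *: G ll') ((a, n) :: ll)) l
      (q + exp n + 2^-1 + m%:R) = F1 n + F2 n.
  rewrite (eq_nf (G' := fun ll => (k a *+ (n == nu)) *: G ll -
     contr (fun y ll' => (k y.1 *+ (y.2 == nu)) *: G ((a, n) :: ll')) ll)) //.
  have bc := bounded_above_contr (fun y => k y.1) nu (bGn n).
  rewrite nfD; first last.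
  - by apply: bounded_above_sub bc => l' ->; rewrite oppr0.
  - by apply: bounded_above_sub bG => l' ->; rewrite scaler0.
  rewrite nfN // IH // scalerDr; congr (_ + _); rewrite /F2 scalerN -contrZ; congr (- _).
  apply: eq_contr => y l'; rewrite !scalerA mulrC; congr (_ *: nf _ _ _); ring.
have F1nu n : n != nu -> F1 n = 0.
  move=> /negPf nnu; rewrite /F1 nnu nfZ // mulr0n scale0r scaler0 //.
have F2fin y l' : exists r, finsupp_in r (fun n =>
   (ratr (gbinom (- exp nu - 2^-1) y.2) * k y.1) *:
   (ratr (gbinom (- exp n - 2^-1) m) *:
    nf (fun ll => G ((a, n) :: ll)) l' (q + exp nu + 2^-1 + y.2%:R + exp n + 2^-1 + m%:R))).
  have [r rP] := nf_cons_supp a m l' (q + exp nu + 2^-1 + y.2%:R) bG.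
  by exists r => n /rP ->; rewrite scaler0.
have [[r rP] F2E] := contr_fsum l F2fin.
rewrite (eq_fsum F12) (@fsumD _ _ (nu :: r)); first last.
- by move=> n; rewrite inE negb_or => /andP[_ /rP]; rewrite /F2 => ->; rewrite oppr0.
- by move=> n; rewrite inE negb_or => /andP[/F1nu].
rewrite contr_cons (fsum1 F1nu); congr (_ + _).
  by rewrite /F1 eqxx mulr1n nfZ // scalerA; congr (_ *: nf _ _ _); ring.
rewrite /F2 -(@fsum_additive _ _ _ r (-%R : X -> X)) ?oppr0 //; last exact: opprD.
rewrite F2E; congr (- _); apply: eq_contr => y l'.
have [r' rP'] := nf_cons_supp a m l' (q + exp nu + 2^-1 + y.2%:R) bG.
by rewrite -(lin_fsum (scale_linear _ (@id_linear _ X)) rP') -nf_cons.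
Qed.

End Fields.

Lemma nf_map (R : realType) (h : lmodType R[i]) (s : sector) (X X' : lmodType R[i])
    (L : X -> X') (G : seq (h * int) -> X) l q : linear L ->
  bounded_above s G -> nf s (fun ll => L (G ll)) l q = L (nf s G l q).
Proof.
move=> lL bG; have [r rP] := fterm_supp l q bG.
rewrite /nf (lin_fsum lL rP); apply: eq_fsum => ns; rewrite /fterm.
by case: andP; rewrite ?(lin0 lL) // (linZ lL).
Qed.

(** * Recursion and commutation rules for products of fields *)

Section VertexModes.
Variables (R : realType).
Local Notation C := R[i].
Variables (h : lmodType C) (form : h -> h -> C).
Hypothesis formDr : forall a c b b', form a (c *: b + b') = c * form a b + form a b'.
Hypothesis formDl : forall a a' c b, form (c *: a + a') b = c * form a b + form a' b.
Variables (s : sector) (U : lmodType C) (act0 : h -> U -> U).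
Local Notation exp := (expo s).
Local Notation hs := (hshift s).
Variable W : fock_module form s act0.
Local Notation mo := (@fmo R h form s U act0 W).
Local Notation mops := (@mops R h form s U act0 W).
Local Notation mlin := (@fmo_linear R h form s U act0 W).
Local Notation flin := (@fwt_linear R h form s U act0 W).
Local Notation listm := (seq (h * int)).
Local Notation listn := (seq (h * nat)).
Local Notation nrd := (@fnord R h form s U act0 W).
Implicit Types (ll : listm) (l : listn) (w : W).

Lemma znord_linear (l : seq h) : linear (@znord R h form s U act0 W l).
Proof.
suff H k (l' : seq h) : linear (@znord_rec R h form s U act0 W k l') by exact: H.
elim: k l' => [|k IH] [|a l'] //=.
apply: add_linear; first exact: comp_linear (mlin a 0) (IH l').
by apply: sum_linear => j; apply: scale_linear.
Qed.

Lemma fnord_linear (ll : listm) : linear (nrd ll).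
Proof.
rewrite fnord_unlock; apply/scale_linear/comp_linear; first exact: mops_linear.
by apply: comp_linear; [exact: mops_linear | exact: znord_linear].
Qed.

(** A positive mode reaches [w], by [fnord_pos], and kills it once its exponent exceeds the degree
    of [w]; smaller positive modes only lower that degree. The bound is chosen nonnegative so that
    negative and zero modes never exceed it. *)
Lemma bounded_fnord w : bounded_above s (nrd ^~ w).
Proof.
have [b b_ge0 wb] : exists2 b, 0 <= b & filt b w.
  have [b0 wb0] := filt_ex w; exists (Num.max b0 0); first by rewrite le_max lexx orbT.
  by apply: filt_mono wb0; rewrite le_max lexx.
exists b => ll; move sm : (size ll) => m.
elim/ltn_ind: m ll sm w wb => m IH [|[a n] l] // sm w wb.
rewrite -{m}sm in IH; rewrite /= => /orP hb; case: (ltgtP (exp n) 0) => n0.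
- rewrite (fnord_neg a l w n0) (IH (size l)) ?(lin0 (mlin a n)) //.
  by case: hb => //; rewrite ltNge (le_trans (ltW n0)).
- rewrite (fnord_pos a l w n0); have [bn|nb] := ltP b (exp n).
    by rewrite (fmo_large a wb bn) (lin0 (fnord_linear l)) scaler0.
  rewrite (IH (size l)) ?scaler0 //; last by case: hb => //; rewrite ltNge nb.
  by apply: filt_mono (filt_mode a n wb); rewrite gerBl ltW.
- have hl : has (fun x => b < exp x.2) l.
    by case: hb => //; rewrite n0 ltNge b_ge0.
  rewrite (fnord_zero a l w n0) (IH (size l)) // (lin0 (mlin a n)) sub0r.
  rewrite (@eq_contr_in _ _ _ _ (fun _ _ => 0)) ?contr0 ?oppr0 // => l1 y l2 el.
  have [y0|_] := eqVneq (exp y.2) 0; last by rewrite mulr0n scale0r.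
  rewrite (IH (size (l1 ++ l2))) ?scaler0 //.
    by rewrite el /= !size_cat /= addnS.
  have /hasP[x xl bx] := hl; apply/hasP; exists x => //.
  move: xl; rewrite el !mem_cat inE; case: eqVneq => [xy|_ //].
  by move: bx; rewrite xy y0 ltNge b_ge0.
Qed.

Lemma filtZ b c w : filt b w -> filt b (c *: w).
Proof. exact: (subspaceZ (filt_subspace W b)). Qed.
Lemma filtB b v w : filt b v -> filt b w -> filt b (v - w).
Proof. exact: (subspaceB (filt_subspace W b)). Qed.
Lemma filt0 b : filt b (0 : W).
Proof. by case: (filt_subspace W b). Qed.

Lemma fnord_filt b ll w : filt b w -> filt (b - \sum_(x <- ll) exp x.2) (nrd ll w).
Proof.
move sm : (size ll) => m; elim/ltn_ind: m b ll sm w => m IH b [|[a n] l] sm w wb.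
  by rewrite big_nil subr0 fnord_nil.
rewrite -{m}sm in IH; rewrite big_cons /=; case: (ltgtP (exp n) 0) => n0.
- rewrite (fnord_neg a l w n0) opprD [- _ - _]addrC addrA.
  by apply: filt_mode; apply: (IH (size l)).
- rewrite (fnord_pos a l w n0) opprD addrA; apply: filtZ.
  by apply: (IH (size l)) => //; apply: filt_mode.
- rewrite (fnord_zero a l w n0); apply: filtB.
    by rewrite opprD [- _ - _]addrC addrA; apply: filt_mode; apply: (IH (size l)).
  rewrite n0 add0r; apply: (@contr_subspace _ _ _ _ (fun _ _ => True)).
    exact: filt_subspace.
  move=> l1 y l2 el; have [y0|_] := eqVneq (exp y.2) 0; last first.
    by rewrite mulr0n scale0r; apply: filt0.
  apply: filtZ.
  have -> : \sum_(x <- l) exp x.2 = \sum_(x <- l1 ++ l2) exp x.2.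
    by rewrite el !big_cat big_cons /= y0 add0r.
  by apply: (IH (size (l1 ++ l2))) => //; rewrite el /= !size_cat /= addnS.
Qed.

Lemma fnord_wt ll w : fwt (nrd ll w) =
  nrd ll (fwt w) - ratr (\sum_(x <- ll) exp x.2) *: nrd ll w.
Proof.
move sm : (size ll) => m; elim/ltn_ind: m ll sm w => m IH [|[a n] l] sm w.
  by rewrite big_nil rmorph0 scale0r subr0 !fnord_nil.
rewrite -{m}sm in IH; rewrite big_cons [(a, n).2]/= rmorphD /=.
case: (ltgtP (exp n) 0) => n0.
- rewrite !(fnord_neg a l _ n0) fwt_mode (IH (size l)) // moB.
  by rewrite moZ scalerDl opprD addrA addrAC.
- rewrite !(fnord_pos a l _ n0) (linZ flin) (IH (size l)) //.
  rewrite fwt_mode (linB (fnord_linear l)) (linZ (fnord_linear l)).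
  rewrite [X in _ = _ - X]scaleC -scalerBr; congr (_ *: _).
  by rewrite scalerDl opprD addrA.
- rewrite !(fnord_zero a l _ n0) (linB flin) fwt_mode n0 rmorph0 scale0r subr0.
  rewrite add0r (IH (size l)) // moB moZ scalerBr.
  pose kz (y : h * int) := form a y.1 / 2%:R *+ (exp y.2 == 0).
  set F := fwt (contr _ _); set c1 := contr (fun y ll => kz y *: nrd ll (fwt w)) l.
  set c2 := contr (fun y ll => kz y *: nrd ll w) l.
  suff -> : F = c1 - ratr (\sum_(j <- l) exp j.2) *: c2.
    by rewrite !opprB [LHS]addrACA [RHS]addrACA [- c1 + _]addrC.
  rewrite /F /c1 /c2 (contr_comp (L := @fwt R h form s U act0 W) _ _ flin).
  rewrite -contrZ -contrN -contrD; apply: eq_contr_in => l1 y l2 el.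
  rewrite /kz; have [y0|_] := eqVneq (exp y.2) 0; last first.
    by rewrite mulr0n !scale0r scaler0 (lin0 flin) oppr0 addr0.
  rewrite (linZ flin) (IH (size (l1 ++ l2))) //; last first.
    by rewrite el /= !size_cat /= addnS.
  have -> : \sum_(x <- l) exp x.2 = \sum_(x <- l1 ++ l2) exp x.2.
    by rewrite el !big_cat big_cons /= y0 add0r.
  by rewrite scalerBr; congr (_ - _); apply: scaleC.
Qed.

Definition NF (l : listn) (q : rat) (w : W) : W := nf s (nrd ^~ w) l q.

Lemma NF_nil q w : NF [::] q w = if q == 0 then w else 0.
Proof. by rewrite /NF nf_nil fnord_nil. Qed.

(* The coefficients of the contraction (1/2) x^(-1/2) y^(-1/2) of two zero
   modes. *)
Definition Knaive (m i : nat) : rat :=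
  if s is IntModes then - 2^-1 * gbinom (- 2^-1) m * gbinom (- 2^-1) i else 0.

Lemma expo_cr_eq0 k : (exp (cr s k) == 0) = (if s is IntModes then k == 0%N else false).
Proof.
case: (s) => /=; last exact/negbTE/half_ne0.
by rewrite /expo /cr addr0 intr_eq0; apply/eqP/eqP; lia.
Qed.

(** The mode sum of the leftmost field is split at exponent 0. The creation half stays outside, the
    annihilation half goes to [w], and the recursion for zero modes leaves the half contraction
    recorded by [Knaive]. *)
Lemma NF_cons a m l q w : NF ((a, m) :: l) q w =
  fsum (fun k => ratr (gbinom (k%:R - hs) m) *:
    mo a (cr s k) (NF l (q - (k%:R - hs) + m%:R) w)) +
  fsum (fun k => ratr (gbinom (- (k.+1%:R + hs)) m) *:
    ((-1) ^+ size l *: NF l (q + (k.+1%:R + hs) + m%:R) (mo a (an s k) w))) +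
  contr (fun y l' => (ratr (Knaive m y.2) * form a y.1) *:
    NF l' (q + m%:R + y.2%:R + 1) w) l.
Proof.
have bw := bounded_fnord w.
have [r rP] := nf_cons_supp a m l q bw.
rewrite {1}/NF nf_cons // (fsum_cr_an s rP) addrAC; congr (_ + _); last first.
  apply: eq_fsum => k; have e := expo_an s k.
  have -> : - exp (an s k) - 2^-1 = - (k.+1%:R + hs) by rewrite e; lra.
  congr (_ *: _).
  rewrite (@eq_nf _ _ s _ _ (fun ll => (-1) ^+ size l *: nrd ll (mo a (an s k) w))); last first.
    by move=> ll sz; rewrite fnord_pos ?expo_an_gt0 // sz.
  rewrite nfZ; last exact: bounded_fnord.
  by congr (_ *: nf _ _ _ _); rewrite e; lra.
pose F k := ratr (gbinom (- exp (cr s k) - 2^-1) m) *: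
  nf s (fun ll => nrd ((a, cr s k) :: ll) w) l (q + exp (cr s k) + 2^-1 + m%:R).
pose A k := ratr (gbinom (k%:R - hs) m) *: mo a (cr s k) (NF l (q - (k%:R - hs) + m%:R) w).
pose c := contr (fun y l' => (ratr (Knaive m y.2) * form a y.1) *:
    NF l' (q + m%:R + y.2%:R + 1) w) l.
(* The extra term caused by the zero mode: it occurs for k = 0 in [IntModes] and never in
   [HalfModes]. *)
pose D k := if exp (cr s k) == 0 then c else 0.
have gE k : - exp (cr s k) - 2^-1 = k%:R - hs by rewrite expo_cr; lra.
have qE k : q + exp (cr s k) + 2^-1 + m%:R = q - (k%:R - hs) + m%:R by rewrite expo_cr; lra.
have FE k : F k = A k + D k.
  rewrite /F gE qE; have mnf := nf_map l (q - (k%:R - hs) + m%:R) (mlin a (cr s k)) bw.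
  have [z0|nz0] := eqVneq (exp (cr s k)) 0; last first.
    rewrite /D (negPf nz0) addr0 /A; congr (_ *: _); rewrite /NF -mnf; apply: eq_nf => ll _.
    apply: fnord_neg; rewrite lt_neqAle nz0 expo_cr.
    have : 0 <= k%:R :> rat := ler0n _ k.
    by case: (s) => /=; lra.
  rewrite (@eq_nf _ _ s _ _ (fun ll => mo a (cr s k) (nrd ll w) +
      - contr (fun y ll' => (form a y.1 / 2%:R *+ (y.2 == cr s k)) *: nrd ll' w) ll)); last first.
    move=> ll _; rewrite (fnord_zero a ll w z0); congr (_ - _); apply: eq_contr => y ll'.
    by rewrite -z0 (inj_eq (@expo_inj s)).
  have bc := bounded_above_contr (fun y => form a y.1 / 2%:R) (cr s k) bw.
  rewrite nfD; first last.
  - by apply: bounded_above_sub bc => ll ->; rewrite oppr0.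
  - by apply: bounded_above_sub bw => ll ->; rewrite (lin0 (mlin a (cr s k))).
  rewrite mnf nfN // (nf_contr (fun y => form a y / 2%:R)) // scalerDr; congr (_ + _).
  rewrite /D z0 eqxx /c scalerN -contrZ -contrN; apply: eq_contr => y l'.
  have k0 := expo_cr_eq0 k; rewrite z0 eqxx in k0.
  rewrite oppr0 sub0r addr0 scalerA -scaleNr; congr (_ *: NF _ _ _).
    move: k0; rewrite /Knaive; case: (s) => // /esym/eqP -> /=.
    rewrite sub0r; move: (gbinom (- 2^-1) m) (gbinom (- 2^-1) y.2) => b1 b2.
    by rewrite !rmorphM /= rmorphN /= fmorphV /= ratr_nat; ring.
  by move: k0; case: (s) => // /esym/eqP -> /=; lra.
have Dfin : vanish_from 1 D.
  move=> k k0; rewrite /D; have -> // : (exp (cr s k) == 0) = false.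
  by rewrite expo_cr_eq0; case: (s); rewrite // (gtn_eqF k0).
have [N FN] : exists N, vanish_from N F.
  pose N := \max_(i <- r) (absz i).+1; exists N => k Nk; apply: rP; apply/negP => kr.
  have : (absz (cr s k) < N)%N by rewrite /N (big_rem (cr s k)) //= leq_maxl.
  by case: (s) kr; rewrite /cr; lia.
pose M := (N + 1)%N.
have DM : vanish_from M D by move=> k Mk; apply: Dfin; rewrite /M in Mk; lia.
(* The finite support of A is inherited from F and D, because A = F - D. *)
have AM : vanish_from M A.
  move=> k Mk; have := FE k; rewrite DM // FN ?addr0 //; rewrite /M in Mk; lia.
rewrite (eq_fsum FE) (fsumD (vanish_finsupp AM) (vanish_finsupp DM)); congr (_ + _).
rewrite (nsumE Dfin) big_ord1 /D expo_cr_eq0; case: ifPn => // sH.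
rewrite /c contr0 // => y l'; have -> : Knaive m y.2 = 0.
  by move: sH; rewrite /Knaive; case: (s).
by rewrite rmorph0 mul0r scale0r.
Qed.

Lemma NF_com a k l q w : mo a (an s k) (NF l q w) =
  (-1) ^+ size l *: NF l q (mo a (an s k) w) +
  contr (fun y l' => (ratr (gbinom (k%:R + hs) y.2) * form a y.1) *:
    NF l' (q - (k%:R + hs) + y.2%:R) w) l.
Proof.
have bw := bounded_fnord w; have bw' := bounded_fnord (mo a (an s k) w).
have bc := bounded_above_contr (fun y => form a y.1) (neg_mode s (an s k)) bw.
rewrite /NF -(nf_map _ _ (mlin a _)) // -nfZ //.
rewrite (@eq_nf _ _ s _ _ (fun ll => (-1) ^+ size l *: nrd ll (mo a (an s k) w) +
   contr (fun y ll' => (form a y.1 *+ (y.2 == neg_mode s (an s k))) *: nrd ll' w) ll)).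
  rewrite nfD //; last by apply: bounded_above_sub bw' => ll ->; rewrite scaler0.
  congr (_ + _); rewrite (nf_contr (form a)) //; apply: eq_contr => y l'.
  have e : exp (neg_mode s (an s k)) = - (2^-1 + (k%:R + hs)).
    by rewrite expo_neg_mode expo_an.
  have -> : - exp (neg_mode s (an s k)) - 2^-1 = k%:R + hs by rewrite e; lra.
  have -> // : q + exp (neg_mode s (an s k)) + 2^-1 + y.2%:R = q - (k%:R + hs) + y.2%:R.
  by rewrite e; lra.
move=> ll sz; rewrite ann_fnord ?expo_an_gt0 // sz; congr (_ + _).
by apply: eq_contr => y ll'; rewrite expo_opp_eq.
Qed.

Definition wt_list (l : listn) : rat := \sum_(x <- l) (2^-1 + x.2%:R).

Lemma sum_expo_zip ns l : size ns = size l ->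
  \sum_(x <- zip (map fst l) ns) exp x.2 = - (expo_fields s ns l + wt_list l).
Proof.
move=> sz; rewrite /wt_list -sum_expo // sumrN opprK.
by rewrite -[in RHS](zip_map_fst_size sz) big_map.
Qed.

Lemma NF_filt b l q w : filt b w -> filt (b + q + wt_list l) (NF l q w).
Proof.
move=> wb; apply: (subspace_fsum (filt_subspace W _)) => ns; rewrite /fterm.
case: andP => [[/eqP sz /eqP qE]|_]; last by apply: filt0.
apply: filtZ.
by have := fnord_filt (zip (map fst l) ns) wb; rewrite sum_expo_zip // qE opprK addrA.
Qed.

Lemma NF_linear l q : linear (NF l q).
Proof.
move=> c v w.
have [r rP] := fterm_supp l q (bounded_fnord v).
have [r' rP'] := fterm_supp l q (bounded_fnord w).
rewrite /NF /nf (lin_fsum (scale_linear c (@id_linear _ W)) rP) -(@fsumD _ _ (r ++ r')).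
- apply: eq_fsum => ns; rewrite /fterm; case: andP; rewrite ?scaler0 ?addr0 //.
  by rewrite fnord_linear scalerDr !scalerA [c * _]mulrC.
- by move=> ns; rewrite mem_cat negb_or => /andP[/rP -> _]; rewrite scaler0.
- by move=> ns; rewrite mem_cat negb_or => /andP[_ /rP' ->].
Qed.

Lemma NF_wt l q w : fwt (NF l q w) =
  NF l q (fwt w) + ratr (q + wt_list l) *: NF l q w.
Proof.
have [r rP] := fterm_supp l q (bounded_fnord w).
have [r' rP'] := fterm_supp l q (bounded_fnord (fwt w)).
rewrite /NF /nf (lin_fsum flin rP).
rewrite (lin_fsum (scale_linear _ (@id_linear _ W)) rP) -(@fsumD _ _ (r ++ r')).
- apply: eq_fsum => ns; rewrite /fterm; case: andP => [[/eqP sz /eqP qE]|_]; last first.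
    by rewrite (lin0 flin) scaler0 addr0.
  rewrite (linZ flin) fnord_wt sum_expo_zip // qE rmorphN scaleNr opprK.
  by rewrite scalerDr [X in _ + X]scaleC.
- by move=> ns; rewrite mem_cat negb_or => /andP[_ /rP'].
- by move=> ns; rewrite mem_cat negb_or => /andP[/rP -> _]; rewrite scaler0.
Qed.

Lemma expo_fields_int ns l : size ns = size l ->
  expo_fields s ns l + (size l)%:R * hs \is a Num.int.
Proof.
rewrite /expo_fields; elim: l ns => [|x l IH] [|n ns] //= => [_|[/IH]].
  by rewrite big_nil mul0r addr0.
rewrite big_cons -[(size l).+1%:R]natr1 mulrDl mul1r => IHl.
have -> : - exp n - 2^-1 - x.2%:R + \sum_(j <- zip ns l) (- exp j.1 - 2^-1 - j.2.2%:R) +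
   ((size l)%:R * hs + hs) = (- exp n - 2^-1 + hs - x.2%:R) +
   (\sum_(j <- zip ns l) (- exp j.1 - 2^-1 - j.2.2%:R) + (size l)%:R * hs) by ring.
apply: rpredD => //; apply: rpredB; last exact: rpred_nat.
have -> : - exp n - 2^-1 + hs = - (n + (if s is HalfModes then 1 else 0))%:~R.
  by rewrite /expo /hshift; case: (s); rewrite rmorphD /=; lra.
by rewrite rpredN; apply: rpred_int.
Qed.

Lemma NF_int l q w : NF l q w != 0 -> q + (size l)%:R * hs \is a Num.int.
Proof.
apply: contraNT => nint; apply/eqP/fsum0 => ns; rewrite /fterm.
case: andP => // -[/eqP sz /eqP qE]; case/negP: nint.
by rewrite -qE; apply: expo_fields_int.
Qed.

Lemma NF_multilin q w : multilin (fun l => NF l q w).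
Proof.
move=> c a b m l1 l2.
have bw := bounded_fnord w.
have [r rP] := fterm_supp (l1 ++ (a, m) :: l2) q bw.
have [r' rP'] := fterm_supp (l1 ++ (b, m) :: l2) q bw.
rewrite /NF /nf (lin_fsum (scale_linear c (@id_linear _ W)) rP) -(@fsumD _ _ (r ++ r')).
- apply: eq_fsum => ns; rewrite /fterm.
  have szE x : size (l1 ++ (x, m) :: l2) = (size l1 + (size l2).+1)%N by rewrite size_cat.
  rewrite !szE; case: eqVneq => [sz|]; last by rewrite scaler0 addr0.
  have [n1 [n [n2 [nsE sz1 sz2]]]] : exists n1 n n2,
      [/\ ns = n1 ++ n :: n2, size n1 = size l1 & size n2 = size l2].
    exists (take (size l1) ns), (nth 0 ns (size l1)), (drop (size l1).+1 ns).
    rewrite -drop_nth ?sz ?cat_take_drop; last by rewrite addnS ltnS leq_addr.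
    split=> //; rewrite ?size_take ?size_drop sz; last by lia.
    by rewrite addnS ltnS leq_addr.
  have eE x : expo_fields s ns (l1 ++ (x, m) :: l2) = expo_fields s ns (l1 ++ (0, m) :: l2).
    by rewrite /expo_fields nsE !zip_cat //= !big_cat /= !big_cons.
  have cE x : coef_fields s ns (l1 ++ (x, m) :: l2) = coef_fields s ns (l1 ++ (0, m) :: l2).
    by rewrite /coef_fields nsE !zip_cat //= !big_cat /= !big_cons.
  rewrite !eE !cE; case: eqVneq => /= [_|]; last by rewrite scaler0 addr0.
  have zE x : zip (map fst (l1 ++ (x, m) :: l2)) ns =
      zip (map fst l1) n1 ++ (x, n) :: zip (map fst l2) n2.
    by rewrite map_cat nsE zip_cat ?size_map.
  rewrite !zE (fnord_multilin formDr formDl w) scalerDr; congr (_ + _); exact: scaleC.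
- by move=> ns; rewrite mem_cat negb_or => /andP[/rP -> _]; rewrite scaler0.
- by move=> ns; rewrite mem_cat negb_or => /andP[_ /rP'].
Qed.

End VertexModes.

Lemma nat_large (x : rat) : exists N : nat, forall k : nat, (N <= k)%N -> x < k%:R.
Proof.
exists (Num.bound x) => k Nk; have [x0|x0] := ltP x 0.
  by apply: lt_le_trans x0 (ler0n _ _).
by apply: lt_le_trans (archi_boundP x0) _; rewrite ler_nat.
Qed.

Lemma fsum_linear (K : nzRingType) (V X : lmodType K) (F : nat -> V -> X) :
  (forall k, linear (F k)) -> (forall v, exists N, vanish_from N (F^~ v)) ->
  linear (fun v => fsum (F^~ v)).
Proof.
move=> lF FN c x y; have [N xN] := FN x; have [N' yN] := FN y.
pose M := maxn N N'.
have xM : vanish_from M (F^~ x) by move=> k Mk; apply: xN; apply: leq_trans Mk; apply: leq_maxl.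
have yM : vanish_from M (F^~ y) by move=> k Mk; apply: yN; apply: leq_trans Mk; apply: leq_maxr.
rewrite (nsumE xM) (nsumE yM) (@nsumE _ M).
  by rewrite scaler_sumr -big_split; apply: eq_bigr => k _; rewrite lF.
by move=> k Mk; rewrite lF (xM k Mk) (yM k Mk) scaler0 addr0.
Qed.

(** * Vertex operators and their recursion *)

Section VertexTheory.
Variables (R : realType).
Local Notation C := R[i].
Variables (h : lmodType C) (form : h -> h -> C).
Variable V : fock_module form HalfModes (U := C^o) (fun _ _ => 0).
Local Notation vac := (fov V (1 : C^o)).
Local Notation cre := (@cre R h form V).
Local Notation ann := (@ann R h form V).
Local Notation mono := (@mono R h form V).
Implicit Types (v : V) (l : seq (h * nat)).

Lemma ann_large v : exists N : nat, forall i a, (N <= i)%N -> ann a i v = 0.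
Proof.
have [b vb] := filt_ex v; have [N NP] := nat_large b.
exists N => i a Ni; apply: (fmo_large a vb).
by have := NP i Ni; rewrite /expo /=; lra.
Qed.

Lemma cre_filt b a m v : filt b v -> filt (b + (2^-1 + m%:R)) (cre a m v).
Proof.
move=> /(filt_mode a (- m.+1%:Z)); apply: filt_mono; rewrite /expo rmorphN /=; lra.
Qed.

Lemma ann_filt b a i v : filt b v -> filt (b - (2^-1 + i%:R)) (ann a i v).
Proof. by move=> /(filt_mode a i%:Z); apply: filt_mono; rewrite /expo /=; lra. Qed.

Lemma fov_vac (u : C^o) : fov V u = u *: vac.
Proof.
by rewrite -(linZ (@fov_linear _ _ _ _ _ _ V)); congr fov; rewrite /GRing.scale /= mulr1.
Qed.

Lemma mono_gen (l : seq (h * int)) (u : C^o) :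
  all (fun x => expo HalfModes x.2 < 0) l ->
  exists2 l' : seq (h * nat), mops l (fov V u) = u *: mono l' &
    \sum_(x <- l) - expo HalfModes x.2 = wt_list l' /\ size l' = size l.
Proof.
elim: l => [|[a n] l IH] /= => [_|/andP[n0 /IH [l' e [e' sz]]]].
  by exists [::]; [apply: fov_vac | rewrite /wt_list !big_nil].
case: n n0 => [i|m _]; first by rewrite ltNge ltW ?half_pos.
exists ((a, m) :: l'); rewrite ?e.
  by rewrite (moZ (W := V)) mono_cons NegzE.
rewrite /wt_list !big_cons e' [size (_ :: _)]/= sz; split=> //; congr (_ + _) => /=.
by rewrite NegzE /expo rmorphN /=; lra.
Qed.

Lemma filt_mono_ind g (P : V -> Prop) : subspace P ->
  (forall l, wt_list l <= g -> P (mono l)) -> forall v, filt g v -> P v.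
Proof.
move=> sP Pm; apply: lspan_min => // _ [l [u [la lg ->]]].
have [l' -> [e _]] := mono_gen u la; apply: subspaceZ => //; apply: Pm.
by rewrite -e.
Qed.

Lemma mono_filt l : filt (wt_list l) (mono l).
Proof.
elim: l => [|[a m] l IH]; first by rewrite /wt_list big_nil; apply: filt_vect.
rewrite mono_cons /wt_list big_cons /= addrC; exact: cre_filt.
Qed.

Lemma fwt_mono l : fwt (mono l) = ratr (wt_list l) *: mono l.
Proof.
elim: l => [|[a m] l IH].
  by rewrite /wt_list big_nil rmorph0 scale0r; apply: fwt_vect.
rewrite mono_cons /cre fwt_mode IH (moZ (W := V)) -scalerBl; congr (_ *: _).
rewrite -rmorphB /wt_list big_cons /expo rmorphN; congr ratr; rewrite /=; lra.
Qed.

(** Contractions indexed by the entries of a monomial become a sum over annihilation modes. In this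
    form they make sense for every vector of V, and the recursions can be stated without choosing a
    monomial. *)
Lemma ann_fsum (X : lmodType C) a (Phi : nat -> V -> X) l :
  (forall i, linear (Phi i)) ->
  fsum (fun i => Phi i (ann a i (mono l))) =
  contr (fun y l' => form a y.1 *: Phi y.2 (mono l')) l.
Proof.
move=> lP; pose f i (y : h * nat) l' := (form a y.1 *+ (i == y.2)) *: Phi i (mono l').
have fE i : Phi i (ann a i (mono l)) = contr (f i) l.
  rewrite ann_mono (contr_comp (L := Phi i)) //; apply: eq_contr => y l'.
  by rewrite (linZ (lP i)).
have f1 y l' i : i != y.2 -> f i y l' = 0.
  by move=> /negPf iy; rewrite /f iy mulr0n scale0r.
rewrite (eq_fsum fE); have [|_ ->] := @contr_fsum _ _ X _ f l.
  by move=> y l'; exists [:: y.2] => i; rewrite inE => /f1.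
by apply: eq_contr => y l'; rewrite (fsum1 (f1 y l')) /f eqxx.
Qed.

(** The predicate on lengths is a parameter because three conditions occur: a fixed length, a bound
    on it, and a fixed parity. *)
Definition lspan_len (Q : nat -> Prop) : V -> Prop :=
  lspan [set v | exists2 l, Q (size l) & v = mono l]%classic.

Lemma lspan_len_subspace Q : subspace (lspan_len Q).
Proof. exact: lspan_subspace. Qed.

Lemma lspan_len_mono (Q : nat -> Prop) l : Q (size l) -> lspan_len Q (mono l).
Proof. by move=> Ql; apply: lspan_gen; exists l. Qed.

Lemma lspan_len_sub (Q Q' : nat -> Prop) v : (forall n, Q n -> Q' n) ->
  lspan_len Q v -> lspan_len Q' v.
Proof.
move=> QQ'; move: v; apply: lspan_min; first exact: lspan_len_subspace.
by move=> _ [l /QQ' Ql ->]; apply: lspan_len_mono.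
Qed.

Lemma lspan_len_ann (Q Q' : nat -> Prop) a i v : (forall n, Q n.+1 -> Q' n) ->
  lspan_len Q v -> lspan_len Q' (ann a i v).
Proof.
move=> QQ'; move: v; apply: lspan_min.
  exact: (linear_subspace_pre (ann_linear (V := V) a i) (lspan_len_subspace _)).
move=> _ [l Ql ->]; rewrite ann_mono.
apply: (@contr_subspace _ _ _ _ (fun _ _ => True)); first exact: lspan_len_subspace.
move=> l1 y l2 el; apply: subspaceZ; first exact: lspan_len_subspace.
apply: lspan_len_mono; apply: QQ'; move: Ql; rewrite el !size_cat /=.
by rewrite addnS.
Qed.

Lemma weight_lspan_len (z : rat) v : wspace (W := V) (ratr z) v ->
  lspan [set v | exists2 l, wt_list l = z & v = mono l]%classic v.
Proof.
move: v; apply: lspan_min; first exact: lspan_subspace.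
move=> _ [l [u [la lz ->]]]; have [l' -> [e _]] := mono_gen u la.
apply: lspanZ; apply: lspan_gen; exists l' => //.
have : ratr (wt_list l') = ratr z :> C; last exact: fmorph_inj.
by rewrite -lz -e rmorph_sum /=; apply: eq_bigr => x _; rewrite rmorphN.
Qed.

(** The parity involution. It replaces the sign (-1)^(size l), which depends on a monomial, by an
    operator, so that the recursions are linear in v. *)
Variable th : V -> V.
Hypothesis th_linear : linear th.
Hypothesis th_mono : forall l, th (mono l) = (-1) ^+ size l *: mono l.

Lemma th_vac : th vac = vac.
Proof. by have := th_mono [::]; rewrite scale1r. Qed.

Lemma th_cre a m v : th (cre a m v) = - cre a m (th v).
Proof.
move: v; apply: eq_on_mono.
- exact: comp_linear th_linear (cre_linear (V := V) a m).
- by move=> c x y; rewrite th_linear cre_linear opprD scalerN.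
move=> l; rewrite -mono_cons !th_mono (linZ (cre_linear (V := V) a m)).
by rewrite exprS mulN1r scaleNr.
Qed.

Lemma th_ann a i v : th (ann a i v) = - ann a i (th v).
Proof.
move: v; apply: vertex_ind.
- apply: eq_lin_subspace; first exact: comp_linear th_linear (ann_linear (V := V) a i).
  by move=> c x y; rewrite th_linear ann_linear opprD scalerN.
- by rewrite th_vac ann_vac (lin0 th_linear) oppr0.
move=> b m v IH; rewrite ann_cre (linB th_linear) (linZ th_linear) !th_cre IH.
by rewrite (linN (cre_linear (V := V) b m)) (linN (ann_linear (V := V) a i)) !opprK ann_cre.
Qed.

Lemma th_th v : th (th v) = v.
Proof.
move: v; apply: eq_on_mono; first exact: comp_linear th_linear th_linear.
  exact: id_linear.
by move=> l; rewrite !th_mono (linZ th_linear) th_mono sign_sq.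
Qed.

Section Operations.
Variables (s : sector) (U : lmodType C) (act0 : h -> U -> U).
Local Notation hs := (hshift s).
Variable W : fock_module form s act0.
Local Notation mo := (@fmo R h form s U act0 W).

(* The kernel K collects the contractions of a creation field with the fields
   to its right, relative to those of V. *)
Record vops (K : nat -> nat -> rat) (Y : V -> rat -> W -> W) : Prop := {
  vo_linV : forall q w, linear (fun v => Y v q w);
  vo_linW : forall v q, linear (Y v q);
  vo_vac : forall q w, Y vac q w = if q == 0 then w else 0;
  vo_filt : forall g b v q w, filt g v -> filt b w -> filt (b + q + g) (Y v q w);
  vo_rec : forall a m v q w, Y (cre a m v) q w =
    fsum (fun k => ratr (gbinom (k%:R - hs) m) *:
      mo a (cr s k) (Y v (q - (k%:R - hs) + m%:R) w)) +
    fsum (fun k => ratr (gbinom (- (k.+1%:R + hs)) m) *: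
      Y (th v) (q + (k.+1%:R + hs) + m%:R) (mo a (an s k) w)) +
    fsum (fun i => ratr (K m i) *: Y (ann a i v) (q + m%:R + i%:R + 1) w);
  vo_com : forall a k v q w, mo a (an s k) (Y v q w) =
    Y (th v) q (mo a (an s k) w) +
    fsum (fun i => ratr (gbinom (k%:R + hs) i) *:
      Y (ann a i v) (q - (k%:R + hs) + i%:R) w);
  vo_wt : forall v q w, fwt (Y v q w) =
    Y v q (fwt w) + Y (fwt v) q w + ratr q *: Y v q w;
  vo_int : forall (b : bool) v q w, lspan_len (fun n => odd n = b) v ->
    Y v q w != 0 -> q + b%:R * hs \is a Num.int }.

Section Truncation.
Variable Y : V -> rat -> W -> W.
Hypothesis linV : forall q w, linear (fun v => Y v q w).
Hypothesis Yfilt : forall g b v q w, filt g v -> filt b w -> filt (b + q + g) (Y v q w).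

Lemma Y_trunc v w : exists N : rat, forall q, q < N -> Y v q w = 0.
Proof.
have [g vg] := filt_ex v; have [b wb] := filt_ex w; exists (- b - g) => q qN.
by apply: (filt_lt0 _ (Yfilt q vg wb)); lra.
Qed.

Lemma rec_cr_vanish a m v q w : exists N, vanish_from N
  (fun k => ratr (gbinom (k%:R - hs) m) *:
      mo a (cr s k) (Y v (q - (k%:R - hs) + m%:R) w)).
Proof.
have [B BP] := Y_trunc v w; have [N NP] := nat_large (q + hs + m%:R - B).
exists N => k /NP kN; rewrite BP ?(lin0 (@fmo_linear _ _ _ _ _ _ W _ _)) ?scaler0 //.
lra.
Qed.

Lemma rec_an_vanish a m v q w : exists N, vanish_from N
  (fun k => ratr (gbinom (- (k.+1%:R + hs)) m) *:
      Y v (q + (k.+1%:R + hs) + m%:R) (mo a (an s k) w)).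
Proof.
have [b wb] := filt_ex w; have [N NP] := nat_large b.
exists N => k /NP kN; rewrite (fmo_large a wb).
  have [g vg] := filt_ex v.
  have f0 b' : filt b' (0 : W) by case: (filt_subspace W b').
  set x := q + _ + _; rewrite (filt_lt0 _ (Yfilt x vg (f0 (- x - g - 1)))) ?scaler0 //.
  lra.
have hs0 : 0 <= hs by case: (s) => /=; lra.
by rewrite expo_an; lra.
Qed.

Lemma ann_vanish (c : nat -> C) (e : nat -> rat) a v w : exists N, vanish_from N
  (fun i => c i *: Y (ann a i v) (e i) w).
Proof.
have [N NP] := ann_large v; exists N => i /NP ->.
by rewrite (lin0 (linV _ w)) scaler0.
Qed.

Lemma ann_sum_linear (c : nat -> C) (e : nat -> rat) a w :
  linear (fun v => fsum (fun i => c i *: Y (ann a i v) (e i) w)).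
Proof.
apply: (@fsum_linear _ V W (fun i v => c i *: Y (ann a i v) (e i) w)).
  move=> i; apply/scale_linear; apply: (comp_linear (f := fun v => Y v (e i) w)) => //.
  exact: ann_linear.
by move=> v; apply: ann_vanish.
Qed.

Lemma ann_sum_mono (c : nat -> C) (e : nat -> rat) a w l :
  fsum (fun i => c i *: Y (ann a i (mono l)) (e i) w) =
  contr (fun y l' => (c y.2 * form a y.1) *: Y (mono l') (e y.2) w) l.
Proof.
rewrite (@ann_fsum W a (fun i v => c i *: Y v (e i) w) l); last first.
  by move=> i; apply/scale_linear.
by apply: eq_contr => y l'; rewrite scalerA mulrC.
Qed.

End Truncation.

Lemma naive_vops (Y : V -> rat -> W -> W) :
  (forall q w, linear (fun v => Y v q w)) ->
  (forall l q w, Y (mono l) q w = NF l q w) -> vops (Knaive s) Y.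
Proof.
move=> linV YE.
have linW v q : linear (Y v q).
  move=> c x y; move: v; apply: eq_on_mono => //.
    by apply: add_linear => //; apply: scale_linear.
  by move=> l; rewrite !YE NF_linear.
have Yfilt g b v q w : filt g v -> filt b w -> filt (b + q + g) (Y v q w).
  move=> vg wb; move: v vg; apply: filt_mono_ind.
    exact: (linear_subspace_pre (linV q w) (filt_subspace W _)).
  move=> l lg; rewrite YE; apply: filt_mono (NF_filt l q wb).
  by rewrite lerD2l.
have thY v' l q w : v' = mono l -> Y (th v') q w = (-1) ^+ size l *: NF l q w.
  by move=> ->; rewrite th_mono (linZ (linV q w)) YE.
split=> //.
- by move=> q w; rewrite -[vac]/(mono [::]) YE NF_nil.
- move=> a m v q w; move: v; apply: eq_on_mono.
  + apply: (comp_linear (f := fun v => Y v q w)) => //; exact: cre_linear.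
  + apply: add_linear; first apply: add_linear.
    * apply: (@fsum_linear _ V W (fun k v => ratr (gbinom (k%:R - hs) m) *:
         mo a (cr s k) (Y v (q - (k%:R - hs) + m%:R) w))).
        move=> k; apply/scale_linear/comp_linear => //; exact: fmo_linear.
      by move=> v; apply: rec_cr_vanish.
    * apply: (@fsum_linear _ V W (fun k v => ratr (gbinom (- (k.+1%:R + hs)) m) *:
        Y (th v) (q + (k.+1%:R + hs) + m%:R) (mo a (an s k) w))).
        by move=> k; apply/scale_linear; apply: (comp_linear (f := fun v => Y v _ _)).
      by move=> v; apply: rec_an_vanish.
    * exact: (ann_sum_linear linV).
  + move=> l; rewrite -mono_cons YE NF_cons (ann_sum_mono linV); congr (_ + _ + _).
    * by apply: eq_fsum => k; rewrite YE.
    * by apply: eq_fsum => k; rewrite (thY _ l).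
    * by apply: eq_contr => y l'; rewrite YE.
- move=> a k v q w; move: v; apply: eq_on_mono.
  + apply: comp_linear => //; exact: fmo_linear.
  + apply: add_linear; last exact: (ann_sum_linear linV).
    by apply: (comp_linear (f := fun v => Y v _ _)).
  + move=> l; rewrite YE NF_com (ann_sum_mono linV) (thY _ l) //; congr (_ + _).
    by apply: eq_contr => y l'; rewrite YE.
- move=> v q w; move: v; apply: eq_on_mono.
  + apply: comp_linear => //; exact: fwt_linear.
  + apply: add_linear; last exact: scale_linear.
    apply: add_linear => //; apply: (comp_linear (f := fun v => Y v _ _)) => //.
    exact: fwt_linear.
  + move=> l; rewrite fwt_mono (linZ (linV q w)) !YE NF_wt -addrA; congr (_ + _).
    by rewrite rmorphD scalerDl addrC.
- move=> b v q w vb; apply: contraNT => nint; apply/eqP.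
  move: v vb; apply: lspan_min.
    by split=> [|c x y x0 y0]; rewrite ?(lin0 (linV q w)) // linV x0 y0 scaler0 addr0.
  move=> _ [l lb ->]; rewrite YE; apply/eqP; apply: contraNT nint => /NF_int.
  (* Only the parity of the length matters, since twice the shift is an integer. *)
  rewrite -[X in X%:R * hs](odd_double_half (size l)) lb natrD mulrDl addrA => /rpredB.
  have hint : (size l)./2.*2%:R * hs \is a Num.int.
    rewrite -muln2 natrM -mulrA; apply: rpredM; first exact: rpred_nat.
    by case: (s); rewrite /= ?mulr0 // divff.
  by move=> /(_ _ hint); rewrite addrK.
Qed.

End Operations.
End VertexTheory.

Lemma triangle_exchange (X : zmodType) n (F : nat -> nat -> X) :
  \sum_(i < n.+1) \sum_(p < (n - i).+1) F i p =
  \sum_(p < n.+1) \sum_(i < (n - p).+1) F i p.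
Proof.
have H (G : nat -> nat -> X) : \sum_(i < n.+1) \sum_(p < (n - i).+1) G i p =
    \sum_(i < n.+1) \sum_(p < n.+1 | (i + p <= n)%N) G i p.
  apply: eq_bigr => i _.
  have il : ((n - i).+1 <= n.+1)%N by rewrite ltnS leq_subr.
  rewrite (big_ord_widen_cond _ xpredT (fun p => G i p) il).
  by apply: eq_bigl => p; rewrite /= ltnS leq_subRL // -ltnS.
rewrite H (H (fun p i => F i p)) (exchange_big_dep xpredT) //=.
by apply: eq_bigr => p _; apply: eq_bigl => i; rewrite addnC.
Qed.

Lemma coefC_anti m n : Defs.coefC n m = - Defs.coefC m n.
Proof. by rewrite /Defs.coefC [(n + m)%N]addnC; ring. Qed.

(** * The exponential of Delta *)

Section ExpDelta.
Variables (R : realType).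
Local Notation C := R[i].
Variables (h : lmodType C) (form : h -> h -> C).
Variable V : fock_module form HalfModes (U := C^o) (fun _ _ => 0).
Variables (M : nat) (e ebar : M.-tuple h).
Hypothesis dual_basis : forall a, a = \sum_(i < M)
  (form (tnth ebar i) a *: tnth e i + form (tnth e i) a *: tnth ebar i).
Local Notation vac := (fov V (1 : C^o)).
Local Notation cre := (@cre R h form V).
Local Notation ann := (@ann R h form V).
Local Notation mono := (@mono R h form V).
Implicit Types (v : V).

Definition DeltaF (l : nat) (v : V) : V :=
  \sum_(i < M) \sum_(m < l)
    ratr (Defs.coefC m (l - m.+1)) *:
      ann (tnth e i) m (ann (tnth ebar i) (l - m.+1) v).

Fixpoint Delta_powF (j l : nat) (v : V) : V :=
  if j is j'.+1 then \sum_(i < l.+1) DeltaF i (Delta_powF j' (l - i) v)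
  else if l is 0 then v else 0.

Definition exp_DeltaF (l : nat) (v : V) : V :=
  \sum_(j < l.+1) (j`!%:R)^-1 *: Delta_powF j l v.

Lemma annZ a i c v : ann a i (c *: v) = c *: ann a i v.
Proof. exact: linZ (ann_linear (V := V) a i) c v. Qed.
Lemma annB a i v v' : ann a i (v - v') = ann a i v - ann a i v'.
Proof. exact: linB (ann_linear (V := V) a i) v v'. Qed.
Lemma ann0 a i : ann a i 0 = 0.
Proof. exact: lin0 (ann_linear (V := V) a i). Qed.
Lemma ann_sum a i (I : Type) (r : seq I) (F : I -> V) :
  ann a i (\sum_(j <- r) F j) = \sum_(j <- r) ann a i (F j).
Proof. by rewrite (lin_sum (ann_linear (V := V) a i)). Qed.
Lemma cre_sum a i (I : Type) (r : seq I) (F : I -> V) :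
  cre a i (\sum_(j <- r) F j) = \sum_(j <- r) cre a i (F j).
Proof. by rewrite (lin_sum (cre_linear (V := V) a i)). Qed.
Lemma creZ a i c v : cre a i (c *: v) = c *: cre a i v.
Proof. exact: linZ (cre_linear (V := V) a i) c v. Qed.

Lemma ann_linear_l i v : linear (fun a => ann a i v).
Proof. exact: fmo_linear_l. Qed.

Lemma Delta_linear l : linear (DeltaF l).
Proof.
apply: sum_linear => i; apply: sum_linear => m; apply: scale_linear.
by apply: comp_linear; apply: ann_linear.
Qed.

Lemma Delta0 v : DeltaF 0 v = 0.
Proof. by rewrite /DeltaF big1 // => i _; rewrite big_ord0. Qed.

Lemma Delta_vac l : DeltaF l vac = 0.
Proof.
rewrite /DeltaF big1 // => i _; rewrite big1 // => m _.
by rewrite ann_vac ann0 scaler0.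
Qed.

Lemma Delta_ann l a i v : DeltaF l (ann a i v) = ann a i (DeltaF l v).
Proof.
rewrite /DeltaF ann_sum; apply: eq_bigr => j _; rewrite ann_sum.
apply: eq_bigr => m _; rewrite annZ; congr (_ *: _).
rewrite [ann (tnth ebar j) _ _]ann_anti [RHS]ann_anti.
by rewrite (linN (ann_linear (V := V) (tnth e j) m)).
Qed.

(* The commutator of Delta with a creation mode, in degree p. *)
Definition dcre a m (p : nat) v : V :=
  if (m < p)%N then - ratr (Defs.coefC m (p - m.+1)) *: ann a (p - m.+1) v else 0.

Lemma dcre_linear a m p : linear (dcre a m p).
Proof.
rewrite /dcre; case: (m < p)%N; first exact/scale_linear/ann_linear.
by move=> c x y; rewrite scaler0 addr0.
Qed.

(** Either factor of Delta may contract with the creation mode, leaving the other. With n the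
    remaining index, the coefficients are C_nm on the e-part and -C_mn on the ebar-part;
    antisymmetry makes them equal, and [dual_basis] reassembles the vector a. *)
Lemma Delta_cre l a m v :
  DeltaF l (cre a m v) = cre a m (DeltaF l v) + dcre a m l v.
Proof.
have E (i : 'I_M) (m' : 'I_l) :
   ann (tnth e i) m' (ann (tnth ebar i) (l - m'.+1) (cre a m v)) =
   cre a m (ann (tnth e i) m' (ann (tnth ebar i) (l - m'.+1) v)) +
   ((form (tnth ebar i) a *+ (l - m'.+1 == m)%N) *: ann (tnth e i) m' v -
    (form (tnth e i) a *+ (m' == m :> nat)) *: ann (tnth ebar i) (l - m'.+1) v).
  by rewrite ann_cre annB annZ ann_cre opprB addrCA.
rewrite /DeltaF; under eq_bigr do under eq_bigr do rewrite E scalerDr -creZ.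
under eq_bigr do rewrite big_split -cre_sum /=.
rewrite big_split -cre_sum /=; congr (_ + _).
rewrite /dcre; case: ltnP => [ml|lm]; last first.
  rewrite big1 // => i _; rewrite big1 // => m' _.
  have ml := leq_trans (ltn_ord m') lm.
  have -> : (m' == m :> nat) = false by apply/negbTE; rewrite neq_ltn ml.
  have -> : (l - m'.+1 == m)%N = false by apply/negbTE/eqP; have := ltn_ord m'; lia.
  by rewrite !mulr0n !scale0r subrr scaler0.
rewrite [in RHS](dual_basis a) (lin_sum (ann_linear_l (l - m.+1) v)) scaler_sumr.
apply: eq_bigr => i _.
rewrite (linD (ann_linear_l _ v)) !(linZ (ann_linear_l _ v)).
have nl : (l - m.+1 < l)%N by lia.
under eq_bigr do rewrite scalerBr.
rewrite big_split sumrN /= (bigD1 (Ordinal nl)) //= big1 ?addr0; last first.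
  move=> m' /eqP m'n; have -> : (l - m'.+1 == m)%N = false.
    apply/negbTE/eqP => E'; apply: m'n; apply: val_inj => /=; have := ltn_ord m'; lia.
  by rewrite mulr0n scale0r scaler0.
rewrite (bigD1 (Ordinal ml)) //= big1 ?addr0; last first.
  move=> m' /eqP m'n; have -> : (m' == m :> nat) = false.
    by apply/negbTE/eqP => E'; apply: m'n; apply: val_inj.
  by rewrite mulr0n scale0r scaler0.
have -> : (l - (l - m.+1).+1 = m)%N by lia.
by rewrite !eqxx !mulr1n (coefC_anti m) rmorphN /= scalerDr !scaleNr.
Qed.

Lemma Delta_dcre l a m p v : DeltaF l (dcre a m p v) = dcre a m p (DeltaF l v).
Proof.
rewrite /dcre; case: ifP => _; last exact: lin0 (Delta_linear l).
by rewrite (linZ (Delta_linear l)) Delta_ann.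
Qed.

Lemma Delta_pow_linear j l : linear (Delta_powF j l).
Proof.
elim: j l => [|j IH] l /=.
  by case: l => [|l] c x y //; rewrite scaler0 addr0.
by apply: sum_linear => i; apply: comp_linear; first exact: Delta_linear.
Qed.

Lemma Delta_pow_ann j l a i v : Delta_powF j l (ann a i v) = ann a i (Delta_powF j l v).
Proof.
elim: j l => [|j IH] l /=; first by case: l => //; rewrite ann0.
by rewrite ann_sum; apply: eq_bigr => p _; rewrite IH Delta_ann.
Qed.

Lemma Delta_pow_vac j l : Delta_powF j l vac = if (j == 0)%N && (l == 0)%N then vac else 0.
Proof.
elim: j l => [|j IH] l /=; first by case: l.
rewrite big1 // => i _; rewrite IH; case: ifP => _; first exact: Delta_vac.
exact: lin0 (Delta_linear i).
Qed.

Lemma Delta_pow_small j l v : (l < j)%N -> Delta_powF j l v = 0.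
Proof.
elim: j l => // j IH l lj /=; rewrite big1 // => -[[|i] il] _ /=.
  exact: Delta0.
rewrite IH; [exact: lin0 (Delta_linear _) | lia].
Qed.

(** The commutator of Delta with a creation mode consists of annihilation modes, hence commutes with
    Delta. This gives the rule for the derivative of a power; the value of [j.-1] at j = 0 is masked
    by the factor j. *)
Lemma Delta_pow_cre j l a m v : Delta_powF j l (cre a m v) =
  cre a m (Delta_powF j l v) +
  j%:R *: \sum_(p < l.+1) dcre a m p (Delta_powF j.-1 (l - p) v).
Proof.
elim: j l => [|j IH] l /=.
  rewrite scale0r addr0; case: l => // l.
  by rewrite (lin0 (cre_linear (V := V) a m)).
under eq_bigr => i _.
  rewrite IH (linD (Delta_linear i)) (linZ (Delta_linear i)) Delta_cre.
  rewrite (lin_sum (Delta_linear i)) -addrA.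
  over.
rewrite !big_split -cre_sum /=; congr (_ + _).
rewrite -natr1 scalerDl scale1r addrC; congr (_ + _).
rewrite -scaler_sumr; case: j {IH} => [|j]; first by rewrite !scale0r.
congr (_ *: _) => /=.
rewrite (triangle_exchange l (fun i p => DeltaF i (dcre a m p (Delta_powF j (l - i - p) v)))).
apply: eq_bigr => p _; rewrite (lin_sum (dcre_linear a m p)).
apply: eq_bigr => i _; rewrite Delta_dcre; do 2![congr (_ _)].
by congr Delta_powF; lia.
Qed.

Lemma exp_Delta_linear l : linear (exp_DeltaF l).
Proof. by apply: sum_linear => j; apply/scale_linear/Delta_pow_linear. Qed.

Lemma exp_Delta_vac l : exp_DeltaF l vac = if l == 0%N then vac else 0.
Proof.
rewrite /exp_DeltaF big_ord_recl big1 ?addr0 => [|j _]; rewrite Delta_pow_vac.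
  by case: (l == 0%N); rewrite /= ?scaler0 // fact0 invr1 scale1r.
by rewrite scaler0.
Qed.

Lemma exp_Delta_ann l a i v : exp_DeltaF l (ann a i v) = ann a i (exp_DeltaF l v).
Proof.
rewrite /exp_DeltaF ann_sum; apply: eq_bigr => j _.
by rewrite annZ Delta_pow_ann.
Qed.

(** The factor j from [Delta_pow_cre] turns 1/j! into 1/(j-1)!, so conjugation by the exponential
    stops at the first commutator. *)
Lemma exp_Delta_cre l a m v : exp_DeltaF l (cre a m v) =
  cre a m (exp_DeltaF l v) + \sum_(p < l.+1) dcre a m p (exp_DeltaF (l - p) v).
Proof.
rewrite /exp_DeltaF cre_sum.
under eq_bigr => j _ do rewrite Delta_pow_cre scalerDr -creZ.
rewrite big_split /=; congr (_ + _).
rewrite big_ord_recl scale0r scaler0 add0r.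
transitivity (\sum_(j < l) \sum_(p < l.+1) (j`!%:R)^-1 *: dcre a m p (Delta_powF j (l - p) v)).
  apply: eq_bigr => j _; rewrite -scaler_sumr scalerA; congr (_ *: _).
  have j0 : (j.+1%:R : C) != 0 by rewrite pnatr_eq0.
  by rewrite factS natrM invfM mulrAC mulVf ?mul1r.
rewrite exchange_big; apply: eq_bigr => -[[|p] pl] _ /=.
  by rewrite /dcre big1 // => j _; rewrite scaler0.
rewrite (lin_sum (dcre_linear a m p.+1)).
(* The ranges of j on the two sides differ; the surplus terms vanish by [Delta_pow_small], as Delta
   has no constant term. *)
rewrite (big_ord_widen l (fun j => dcre a m p.+1 ((j`!%:R)^-1 *: Delta_powF j (l - p.+1) v))); last by lia.
rewrite [RHS]big_mkcond /=; apply: eq_bigr => j _.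
rewrite -(linZ (dcre_linear a m p.+1)); case: ltnP => // jl.
by rewrite Delta_pow_small ?scaler0 ?(lin0 (dcre_linear _ _ _)).
Qed.

(** The term of degree l in Delta is a combination of pairs of annihilation modes whose exponents
    add up to l. The lemma serves for the filtration, for weight vectors and for the parity of the
    length. *)
Lemma exp_Delta_pres (P : rat -> V -> Prop) :
  (forall g, subspace (P g)) ->
  (forall g a b i j v, P g v -> P (g - (1 + i%:R + j%:R)) (ann a i (ann b j v))) ->
  forall g l v, P g v -> P (g - l%:R) (exp_DeltaF l v).
Proof.
move=> sP Pann.
have PD g l v : P g v -> P (g - l%:R) (DeltaF l v).
  move=> Pv; apply: (subspace_sum _ (sP _)) => i _; apply: (subspace_sum _ (sP _)) => m _.
  apply: (subspaceZ (sP _)); have := Pann g (tnth e i) (tnth ebar i) m (l - m.+1)%N v Pv.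
  have -> // : g - (1 + m%:R + (l - m.+1)%:R) = g - l%:R.
  have : l%:R = m.+1%:R + (l - m.+1)%:R :> rat by rewrite -natrD subnKC.
  by move=> ->; rewrite -natr1; ring.
have PDp g j l v : P g v -> P (g - l%:R) (Delta_powF j l v).
  move=> Pv; elim: j l => [|j IH] l /=.
    by case: l => [|l]; [rewrite subr0 | case: (sP (g - l.+1%:R))].
  apply: (subspace_sum _ (sP _)) => i _; have := PD _ i _ (IH (l - i)%N).
  have -> // : g - (l - i)%:R - i%:R = g - l%:R.
  by rewrite natrB; [ring | rewrite -ltnS].
move=> g l v Pv; apply: (subspace_sum _ (sP _)) => j _.
by apply: (subspaceZ (sP _)); apply: PDp.
Qed.

Lemma exp_Delta_filt g l v : filt g v -> filt (g - l%:R) (exp_DeltaF l v).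
Proof.
apply: exp_Delta_pres; first exact: filt_subspace.
move=> g' a b i j v' v'g; have := ann_filt a i (ann_filt b j v'g).
by apply: filt_mono; lra.
Qed.

Lemma exp_Delta_len (b : bool) l v : lspan_len (fun n => odd n = b) v ->
  lspan_len (fun n => odd n = b) (exp_DeltaF l v).
Proof.
apply: (@exp_Delta_pres (fun _ => lspan_len (fun n => odd n = b)) _ _ 0).
  by move=> _; apply: lspan_len_subspace.
move=> _ a c i j v' v'b; apply: (@lspan_len_ann _ _ _ _ (fun n => odd n = ~~ b)).
  by move=> n /= /negb_inj.
apply: (@lspan_len_ann _ _ _ _ (fun n => odd n = b)) => //.
by move=> n /= <-; rewrite negbK.
Qed.

Lemma exp_Delta_wt l v : fwt (exp_DeltaF l v) = exp_DeltaF l (fwt v) - l%:R *: exp_DeltaF l v.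
Proof.
have lin := exp_Delta_linear l.
have key g : subspace (fun v : V => fwt v = ratr g *: v).
  by apply: eq_lin_subspace; [exact: fwt_linear | exact/scale_linear/id_linear].
move: v; apply: eq_on_mono.
- by apply: comp_linear => //; apply: fwt_linear.
- apply: add_linear; first by apply: comp_linear => //; apply: fwt_linear.
  by move=> c x y; rewrite lin scalerDr opprD scalerA mulrC -scalerA scalerN.
move=> l'; rewrite fwt_mono (linZ lin) -scalerBl.
have := @exp_Delta_pres (fun g v => fwt v = ratr g *: v) key _ (wt_list l') l (mono l') (fwt_mono V l').
move=> -> => [|g a b i j v vg]; first by rewrite rmorphB /= ratr_nat.
rewrite /ann !fwt_mode vg !(@moZ _ _ _ _ _ _ V) (@moB _ _ _ _ _ _ V) !(@moZ _ _ _ _ _ _ V).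
rewrite -!scalerBl; congr (_ *: _); rewrite -!rmorphB; congr ratr.
by rewrite /expo /=; lra.
Qed.

Variable th : V -> V.
Hypothesis th_linear : linear th.
Hypothesis th_mono : forall l, th (mono l) = (-1) ^+ size l *: mono l.

Lemma exp_Delta_th l v : th (exp_DeltaF l v) = exp_DeltaF l (th v).
Proof.
have tA a i v' : th (ann a i v') = - ann a i (th v') by exact: th_ann.
have tD p v' : th (DeltaF p v') = DeltaF p (th v').
  rewrite /DeltaF (lin_sum th_linear); apply: eq_bigr => i _.
  rewrite (lin_sum th_linear); apply: eq_bigr => m _; rewrite (linZ th_linear).
  by rewrite !tA (linN (ann_linear (V := V) (tnth e i) m)) opprK.
have tP j p v' : th (Delta_powF j p v') = Delta_powF j p (th v').
  elim: j p => [|j IH] p /=; first by case: p; rewrite ?(lin0 th_linear).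
  by rewrite (lin_sum th_linear); apply: eq_bigr => i _; rewrite tD IH.
rewrite /exp_DeltaF (lin_sum th_linear); apply: eq_bigr => j _.
by rewrite (linZ th_linear) tP.
Qed.

Lemma exp_Delta_vanish v : exists N, forall l, (N <= l)%N -> exp_DeltaF l v = 0.
Proof.
have [g vg] := filt_ex v; have [N NP] := nat_large g; exists N => l /NP lN.
by apply: (filt_lt0 _ (exp_Delta_filt l vg)); rewrite subr_lt0.
Qed.

End ExpDelta.

Section ActualVertex.
Variables (R : realType).
Local Notation C := R[i].
Variables (h : lmodType C) (form : h -> h -> C).
Variable V : fock_module form HalfModes (U := C^o) (fun _ _ => 0).
Variables (M : nat) (e ebar : M.-tuple h).
Hypothesis dual_basis : forall a, a = \sum_(i < M)
  (form (tnth ebar i) a *: tnth e i + form (tnth e i) a *: tnth ebar i).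
Local Notation vac := (fov V (1 : C^o)).
Local Notation cre := (@cre R h form V).
Local Notation ann := (@ann R h form V).
Local Notation mono := (@mono R h form V).
Local Notation xD := (@exp_DeltaF R h form V M e ebar).
Variable th : V -> V.
Hypothesis th_linear : linear th.
Hypothesis th_mono : forall l, th (mono l) = (-1) ^+ size l *: mono l.

Definition Kactual (m i : nat) : rat := Knaive IntModes m i - Defs.coefC m i.

Variables (U : lmodType C) (act0 : h -> U -> U).
Local Notation hs := (hshift IntModes).
Variable W : fock_module form IntModes act0.
Local Notation mo := (@fmo R h form IntModes U act0 W).
Variable Y0 : V -> rat -> W -> W.
Hypothesis Y0ops : vops th (Knaive IntModes) Y0.

Definition actualY (v : V) (q : rat) (w : W) : W :=
  fsum (fun l : nat => Y0 (xD l v) (q + l%:R) w).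

Let linV := vo_linV Y0ops.
Let linW := vo_linW Y0ops.
Let xD_lin l : linear (xD l) := @exp_Delta_linear R h form V M e ebar l.

Lemma Y00 q w : Y0 0 q w = 0.
Proof. exact: lin0 (linV q w). Qed.

Lemma actualYE v N q w : (forall l, (N <= l)%N -> xD l v = 0) ->
  actualY v q w = \sum_(l < N) Y0 (xD l v) (q + l%:R) w.
Proof. by move=> vN; rewrite /actualY (@nsumE _ N) // => l /vN ->; rewrite Y00. Qed.

Lemma actualY_vanish v q w : exists N, vanish_from N (fun l => Y0 (xD l v) (q + l%:R) w).
Proof.
have [N vN] := exp_Delta_vanish e ebar v.
by exists N => l /vN ->; rewrite Y00.
Qed.

Lemma actualY_linV q w : linear (fun v => actualY v q w).
Proof.
apply: (@fsum_linear _ V W (fun l v => Y0 (xD l v) (q + l%:R) w)).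
  by move=> l; apply: (comp_linear (f := fun v => Y0 v _ _)).
by move=> v; apply: actualY_vanish.
Qed.

Lemma actualY_filt g b v q w : filt g v -> filt b w -> filt (b + q + g) (actualY v q w).
Proof.
move=> vg wb; apply: (subspace_fsum (filt_subspace W _)) => l.
have := vo_filt Y0ops (q + l%:R) (exp_Delta_filt e ebar l vg) wb.
by apply: filt_mono; lra.
Qed.

(** The commutator terms are regrouped by the index i of the annihilation mode, which sits in degree
    p = m+1+i of Delta; the remaining degree l - p belongs to the exponential. This is where the
    shift of the kernel by -C_mi appears. *)
Lemma cre_sum_actual a m v q w :
  fsum (fun l => Y0 (\sum_(p < l.+1) dcre a m p (xD (l - p) v)) (q + l%:R) w) =
  fsum (fun i => ratr (- Defs.coefC m i) *: actualY (ann a i v) (q + m%:R + i%:R + 1) w).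
Proof.
have [N vN] := exp_Delta_vanish e ebar v.
have [P vP] := ann_large v.
pose G p l := Y0 (dcre a m p (xD l v)) (q + p%:R + l%:R) w.
(* For p + l large, either l is beyond the range of the exponential on v, or the index p - m - 1 is
   so large that the annihilation mode, which commutes with the exponential, kills v. *)
have G0 p l : (N + (m + P).+1 <= p + l)%N -> G p l = 0.
  move=> pl; rewrite /G; have [lN|Nl] := ltnP l N; last first.
    by rewrite vN // (lin0 (dcre_linear (V := V) a m p)) Y00.
  rewrite /dcre; case: ifP => mp; last exact: Y00.
  rewrite -exp_Delta_ann (vP (p - m.+1)%N a); last by lia.
  by rewrite (lin0 (xD_lin l)) scaler0 Y00.
transitivity (fsum (fun p => fsum (G p))).
  rewrite (nsum_diag G0); apply: eq_fsum => l.
  rewrite (lin_sum (linV (q + l%:R) w)); apply: eq_bigr => p _; rewrite /G.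
  congr (Y0 _ _ _); rewrite -addrA -natrD subnKC // -ltnS; exact: ltn_ord.
rewrite (@nsum_shift _ (N + (m + P).+1) m.+1); first last.
- move=> p pm; apply: fsum0 => l; rewrite /G /dcre ltnNge.
  by rewrite -ltnS pm /= Y00.
- by move=> p Np; apply: fsum0 => l; apply: G0; apply: leq_trans Np (leq_addr _ _).
apply: eq_fsum => i; have := actualY_vanish (ann a i v) (q + m%:R + i%:R + 1) w.
case=> N' N'P; rewrite (lin_fsum (scale_linear _ (@id_linear _ W)) (vanish_finsupp N'P)).
apply: eq_fsum => l; rewrite /G /dcre ltnS leq_addr.
have -> : (m.+1 + i - m.+1 = i)%N by lia.
rewrite (linZ (linV _ w)) exp_Delta_ann rmorphN; congr (_ *: Y0 _ _ _).
by rewrite natrD -natr1; lra.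
Qed.

Lemma actual_vops : vops th Kactual actualY.
Proof.
have linW' v q : linear (actualY v q).
  have [N vN] := exp_Delta_vanish e ebar v.
  move=> c x y; rewrite !(actualYE _ _ vN) scaler_sumr -big_split.
  by apply: eq_bigr => l _; rewrite linW.
split=> //.
- exact: actualY_linV.
- move=> q w; rewrite /actualY (@fsum1 _ _ 0%N).
    by rewrite exp_Delta_vac (vo_vac Y0ops) addr0.
  by move=> l /negPf l0; rewrite exp_Delta_vac l0 Y00.
- exact: actualY_filt.
- move=> a m v q w.
  have [N vN] := exp_Delta_vanish e ebar v.
  have thN l : (N <= l)%N -> xD l (th v) = 0.
    by move=> /vN vl; rewrite -(exp_Delta_th e ebar th_linear th_mono) vl (lin0 th_linear).
  have annN i l : (N <= l)%N -> xD l (ann a i v) = 0.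
    by move=> /vN vl; rewrite exp_Delta_ann vl (lin0 (ann_linear (V := V) a i)).
  transitivity (fsum (fun l => Y0 (xD l (cre a m v)) (q + l%:R) w)); first by [].
  under eq_fsum => l.
    rewrite (exp_Delta_cre dual_basis) (linD (linV _ w)).
    over.
  have [N1 N1P] : exists N1, vanish_from N1 (fun l =>
      Y0 (\sum_(p < l.+1) dcre a m p (xD (l - p) v)) (q + l%:R) w).
    have [N2 N2P] := exp_Delta_vanish e ebar (cre a m v).
    exists (maxn N N2) => l; rewrite geq_max => /andP[/vN vl /N2P].
    rewrite (exp_Delta_cre dual_basis) vl (lin0 (cre_linear (V := V) a m)) add0r => ->.
    exact: Y00.
  have NP : vanish_from N (fun l => Y0 (cre a m (xD l v)) (q + l%:R) w).
    by move=> l /vN ->; rewrite (lin0 (cre_linear (V := V) a m)) Y00.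
  rewrite (@fsumD _ _ (iota 0 (maxn N N1))); first last.
  - apply: vanish_finsupp => l; rewrite geq_max => /andP[_]; exact: N1P.
  - apply: vanish_finsupp => l; rewrite geq_max => /andP[+ _]; exact: NP.
  rewrite cre_sum_actual (nsumE NP).
  under eq_bigr => l _ do rewrite (vo_rec Y0ops).
  rewrite !big_split /=.
  rewrite -(@fsum_bigsum _ _ _ _ (fun k (l : 'I_N) => ratr (gbinom (k%:R - hs) m) *:
      mo a (cr IntModes k) (Y0 (xD l v) (q + l%:R - (k%:R - hs) + m%:R) w))); last first.
    move=> l; have [N' N'P] := rec_cr_vanish (vo_filt Y0ops) a m (xD l v) (q + l%:R) w.
    by exists (iota 0 N'); apply: vanish_finsupp.
  rewrite -(@fsum_bigsum _ _ _ _ (fun k (l : 'I_N) => ratr (gbinom (- (k.+1%:R + hs)) m) *: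
      Y0 (th (xD l v)) (q + l%:R + (k.+1%:R + hs) + m%:R) (mo a (an IntModes k) w))); last first.
    move=> l; have [N' N'P] := rec_an_vanish (vo_filt Y0ops) a m (th (xD l v)) (q + l%:R) w.
    by exists (iota 0 N'); apply: vanish_finsupp.
  rewrite -(@fsum_bigsum _ _ _ _ (fun i (l : 'I_N) => ratr (Knaive IntModes m i) *:
     Y0 (ann a i (xD l v)) (q + l%:R + m%:R + i%:R + 1) w)); last first.
    move=> l; have [N' N'P] := ann_vanish linV (fun i => ratr (Knaive IntModes m i))
       (fun i => q + l%:R + m%:R + i%:R + 1) a (xD l v) w.
    by exists (iota 0 N'); apply: vanish_finsupp.
  rewrite -[LHS]addrA; congr (_ + _ + _).
  + apply: eq_fsum => k; rewrite -scaler_sumr (actualYE _ _ vN).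
    rewrite (lin_sum (@fmo_linear _ _ _ _ _ _ W a (cr IntModes k))); congr (_ *: _).
    by apply: eq_bigr => l _; congr (mo _ _ (Y0 _ _ _)); rewrite /=; lra.
  + apply: eq_fsum => k; rewrite -scaler_sumr (actualYE _ _ thN); congr (_ *: _).
    apply: eq_bigr => l _; rewrite (exp_Delta_th e ebar th_linear th_mono).
    by congr (Y0 _ _ _); rewrite /=; lra.
  + have E i : \sum_(l < N) ratr (Knaive IntModes m i) *:
        Y0 (ann a i (xD l v)) (q + l%:R + m%:R + i%:R + 1) w =
        ratr (Knaive IntModes m i) *: actualY (ann a i v) (q + m%:R + i%:R + 1) w.
      rewrite -scaler_sumr (actualYE _ _ (annN i)); congr (_ *: _).
      by apply: eq_bigr => l _; rewrite exp_Delta_ann; congr (Y0 _ _ _); rewrite /=; lra.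
    rewrite (eq_fsum E).
    have [N2 N2P] := ann_large v.
    have an0 c i x : (N2 <= i)%N -> c *: actualY (ann a i v) x w = 0.
      by move=> /N2P ->; rewrite (lin0 (actualY_linV _ w)) scaler0.
    rewrite -(@fsumD _ _ (iota 0 N2)).
    * apply: eq_fsum => i; rewrite -scalerDl -rmorphD //.
    * by apply: vanish_finsupp => i; apply: an0.
    * by apply: vanish_finsupp => i; apply: an0.
- move=> a k v q w.
  have [N vN] := exp_Delta_vanish e ebar v.
  have thN l : (N <= l)%N -> xD l (th v) = 0.
    by move=> /vN vl; rewrite -(exp_Delta_th e ebar th_linear th_mono) vl (lin0 th_linear).
  have annN i l : (N <= l)%N -> xD l (ann a i v) = 0.
    by move=> /vN vl; rewrite exp_Delta_ann vl (lin0 (ann_linear (V := V) a i)).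
  rewrite (actualYE _ _ vN) (lin_sum (@fmo_linear _ _ _ _ _ _ W a _)).
  under eq_bigr => l _ do rewrite (vo_com Y0ops).
  rewrite big_split /= (actualYE _ _ thN); congr (_ + _).
    by apply: eq_bigr => l _; rewrite (exp_Delta_th e ebar th_linear th_mono).
  rewrite -(@fsum_bigsum _ _ _ _ (fun i (l : 'I_N) => ratr (gbinom (k%:R + hs) i) *:
     Y0 (ann a i (xD l v)) (q + l%:R - (k%:R + hs) + i%:R) w)); last first.
    move=> l; have [N' N'P] := ann_vanish linV (fun i => ratr (gbinom (k%:R + hs) i))
       (fun i => q + l%:R - (k%:R + hs) + i%:R) a (xD l v) w.
    by exists (iota 0 N'); apply: vanish_finsupp.
  apply: eq_fsum => i; rewrite -scaler_sumr (actualYE _ _ (annN i)); congr (_ *: _).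
  by apply: eq_bigr => l _; rewrite exp_Delta_ann; congr (Y0 _ _ _); rewrite /=; lra.
- move=> v q w.
  have [N vN] := exp_Delta_vanish e ebar v.
  have wtN l : (N <= l)%N -> xD l (fwt v) = 0.
    move=> /vN vl; have := exp_Delta_wt e ebar l v.
    by rewrite vl scaler0 subr0 (lin0 (@fwt_linear _ _ _ _ _ _ V)).
  rewrite !(actualYE _ _ vN) (actualYE _ _ wtN) (lin_sum (@fwt_linear _ _ _ _ _ _ W)).
  rewrite scaler_sumr -!big_split /=; apply: eq_bigr => l _.
  rewrite (vo_wt Y0ops) exp_Delta_wt (linB (linV _ w)) (linZ (linV _ w)).
  rewrite -!addrA; congr (_ + (_ + _)).
  by rewrite rmorphD /= ratr_nat scalerDl addrC addrK.
- move=> b v q w vb; apply: contraNT => nint; apply/eqP/fsum0 => l; apply/eqP.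
  apply: contraNT nint => /(vo_int Y0ops (exp_Delta_len e ebar l vb)) yint.
  have -> : q + b%:R * hs = q + l%:R + b%:R * hs - l%:R by ring.
  by apply: rpredB => //; apply: rpred_nat.
Qed.

End ActualVertex.

Lemma nsum_lin2 (K : nzRingType) (X : lmodType K) c1 c2 (F1 F2 F3 : nat -> X) :
  (exists N, vanish_from N F1) -> (exists N, vanish_from N F2) ->
  (forall k, F3 k = c1 *: F1 k + c2 *: F2 k) ->
  fsum F3 = c1 *: fsum F1 + c2 *: fsum F2.
Proof.
move=> [N1 N1P] [N2 N2P] e; pose N := maxn N1 N2.
have v1 : vanish_from N F1 by move=> k; rewrite geq_max => /andP[/N1P].
have v2 : vanish_from N F2 by move=> k; rewrite geq_max => /andP[_ /N2P].
rewrite (nsumE v1) (nsumE v2) (@nsumE _ N).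
  by rewrite !scaler_sumr -big_split; apply: eq_bigr => k _; apply: e.
by move=> k Nk; rewrite e v1 // v2 // !scaler0 addr0.
Qed.

Lemma nsum_lin3 (K : nzRingType) (X : lmodType K) c c1 (F F1 F2 : nat -> X) :
  (exists N, vanish_from N F) -> (exists N, vanish_from N F1) ->
  (exists N, vanish_from N F2) ->
  (forall k, c *: F k = c1 *: F1 k + F2 k) ->
  c *: fsum F = c1 *: fsum F1 + fsum F2.
Proof.
move=> vF v1 v2 e; rewrite -[fsum F2]scale1r -[LHS]addr0 -(scale0r (fsum F)).
rewrite -(nsum_lin2 vF vF (fun _ => erefl)); apply: nsum_lin2 => // k.
by rewrite scale0r addr0 scale1r e.
Qed.

(** * The actual kernel and the derivative property *)

Section Kernel.
Local Notation b := (gbinom (- 2^-1)).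

Lemma gbinom_half_S m : b m.+1 = - ((2 * m + 1)%:R / (2 * m.+1)%:R) * b m.
Proof.
apply: (@natr_inj_mul m); rewrite gbinomS !(natrD, natrM) -!(natr1 m).
by have m0 : 0 <= m%:R :> rat := ler0n _ m; field; lra.
Qed.

(** The symmetric naive part and the antisymmetric correction combine through 1 + (m-i)/(m+i+1) =
    (2m+1)/(m+i+1). *)
Lemma KactualE m i : Kactual m i = - b m * b i * (2 * m + 1)%:R / (2 * (m + i + 1))%:R.
Proof.
rewrite /Kactual /Knaive /Defs.coefC !(natrD, natrM).
have m0 : 0 <= m%:R :> rat := ler0n _ m; have i0 : 0 <= i%:R :> rat := ler0n _ i.
by move: (b m) (b i) => bm bi; field; lra.
Qed.

Lemma Kactual_der m i : m.+1%:R * Kactual m.+1 i + i.+1%:R * Kactual m i.+1 =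
  - (m + i + 1)%:R * Kactual m i.
Proof.
rewrite !KactualE !gbinom_half_S !(natrD, natrM) -!(natr1 m) -!(natr1 i).
have m0 : 0 <= m%:R :> rat := ler0n _ m; have i0 : 0 <= i%:R :> rat := ler0n _ i.
by move: (b m) (b i) => bm bi; field; lra.
Qed.

Lemma gbinom_half_pos n : gbinom (2^-1) n * (n%:R - 2^-1) = - 2^-1 * b n.
Proof.
have := gbinomS (- 2^-1) n; have e := gbinomSl (- 2^-1) n.
have := gbinomS (- 2^-1 + 1) n.
have -> : (- 2^-1 + 1 : rat) = 2^-1 by lra.
move: e; have -> : (- 2^-1 + 1 : rat) = 2^-1 by lra.
lra.
Qed.

Lemma Kactual_diff m n :
  (if m is m'.+1 then Kactual m' n else 0) - (if n is n'.+1 then Kactual m n' else 0) =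
  b m * gbinom (2^-1) n - ((m == 0%N) && (n == 0%N))%:R.
Proof.
(* All coefficients are expressed by [b], and what remains is an identity of rational functions with
   nonvanishing denominators. *)
have gn0 k : gbinom (2^-1) k = - 2^-1 * b k / (k%:R - 2^-1).
  rewrite -gbinom_half_pos mulfK // subr_eq0; apply/negP => /eqP k2.
  have : (2 * k)%:R = 1%:R :> rat by rewrite natrM k2; lra.
  by move/eqP; rewrite eqr_nat; apply/negP/eqP; lia.
have nh k : (2 * k%:R - 1 : rat) != 0.
  apply/negP; rewrite subr_eq0 => /eqP k2.
  have : (2 * k)%:R = 1%:R :> rat by rewrite natrM k2.
  by move/eqP; rewrite eqr_nat; apply/negP/eqP; lia.
rewrite gn0; case: m n => [|m] [|n]; rewrite ?gbinom0 /= ?subr0 ?sub0r.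
- by field.
- have n0 : 0 <= n%:R :> rat := ler0n _ n.
  rewrite KactualE gbinom0 gbinom_half_S !(natrD, natrM) -!(natr1 n).
  have := nh n.+1; rewrite -(natr1 n) => nn.
  by move: (b n) => bn; field; lra.
- have m0 : 0 <= m%:R :> rat := ler0n _ m.
  rewrite KactualE gbinom0 gbinom_half_S !(natrD, natrM) -!(natr1 m).
  by move: (b m) => bm; field; lra.
- have m0 : 0 <= m%:R :> rat := ler0n _ m; have n0 : 0 <= n%:R :> rat := ler0n _ n.
  rewrite !KactualE !gbinom_half_S !(natrD, natrM) -!(natr1 m) -!(natr1 n).
  have := nh n.+1; rewrite -(natr1 n) => nn.
  by move: (b m) (b n) => bm bn; field; lra.
Qed.
End Kernel.

Section Derivation.
Variables (R : realType).
Local Notation C := R[i].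
Variables (h : lmodType C) (form : h -> h -> C).
Variable V : fock_module form HalfModes (U := C^o) (fun _ _ => 0).
Local Notation vac := (fov V (1 : C^o)).
Local Notation cre := (@cre R h form V).
Local Notation ann := (@ann R h form V).
Local Notation mono := (@mono R h form V).
Variable th : V -> V.
Hypothesis th_linear : linear th.
Hypothesis th_mono : forall l, th (mono l) = (-1) ^+ size l *: mono l.
Variable Z : V -> rat -> V -> V.
Hypothesis Zops : vops th (Knaive HalfModes) Z.

Let ZlinV := vo_linV Zops.
Let ZlinW := vo_linW Zops.

Lemma Z0 q w : Z 0 q w = 0.
Proof. exact: lin0 (ZlinV q w). Qed.

Lemma Zrec a m v q w : Z (cre a m v) q w =
  fsum (fun k => 'C(k, m)%:R *: cre a k (Z v (q - k%:R + m%:R) w)) +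
  fsum (fun k => ratr (gbinom (- k.+1%:R) m) *:
    Z (th v) (q + k.+1%:R + m%:R) (ann a k w)).
Proof.
rewrite (vo_rec Zops) [X in _ + X = _]fsum0 ?addr0.
  congr (_ + _); apply: eq_fsum => k; rewrite /= ?subr0 ?addr0 //.
  by rewrite gbinom_nat ratr_nat.
by move=> i; rewrite /Knaive rmorph0 scale0r.
Qed.

Lemma Zvac_rec a m v q : Z (cre a m v) q vac =
  fsum (fun k => 'C(k, m)%:R *: cre a k (Z v (q - k%:R + m%:R) vac)).
Proof.
rewrite Zrec [X in _ + X]fsum0 ?addr0 // => k.
by rewrite ann_vac (lin0 (ZlinW _ _)) scaler0.
Qed.

Lemma Zvac_lt0 v q : q < 0 -> Z v q vac = 0.
Proof.
move: v q; apply: (@vertex_ind _ _ _ _ (fun v => forall q : rat, q < 0 -> Z v q vac = 0)).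
- split=> [q _|c x y x0 y0 q q0]; first exact: Z0.
  by rewrite ZlinV x0 // y0 // scaler0 addr0.
- by move=> q q0; rewrite (vo_vac Zops) lt_eqF.
move=> a m v IH q q0; rewrite Zvac_rec; apply: fsum0 => k.
have [km|mk] := ltnP k m; first by rewrite bin_small ?scale0r.
rewrite IH ?(lin0 (cre_linear (V := V) a k)) ?scaler0 //.
have : m%:R <= k%:R :> rat by rewrite ler_nat.
lra.
Qed.

Lemma Zvac_0 v : Z v 0 vac = v.
Proof.
move: v; apply: vertex_ind.
- by apply: eq_lin_subspace.
- by rewrite (vo_vac Zops) eqxx.
move=> a m v IH; rewrite Zvac_rec (@fsum1 _ _ m).
  by rewrite binn scale1r sub0r addNr IH.
move=> k km; have [ltkm|mk] := ltnP k m; first by rewrite bin_small ?scale0r.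
rewrite Zvac_lt0 ?(lin0 (cre_linear (V := V) a k)) ?scaler0 //.
have : m%:R < k%:R :> rat by rewrite ltr_nat ltn_neqAle eq_sym km.
by lra.
Qed.

(** The operator D_V: the constant term of the derivative is the coefficient of x^1. *)
Definition Dop (v : V) : V := Z v 1 vac.

Lemma Dop_linear : linear Dop.
Proof. exact: ZlinV. Qed.

Lemma Dop_vac : Dop vac = 0.
Proof. by rewrite /Dop (vo_vac Zops) oner_eq0. Qed.

(** Only k = m and k = m+1 survive in the recursion: smaller k have a zero binomial, and larger k
    would need a negative power of x in Z(v,x) applied to the vacuum. *)
Lemma Dop_cre a m v : Dop (cre a m v) = m.+1%:R *: cre a m.+1 v + cre a m (Dop v).
Proof.
rewrite /Dop Zvac_rec (@nsum_shift _ m.+2 m).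
- rewrite (@nsumE _ 2).
    rewrite big_ord_recl big_ord1 /= addn0 binn scale1r addn1 binSn addrC.
    have -> : 1 - m.+1%:R + m%:R = 0 :> rat by lra.
    by rewrite subrK Zvac_0.
  move=> k k2; rewrite Zvac_lt0 ?(lin0 (cre_linear (V := V) a _)) ?scaler0 //.
  have : 2%:R <= k%:R :> rat by rewrite ler_nat.
  by rewrite natrD; lra.
- move=> k k2; rewrite Zvac_lt0 ?(lin0 (cre_linear (V := V) a _)) ?scaler0 //.
  have : m.+2%:R <= k%:R :> rat by rewrite ler_nat.
  lra.
- by move=> k km; rewrite bin_small ?scale0r.
Qed.

Lemma Dop_th v : th (Dop v) = Dop (th v).
Proof.
have tC a m v' : th (cre a m v') = - cre a m (th v') by exact: th_cre.
move: v; apply: vertex_ind.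
- by apply: eq_lin_subspace; apply: comp_linear => //; apply: Dop_linear.
- by rewrite Dop_vac (th_vac th_mono) Dop_vac (lin0 th_linear).
move=> a m v IH; rewrite Dop_cre (linD th_linear) (linZ th_linear) !tC IH.
by rewrite (linN Dop_linear) Dop_cre opprD scalerN.
Qed.

Lemma Dop_ann a i v : ann a i (Dop v) = Dop (ann a i v) + i%:R *: ann a i.-1 v.
Proof.
move: v; apply: vertex_ind.
- apply: eq_lin_subspace.
    by apply: comp_linear; [exact: ann_linear | exact: Dop_linear].
  apply: add_linear; last exact/scale_linear/ann_linear.
  by apply: comp_linear; [exact: Dop_linear | exact: ann_linear].
- by rewrite Dop_vac !ann_vac (lin0 Dop_linear) (lin0 (ann_linear (V := V) a i)) scaler0 addr0.
move=> b m v IH; rewrite Dop_cre (linD (ann_linear (V := V) a i)).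
rewrite (linZ (ann_linear (V := V) a i)) !ann_cre IH (linB Dop_linear) (linZ Dop_linear).
rewrite Dop_cre (linD (cre_linear (V := V) b m)) (linZ (cre_linear (V := V) b m)).
have -> : i%:R *: ((form a b *+ (i.-1 == m)) *: v - cre b m (ann a i.-1 v)) =
  m.+1%:R *: ((form a b *+ (i == m.+1)) *: v) - i%:R *: cre b m (ann a i.-1 v).
  rewrite scalerBr; congr (_ - _); case: i {IH} => [|i] /=.
    by rewrite !mulr0n !scale0r scaler0.
  by rewrite eqSS; case: eqVneq => [->|_] //; rewrite !mulr0n scale0r !scaler0.
rewrite scalerBr !opprD !addrA; congr (_ - _).
by rewrite [RHS]addrC !addrA; congr (_ - _); rewrite addrAC.
Qed.

Section Module.
Variables (s : sector) (U : lmodType C) (act0 : h -> U -> U).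
Local Notation hs := (hshift s).
Variable W : fock_module form s act0.
Local Notation mo := (@fmo R h form s U act0 W).
Variables (K : nat -> nat -> rat) (Y : V -> rat -> W -> W).
Hypothesis Yops : vops th K Y.
Hypothesis K_der : forall m i,
  m.+1%:R * K m.+1 i + i.+1%:R * K m i.+1 = - (m + i + 1)%:R * K m i.

Let linV := vo_linV Yops.
Let linW := vo_linW Yops.
Let Yfilt := vo_filt Yops.

Lemma scalerAr (x y : rat) (w : W) : ratr x *: (ratr y *: w) = ratr (x * y) *: w.
Proof. by rewrite scalerA -rmorphM. Qed.

Lemma scalerDr2 (x y : rat) (w : W) : ratr x *: w + ratr y *: w = ratr (x + y) *: w.
Proof. by rewrite -scalerDl -rmorphD. Qed.

(** The Leibniz rule on coefficients: m+1 times the divided derivative of order m+1 of the field,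
    plus the field of order m times the derivative of the rest, is the derivative of the product. *)
Lemma gbinom_der (x q : rat) m :
  m.+1%:R * gbinom x m.+1 + gbinom x m * (q - x + m%:R + 1) = (q + 1) * gbinom x m.
Proof. by rewrite gbinomS; ring. Qed.

Lemma Y_derivative v q w : ratr (q + 1) *: Y v (q + 1) w = Y (Dop v) q w.
Proof.
pose E q w v := ratr (q + 1) *: Y v (q + 1) w = Y (Dop v) q w.
have sE q' w' : subspace (E q' w').
  apply: eq_lin_subspace; first exact: scale_linear.
  by apply: (comp_linear (f := fun v => Y v q' w')) => //; apply: Dop_linear.
(* Induction on a strict bound for the length: for u of length below r it applies at once to u, to
   [th u] and to every [ann a i u]. *)
suff H r u : lspan_len (fun n => (n < r)%N) u -> forall q w, E q w u.
  move: v; apply: mono_span; first exact: sE.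
  by move=> l; apply: (H (size l).+1); apply: lspan_len_mono.
elim: r u => [|r IH] u ur q' w'; move: u ur; apply: lspan_min => //.
  by move=> _ [l] //.
move=> _ [[|[a m] l] lr ->]; rewrite /E.
  rewrite -[mono [::]]/vac Dop_vac (lin0 (linV q' w')) (vo_vac Yops).
  by case: eqVneq => [->|_]; rewrite ?rmorph0 ?scale0r ?scaler0.
rewrite mono_cons; have ur : lspan_len (fun n => (n < r)%N) (mono l).
  by apply: lspan_len_mono.
move: {l lr} (mono l) ur => u ur.
have IHu q'' w'' := IH _ ur q'' w''.
have IHth q'' w'' : E q'' w'' (th u).
  apply: IH; move: u ur {IHu}; apply: lspan_min.
    exact: (linear_subspace_pre th_linear (lspan_len_subspace _ _)).
  move=> _ [l lr ->]; rewrite th_mono; apply: subspaceZ; first exact: lspan_len_subspace.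
  exact: lspan_len_mono.
have IHann i q'' w'' : E q'' w'' (ann a i u).
  by apply: IH; apply: lspan_len_ann ur => n /ltnW.
rewrite Dop_cre (linD (linV q' w')) (linZ (linV q' w')) !(vo_rec Yops).
rewrite !scalerDr [RHS]addrACA; congr (_ + _); last first.
  have [N NP] := ann_large u; have [N' N'P] := ann_large (Dop u).
  have Y0 q'' w'' : Y 0 q'' w'' = 0 := lin0 (linV q'' w'').
  pose G i := ratr (K m i * (q' + m%:R + i%:R + 2%:R)) *: Y (ann a i u) (q' + m%:R + i%:R + 2%:R) w'.
  (* G' collects the terms i a(i-1/2) of [Dop_ann]; its term at i = 0 vanishes, and G2 is the same
     series with the index moved down by one. Coefficientwise, G1, G and G2 then meet in [K_der]. *)
  pose G' i := ratr (K m i * i%:R) *: Y (ann a i.-1 u) (q' + m%:R + i%:R + 1) w'.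
  pose G2 i := ratr (K m i.+1 * i.+1%:R) *: Y (ann a i u) (q' + m%:R + i%:R + 2%:R) w'.
  pose G1 i := ratr (K m.+1 i) *: Y (ann a i u) (q' + m.+1%:R + i%:R + 1) w'.
  have vG : vanish_from N G by move=> i /NP; rewrite /G => ->; rewrite Y0 scaler0.
  have vG2 : vanish_from N G2 by move=> i /NP; rewrite /G2 => ->; rewrite Y0 scaler0.
  have vG1 : vanish_from N G1 by move=> i /NP; rewrite /G1 => ->; rewrite Y0 scaler0.
  have vG' : vanish_from N.+1 G'.
    by move=> [|i] // iN; rewrite /G' /= NP // Y0 scaler0.
  have -> : fsum (fun i => ratr (K m i) *: Y (ann a i (Dop u)) (q' + m%:R + i%:R + 1) w') =
      1 *: fsum G + 1 *: fsum G2.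
    have -> : fsum G2 = fsum G'.
      rewrite (nsumS vG') {1}/G' mulr0 rmorph0 scale0r add0r; apply: eq_fsum => i.
      rewrite /G2 /G' /=; congr (_ *: Y _ _ _); lra.
    apply: nsum_lin2; [by exists N | by exists N.+1 | move=> i].
    rewrite !scale1r Dop_ann (linD (linV _ w')) -IHann scalerDr.
    have iE : (i%:R : C) = ratr i%:R by rewrite ratr_nat.
    have -> : q' + m%:R + i%:R + 1 + 1 = q' + m%:R + i%:R + 2%:R by lra.
    by rewrite (linZ (linV _ w')) iE !scalerAr.
  rewrite -/(fsum G1) !scale1r addrA.
  rewrite -[fsum G]scale1r -(@nsum_lin2 _ _ _ _ _ _ (fun i => m.+1%:R *: G1 i + 1 *: G i)) //;
    [|by exists N|by exists N].
  have vS : vanish_from N (fun i => m.+1%:R *: G1 i + 1 *: G i).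
    by move=> i iN; rewrite vG1 // vG // !scaler0 addr0.
  rewrite -[fsum (fun _ => _ + _)]scale1r -[fsum G2]scale1r.
  rewrite -(@nsum_lin2 _ _ _ _ _ _ (fun i => ratr (q' + 1) *: (ratr (K m i) *:
      Y (ann a i u) (q' + 1 + m%:R + i%:R + 1) w'))); [|by exists N|by exists N|].
    apply: (@lin_fsum _ _ _ _ (scale_linear _ (@id_linear _ W)) _ (iota 0 N)).
    by apply: vanish_finsupp => i /NP ->; rewrite Y0 scaler0.
  move=> i; have mE : (m.+1%:R : C) = ratr m.+1%:R by rewrite ratr_nat.
  rewrite !scale1r /G1 /G /G2 mE !scalerAr.
  have -> : q' + m.+1%:R + i%:R + 1 = q' + m%:R + i%:R + 2%:R by lra.
  have -> : q' + 1 + m%:R + i%:R + 1 = q' + m%:R + i%:R + 2%:R by lra.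
  rewrite !scalerDr2; congr (ratr _ *: _).
  have := K_der m i; rewrite natrD natrD; lra.
have mE : (m.+1%:R : C) = ratr m.+1%:R by rewrite ratr_nat.
rewrite [RHS]addrACA; congr (_ + _); apply: nsum_lin3.
- exact: (rec_cr_vanish Yfilt a m u (q' + 1) w').
- exact: (rec_cr_vanish Yfilt a m.+1 u q' w').
- exact: (rec_cr_vanish Yfilt a m (Dop u) q' w').
- move=> k; rewrite -IHu (moZ (W := W)) mE !scalerAr.
  have -> : q' + 1 - (k%:R - hs) + m%:R = q' - (k%:R - hs) + m%:R + 1 by lra.
  have -> : q' - (k%:R - hs) + m.+1%:R = q' - (k%:R - hs) + m%:R + 1 by lra.
  rewrite scalerDr2; congr (ratr _ *: _).
  by rewrite -(gbinom_der (k%:R - hs) q' m); congr (_ + _ * _); ring.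
- exact: (rec_an_vanish Yfilt a m (th u) (q' + 1) w').
- exact: (rec_an_vanish Yfilt a m.+1 (th u) q' w').
- exact: (rec_an_vanish Yfilt a m (th (Dop u)) q' w').
- move=> k; rewrite Dop_th -IHth mE !scalerAr.
  have -> : q' + 1 + (k.+1%:R + hs) + m%:R = q' + (k.+1%:R + hs) + m%:R + 1 by lra.
  have -> : q' + (k.+1%:R + hs) + m.+1%:R = q' + (k.+1%:R + hs) + m%:R + 1 by lra.
  rewrite scalerDr2; congr (ratr _ *: _).
  by rewrite -(gbinom_der (- (k.+1%:R + hs)) q' m); congr (_ + _ * _); ring.
Qed.
End Module.
End Derivation.

(** * Associativity of formal series *)

Section FormalCalculus.
Variables (R : realType).
Local Notation C := R[i].
Variable X : lmodType C.
Implicit Types (f A B : rat -> rat -> X) (x y r s t p q : rat).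

(** The first argument is the exponent of x2 for products and of x0 for iterates. Bounding it below
    makes the binomial expansions finite sums; bounding the total degree controls the infinite sums
    over creation modes. Nothing is asked of the second exponent alone. *)
Definition truncated f := exists N : rat, forall p q, p < N \/ p + q < N -> f p q = 0.

Lemma truncated_fsum f (c : nat -> C) x (g : nat -> rat) : truncated f ->
  exists N, vanish_from N (fun k => c k *: f (x - k%:R) (g k)).
Proof.
move=> [B BP]; have [N NP] := nat_large (x - B).
by exists N => k /NP kN; rewrite BP ?scaler0 //; left; lra.
Qed.

Definition mulx1 s A : rat -> rat -> X := fun q r => A q (r - s).

Lemma truncated_mulx1 s A : truncated A -> truncated (mulx1 s A).
Proof.
move=> [N NP]; exists (Num.min N (N + s)) => p q; rewrite !lt_min /mulx1 => H.
by apply: NP; case: H => /andP[H1 H2]; [left | right; lra].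
Qed.

(* A x2^q x1^r is read off at [A q r]; [expand A p q] is the coefficient of
   x0^p x2^q in A(x0+x2,x2), expanded in nonnegative powers of x2. *)
Definition expand A p q : X :=
  fsum (fun k : nat => ratr (gbinom (p + k%:R) k) *: A (q - k%:R) (p + k%:R)).

(* (x2+x0)^r B(x0,x2), expanded in nonnegative powers of x0. *)
Definition binmul r B : rat -> rat -> X := fun p q =>
  fsum (fun k : nat => ratr (gbinom r k) *: B (p - k%:R) (q - r + k%:R)).

Lemma truncated_binmul r B : truncated B -> truncated (binmul r B).
Proof.
move=> [N NP]; exists (Num.min N (N + r)) => p q; rewrite !lt_min => H.
apply: fsum0 => k; rewrite NP ?scaler0 //; have k0 : 0 <= k%:R :> rat := ler0n _ k.
by case: H => /andP[H1 H2]; [left; lra | right; lra].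
Qed.

Lemma gbinom0l k : gbinom 0 k = (k == 0)%N%:R.
Proof.
by have := gbinom_nat 0 k; rewrite bin0n.
Qed.

Lemma binmul0 B : binmul 0 B = B.
Proof.
apply/funext => p; apply/funext => q; rewrite /binmul (@fsum1 _ _ 0%N).
  by rewrite gbinom0 rmorph1 scale1r mulr0n !subr0 ?addr0.
by move=> k /negPf k0; rewrite gbinom0l k0 rmorph0 scale0r.
Qed.

Lemma binmulM r s B : truncated B -> binmul r (binmul s B) = binmul (r + s) B.
Proof.
move=> tB; apply/funext => p; apply/funext => q; case: (tB) => N NP.
have [K KP] := nat_large (p - N).
pose F (k l : nat) := (ratr (gbinom r k) * ratr (gbinom s l)) *:
  B (p - (k + l)%:R) (q - (r + s) + (k + l)%:R).
have F0 k l : (K <= k + l)%N -> F k l = 0.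
  by move=> /KP kl; rewrite /F NP ?scaler0 //; left; lra.
transitivity (fsum (fun k => fsum (F k))).
  apply: eq_fsum => k; rewrite /binmul.
  have [n nP] := truncated_fsum (fun l => ratr (gbinom s l))
    (p - k%:R) (fun l => q - r + k%:R - s + l%:R) tB.
  rewrite (lin_fsum (scale_linear _ (@id_linear _ X)) (vanish_finsupp nP)).
  apply: eq_fsum => l; rewrite /F scalerA; congr (_ *: B _ _); rewrite natrD; lra.
rewrite (nsum_diag F0); apply: eq_fsum => k.
rewrite -gbinom_vandermonde rmorph_sum scaler_suml; apply: eq_bigr => i _.
by rewrite /F rmorphM subnKC // -ltnS.
Qed.

Lemma binmul1 B p q : binmul 1 B p q = B p (q - 1) + B (p - 1) q.
Proof.
rewrite /binmul (@nsumE _ 2).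
  rewrite big_ord_recl big_ord1 (gbinom_nat 1 0) (gbinom_nat 1 1) !ratr_nat.
  by rewrite !scale1r mulr0n subr0 ?addr0 subrK.
by move=> k k2; rewrite (gbinom_nat 1 k) bin_small // rmorph0 scale0r.
Qed.

(** Multiplication by x1 is multiplication by x0 + x2, by Pascal's rule. *)
Lemma expand_mulx1 A p q : truncated A ->
  expand (mulx1 1 A) p q = expand A (p - 1) q + expand A p (q - 1).
Proof.
move=> tA.
have [N1 v1] := truncated_fsum (fun k => ratr (gbinom (p - 1 + k%:R) k)) q
  (fun k => p - 1 + k%:R) tA.
have [N2 v2] := truncated_fsum (fun k => ratr (gbinom (p + k%:R) k)) (q - 1)
  (fun k => p + k%:R) tA.
pose G (k : nat) : X := if k is k'.+1 then
  ratr (gbinom (p + k'%:R) k') *: A (q - 1 - k'%:R) (p + k'%:R) else 0.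
have vG : vanish_from N2.+1 G by case=> // k; apply: v2.
have -> : expand A p (q - 1) = fsum G by rewrite (nsumS vG) add0r.
rewrite -(@fsumD _ _ (iota 0 (maxn N1 N2.+1))); first last.
- by apply: vanish_finsupp => k; rewrite geq_max => /andP[_ /vG].
- by apply: vanish_finsupp => k; rewrite geq_max => /andP[/v1].
apply: eq_fsum => k; rewrite /mulx1.
have -> : p - 1 + k%:R = p + k%:R - 1 by lra.
case: k => [|k]; first by rewrite /G !gbinom0 [RHS]addr0.
rewrite /G; have -> : q - 1 - k%:R = q - k.+1%:R by lra.
have -> : p + k%:R = p + k.+1%:R - 1 by lra.
by rewrite -scalerDl -rmorphD -gbinom_pascal subrK.
Qed.

(** Weak associativity freed of vertex operators: x1^r A at x1 = x0 + x2, expanded in x2, agrees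
    with (x2 + x0)^r B, expanded in x0. The exponent r may be a half-integer. *)
Record assoc r A B : Prop := Assoc {
  assocA : truncated A;
  assocB : truncated B;
  assocE : forall p q, expand (mulx1 r A) p q = binmul r B p q }.

(** Only a natural number is added, because a polynomial factor (x0 + x2)^n is the same in both
    expansions. *)
Lemma assoc_raise r (n : nat) A B : assoc r A B -> assoc (r + n%:R) A B.
Proof.
case=> tA tB AB; elim: n => [|n [_ _ IH]]; first by rewrite addr0; split.
split=> // p q; have -> : r + n.+1%:R = 1 + (r + n%:R) by lra.
rewrite -(binmulM 1 (r + n%:R) tB) binmul1 -(IH p (q - 1)) -(IH (p - 1) q) [RHS]addrC.
rewrite -(expand_mulx1 p q (truncated_mulx1 (r + n%:R) tA)).
congr (expand _ p q); apply/funext => s; apply/funext => t; congr (A _ _); lra.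
Qed.

Lemma assoc_raise' r r' (n : nat) A B : r' = r + n%:R -> assoc r A B -> assoc r' A B.
Proof. by move=> ->; apply: assoc_raise. Qed.

(** A factor x1^s with arbitrary s, in particular negative or half-integral, is traded against the
    exponent. The only condition is that r' + s exceeds r by a natural number. *)
Lemma assoc_shift r r' s (n : nat) A B : r' + s = r + n%:R -> assoc r A B ->
  assoc r' (mulx1 s A) (binmul s B).
Proof.
move=> e /(assoc_raise n) [tA tB AB]; split.
- exact: truncated_mulx1.
- exact: truncated_binmul.
move=> p q; rewrite (binmulM r' s tB) e -AB; congr (expand _ p q).
by apply/funext => s'; apply/funext => t; congr (A _ _); lra.
Qed.

Lemma assoc_mulx2 r t A B : assoc r A B ->
  assoc r (fun q s => A (q - t) s) (fun p q => B p (q - t)).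
Proof.
case=> -[N NP] [N' N'P] AB; split.
- exists (N + t) => p q H; apply: NP; by case: H => H; [left | right]; lra.
- exists (Num.min N' (N' + t)) => p q; rewrite !lt_min => H; apply: N'P.
  by case: H => /andP[H1 H2]; [left | right; lra].
move=> p q; have := AB p (q - t); rewrite /expand /binmul /mulx1 => AB'.
under eq_fsum => k do rewrite addrAC.
by rewrite AB'; apply: eq_fsum => k; congr (_ *: B _ _); lra.
Qed.

Lemma truncated_subspace : subspace truncated.
Proof.
split=> [|c f g [N NP] [N' N'P]]; first by exists 0.
exists (Num.min N N') => p q; rewrite !lt_min => H.
rewrite -[(c *: f + g) p q]/(c *: f p q + g p q) NP ?N'P ?scaler0 ?addr0 //.
all: by case: H => /andP[H1 H2]; [left | right].
Qed.

Lemma assoc_lin r c A A' B B' : assoc r A B -> assoc r A' B' ->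
  assoc r (fun q s => c *: A q s + A' q s) (fun p q => c *: B p q + B' p q).
Proof.
case=> tA tB AB [tA' tB' AB']; split.
- by case: truncated_subspace => _; apply.
- by case: truncated_subspace => _; apply.
move=> p q; rewrite /expand /binmul.
rewrite (@nsum_lin2 _ _ c 1 (fun k => ratr (gbinom (p + k%:R) k) *:
    mulx1 r A (q - k%:R) (p + k%:R)) (fun k => ratr (gbinom (p + k%:R) k) *:
    mulx1 r A' (q - k%:R) (p + k%:R))); first last.
- by move=> k; rewrite /mulx1 scalerDr scale1r !scalerA mulrC.
- by apply: truncated_fsum; apply: truncated_mulx1.
- by apply: truncated_fsum; apply: truncated_mulx1.
rewrite -/(expand _ _ _) -/(expand _ _ _) AB AB'.
rewrite (@nsum_lin2 _ _ c 1 (fun k => ratr (gbinom r k) *: B (p - k%:R) (q - r + k%:R))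
  (fun k => ratr (gbinom r k) *: B' (p - k%:R) (q - r + k%:R))) //; first last.
- by move=> k; rewrite scalerDr scale1r !scalerA mulrC.
- exact: truncated_fsum.
- exact: truncated_fsum.
Qed.

Lemma assoc0 r : assoc r (fun _ _ => 0) (fun _ _ => 0).
Proof.
have t0 : truncated (fun _ _ => 0 : X) by exists 0.
by split=> // p q; rewrite /expand /binmul !fsum0 // => k; exact: scaler0.
Qed.

Lemma eq_assoc r A A' B B' : (forall q s, A q s = A' q s) ->
  (forall p q, B p q = B' p q) -> assoc r A B -> assoc r A' B'.
Proof.
move=> eA eB; have -> : A' = A by apply/funext => q; apply/funext => s.
by have -> : B' = B by apply/funext => q; apply/funext => s.
Qed.

Lemma assocD r A A' B B' : assoc r A B -> assoc r A' B' ->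
  assoc r (fun q s => A q s + A' q s) (fun p q => B p q + B' p q).
Proof.
move=> AB AB'; apply: eq_assoc (assoc_lin 1 AB AB') => * /=; by rewrite scale1r.
Qed.

Lemma assocZ r c A B : assoc r A B ->
  assoc r (fun q s => c *: A q s) (fun p q => c *: B p q).
Proof.
move=> AB; apply: eq_assoc (assoc_lin c AB (assoc0 r)) => * /=; by rewrite addr0.
Qed.

Lemma assoc_sum r n (A B : nat -> rat -> rat -> X) :
  (forall k, (k < n)%N -> assoc r (A k) (B k)) ->
  assoc r (fun q s => \sum_(k < n) A k q s) (fun p q => \sum_(k < n) B k p q).
Proof.
elim: n => [|n IH] AB.
  by apply: eq_assoc (assoc0 r) => *; rewrite big_ord0.
apply: eq_assoc (assocD (IH _) (AB n _)) => // *; rewrite ?big_ord_recr //.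
by apply: AB; apply: ltnW.
Qed.

Lemma assoc_map r (L : X -> X) A B : linear L -> assoc r A B ->
  assoc r (fun q s => L (A q s)) (fun p q => L (B p q)).
Proof.
move=> lL [tA tB AB]; split.
- by case: tA => N NP; exists N => p q /NP ->; rewrite (lin0 lL).
- by case: tB => N NP; exists N => p q /NP ->; rewrite (lin0 lL).
move=> p q; have [n nP] := truncated_fsum (fun k => ratr (gbinom (p + k%:R) k)) q
  (fun k => p + k%:R) (truncated_mulx1 r tA).
have [m mP] := truncated_fsum (fun k => ratr (gbinom r k)) p (fun k => q - r + k%:R) tB.
have := congr1 L (AB p q); rewrite (lin_fsum lL (vanish_finsupp nP)).
rewrite (lin_fsum lL (vanish_finsupp mP)) => AB'.
rewrite /expand /binmul /mulx1; under eq_fsum => k do rewrite -(linZ lL).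
by rewrite AB'; apply: eq_fsum => k; rewrite (linZ lL).
Qed.

(* Locally finite sums, such as \sum_k a(-k) x^k A. *)
Lemma assoc_fsum r (A B : nat -> rat -> rat -> X) (N : rat) :
  (forall k, assoc r (A k) (B k)) ->
  (forall k p q, p < N \/ p + q < N + k%:R -> A k p q = 0) ->
  (forall k p q, p < N \/ p + q < N + k%:R -> B k p q = 0) ->
  assoc r (fun q s => fsum (fun k => A k q s)) (fun p q => fsum (fun k => B k p q)).
Proof.
move=> AB A0 B0.
have k0 k : 0 <= k%:R :> rat := ler0n _ k.
split.
- by exists N => p q H; apply: fsum0 => k; apply: A0; have := k0 k; case: H; [left|right; lra].
- by exists N => p q H; apply: fsum0 => k; apply: B0; have := k0 k; case: H; [left|right; lra].
move=> p q; pose FA (l k : nat) := ratr (gbinom (p + l%:R) l) *: A k (q - l%:R) (p + l%:R - r).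
pose FB (l k : nat) := ratr (gbinom r l) *: B k (p - l%:R) (q - r + l%:R).
have [M MP] := nat_large (p + q - r - N); have [L LP] := nat_large (q - N).
have [L' L'P] := nat_large (p - N).
have FA0 l k : FA l k != 0 -> (l \in iota 0 L) && (k \in iota 0 M).
  rewrite !mem_iota !add0n /=; apply: contra_neqT; rewrite negb_and -!leqNgt.
  move=> H; rewrite /FA A0 ?scaler0 //; case/orP: H => [/LP ?|/MP ?]; [left|right]; lra.
have FB0 l k : FB l k != 0 -> (l \in iota 0 L') && (k \in iota 0 M).
  rewrite !mem_iota !add0n /=; apply: contra_neqT; rewrite negb_and -!leqNgt.
  move=> H; rewrite /FB B0 ?scaler0 //; case/orP: H => [/L'P ?|/MP ?]; [left|right]; lra.
transitivity (fsum (fun l => fsum (FA l))).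
  apply: eq_fsum => l; have vA : vanish_from M (fun k => A k (q - l%:R) (p + l%:R - r)).
    by move=> k /MP kM; apply: A0; right; lra.
  exact: (lin_fsum (scale_linear _ (@id_linear _ X)) (vanish_finsupp vA)).
transitivity (fsum (fun l => fsum (FB l))); last first.
  apply: eq_fsum => l; have vB : vanish_from M (fun k => B k (p - l%:R) (q - r + l%:R)).
    by move=> k /MP kM; apply: B0; right; lra.
  exact/esym/(lin_fsum (scale_linear _ (@id_linear _ X)) (vanish_finsupp vB)).
rewrite (fsum_exchange FA0) (fsum_exchange FB0); apply: eq_fsum => k.
exact: (assocE (AB k) p q).
Qed.

(** The factor x1 - x2 is x0, and multiplication by x0 merely shifts the exponent p on both sides.
    It can therefore be cancelled without raising r. *)
Lemma assoc_div r A B : truncated A -> truncated B ->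
  assoc r (fun q s => A q (s - 1) - A (q - 1) s) (fun p q => B (p - 1) q) ->
  assoc r A B.
Proof.
move=> tA tB [_ _ AB]; split=> // p q.
have -> : binmul r B p q = binmul r (fun p q => B (p - 1) q) (p + 1) q.
  by apply: eq_fsum => k; congr (_ *: B _ _); lra.
rewrite -(AB (p + 1) q); have tA' := truncated_mulx1 r tA.
have [N1 v1] := truncated_fsum (fun k => ratr (gbinom (p + 1 + k%:R) k)) q
  (fun k => p + 1 + k%:R) (truncated_mulx1 1 tA').
have [N2 v2] := truncated_fsum (fun k => ratr (gbinom (p + 1 + k%:R) k)) (q - 1)
  (fun k => p + 1 + k%:R) tA'.
transitivity (1 *: expand (mulx1 1 (mulx1 r A)) (p + 1) q +
  (-1) *: expand (mulx1 r A) (p + 1) (q - 1)).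
  by rewrite expand_mulx1 // scale1r scaleN1r !addrK.
apply/esym/(nsum_lin2 (ex_intro _ N1 v1) (ex_intro _ N2 v2)) => k.
rewrite /mulx1 scale1r scaleN1r -scalerBr; congr (_ *: (A _ _ - A _ _)); lra.
Qed.
End FormalCalculus.

Lemma addr_transpose (X : zmodType) (x y z t u : X) :
  x + t = z + (u + y) -> x - y = z - t + u.
Proof. by move/(canRL (addrK t)) => ->; rewrite addrA [LHS]addrAC addrK addrAC. Qed.

(** * Associativity under the contraction kernel *)

Section ContractionSeries.
Variables (R : realType).
Local Notation C := R[i].
Variable X : lmodType C.
Implicit Types (A B : rat -> rat -> X) (p q r s : rat).
Local Notation b := (gbinom (- 2^-1)).
Local Notation c := (gbinom (2^-1)).

(** The value 0 at k = 0 makes Pascal's rule valid for all k. *)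
Definition gprev (a : rat) (k : nat) : rat := if k is k'.+1 then gbinom a k' else 0.

Lemma gbinom_prev a k : gbinom (a + 1) k = gbinom a k + gprev a k.
Proof. by case: k => [|k]; rewrite /gprev ?gbinom0 ?addr0 ?gbinom_pascal. Qed.

(* A multiplied by d_1^m d_2^n / (m! n!) of the kernel
   x1^(-1/2) x2^(1/2) / (x1 - x2), the contraction of two fields h(x); [contrB]
   is the corresponding operation on the iterate side, whose kernel is 1/x0 plus
   the regular part Kactual. *)
Definition contrA (m n : nat) A q s : X := fsum (fun k : nat =>
  ratr (gbinom (- (k.+1%:R + 2^-1)) m * gbinom (k%:R + 2^-1) n) *:
  A (q - (k%:R + 2^-1) + n%:R) (s + (k.+1%:R + 2^-1) + m%:R)).

Definition contrB (m n : nat) B p q : X :=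
  ratr (gbinom (- n.+1%:R) m) *: B (p + n.+1%:R + m%:R) q +
  fsum (fun j : nat => ratr ('C(m + j, m)%:R * Kactual (m + j) n) *:
    B (p - j%:R) (q + (m + j)%:R + n%:R + 1)).

Lemma truncated_contrA m n A : truncated A -> truncated (contrA m n A).
Proof.
move=> [N NP]; exists (N - 1 - n%:R - m%:R) => p q H; apply: fsum0 => k.
have := (ler0n rat k, ler0n rat n, ler0n rat m) => -[[k0 n0] m0].
rewrite NP ?scaler0 //; case: H => H; [left | right]; lra.
Qed.

Lemma truncated_contrB m n B : truncated B -> truncated (contrB m n B).
Proof.
move=> [N NP]; exists (N - 1 - n%:R - m%:R) => p q H.
have := (ler0n rat n, ler0n rat m) => -[n0 m0].
rewrite /contrB NP ?scaler0 ?add0r; last by case: H => H; [left | right]; lra.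
apply: fsum0 => j; have j0 := ler0n rat j.
rewrite NP ?scaler0 //; rewrite natrD; case: H => H; [left | right]; lra.
Qed.

(** Leibniz rule for the divided derivatives of (x1 - x2) times the kernel. The undifferentiated
    product is x1^(-1/2) x2^(1/2), which gives the first term; the factor x1 - x2 absorbs at most
    one derivative, which gives the other two. *)
Lemma contrA_diff m n A q s : truncated A ->
  contrA m n A q (s - 1) - contrA m n A (q - 1) s =
  ratr (b m * c n) *: A (q - (2^-1 - n%:R)) (s - (- 2^-1 - m%:R)) -
  (if m is m'.+1 then contrA m' n A q s else 0) +
  (if n is n'.+1 then contrA m n' A q s else 0).
Proof.
move=> tA; pose H k := A (q + n%:R - 2^-1 - k%:R) (s + k%:R + 2^-1 + m%:R).
have vF (F : nat -> rat) : exists N, vanish_from N (fun k => ratr (F k) *: H k).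
  exact: truncated_fsum.
have vF' (F : nat -> rat) : exists N, vanish_from N (fun k => ratr (F k) *: H k.+1).
  by have [N NP] := vF (fun k => F k.-1); exists N => k kN; apply: (NP k.+1); apply: leqW.
have e1 : contrA m n A q (s - 1) =
    fsum (fun k => ratr (gbinom (- (k.+1%:R + 2^-1)) m * gbinom (k%:R + 2^-1) n) *: H k).
  apply: eq_fsum => k; congr (_ *: A _ _); lra.
have e2 : contrA m n A (q - 1) s =
    fsum (fun k => ratr (gbinom (- (k.+1%:R + 2^-1)) m * gbinom (k%:R + 2^-1) n) *: H k.+1).
  apply: eq_fsum => k; congr (_ *: A _ _); lra.
have e3 : (if m is m'.+1 then contrA m' n A q s else 0) =
    fsum (fun k => ratr (gprev (- (k.+1%:R + 2^-1)) m * gbinom (k%:R + 2^-1) n) *: H k).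
  rewrite /H; case: (m) => [|m'].
    by rewrite fsum0 // => k; rewrite mul0r rmorph0 scale0r.
  apply: eq_fsum => k; congr (_ *: A _ _); lra.
have e4 : (if n is n'.+1 then contrA m n' A q s else 0) =
    fsum (fun k => ratr (gbinom (- (k.+1%:R + 2^-1)) m * gprev (k%:R + 2^-1) n) *: H k.+1).
  rewrite /H; case: (n) => [|n'].
    by rewrite fsum0 // => k; rewrite mulr0 rmorph0 scale0r.
  apply: eq_fsum => k; congr (_ *: A _ _); lra.
have e5 : ratr (b m * c n) *: A (q - (2^-1 - n%:R)) (s - (- 2^-1 - m%:R)) =
    ratr (gbinom (- (0%:R + 2^-1)) m * gbinom (0%:R + 2^-1) n) *: H 0%N.
  by rewrite add0r; congr (_ *: A _ _); rewrite ?mulr0n; lra.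
rewrite e1 e2 e3 e4 e5; clear e1 e2 e3 e4 e5.
(* Pascal's rule in the x1-binomial on one side and in the x2-binomial on the other makes both sides
   equal to the sum of T, the elementary term being T at 0. *)
pose T k := ratr (gbinom (- (k%:R + 2^-1)) m * gbinom (k%:R + 2^-1) n) *: H k.
have [N NP] : exists N, vanish_from N T := vF _.
apply: addr_transpose.
transitivity (fsum T); last first.
  rewrite (nsumS NP); congr (_ + _).
  rewrite addrC -[X in X + _]scale1r -[X in _ + X]scale1r; apply: nsum_lin2 => // k.
  rewrite !scale1r /T -scalerDl -rmorphD -mulrDr -gbinom_prev.
  by have -> : k%:R + 2^-1 + 1 = k.+1%:R + 2^-1 :> rat by lra.
rewrite -[X in X + _]scale1r -[X in _ + X]scale1r; apply/esym/nsum_lin2 => // k.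
rewrite !scale1r /T -scalerDl -rmorphD -mulrDl -gbinom_prev.
by have -> : - (k.+1%:R + 2^-1) + 1 = - (k%:R + 2^-1) :> rat by lra.
Qed.

(** The same Leibniz rule on the iterate side, for the kernel 1/x0 plus its regular part. It must
    produce the same three terms, with x1 replaced by x2 + x0. *)
Lemma contrB_diff m n B p q : truncated B ->
  contrB m n B (p - 1) q =
  ratr (b m * c n) *:
    binmul (- 2^-1 - m%:R) (fun p q => B p (q - (2^-1 - n%:R))) p q -
  (if m is m'.+1 then contrB m' n B p q else 0) +
  (if n is n'.+1 then contrB m n' B p q else 0).
Proof.
move=> tB; pose H j := B (p - j%:R) (q + m%:R + j%:R + n%:R).
pose B0 := B (p + n%:R + m%:R) q.
have vF (F : nat -> rat) : exists N, vanish_from N (fun k => ratr (F k) *: H k).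
  exact: truncated_fsum.
(* u, v and w are the coefficients of the regular parts of the left-hand side and of the two lower
   order terms, aligned on the common series H. *)
pose u j := if j is j'.+1 then 'C(m + j', m)%:R * Kactual (m + j') n else 0.
pose v j := if m is m'.+1 then 'C(m' + j, m')%:R * Kactual (m' + j) n else 0.
pose w j := if n is n'.+1 then 'C(m + j, m)%:R * Kactual (m + j) n' else 0.
have e1 : contrB m n B (p - 1) q = ratr (gbinom (- n.+1%:R) m) *: B0 +
    fsum (fun j => ratr (u j) *: H j).
  rewrite /contrB; congr (_ + _).
    by rewrite /B0; congr (_ *: B _ _); lra.
  have [N NP] := vF u; rewrite (nsumS NP) /u rmorph0 scale0r add0r.
  by apply: eq_fsum => j; rewrite /H; congr (_ *: B _ _); rewrite ?natrD; lra.
have e2 : (if m is m'.+1 then contrB m' n B p q else 0) =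
    ratr (gprev (- n.+1%:R) m) *: B0 + fsum (fun j => ratr (v j) *: H j).
  rewrite /v /H /B0; case: (m) => [|m'].
    by rewrite /= rmorph0 scale0r add0r fsum0 // => j; rewrite rmorph0 scale0r.
  rewrite /contrB; congr (_ + _).
    by rewrite /B0; congr (_ *: B _ _); lra.
  by apply: eq_fsum => j; rewrite /H; congr (_ *: B _ _); rewrite ?natrD; lra.
have e3 : (if n is n'.+1 then contrB m n' B p q else 0) =
    ratr (if n is n'.+1 then gbinom (- n%:R) m else 0) *: B0 +
    fsum (fun j => ratr (w j) *: H j).
  rewrite /w /H /B0; case: (n) => [|n'].
    by rewrite /= rmorph0 scale0r add0r fsum0 // => j; rewrite rmorph0 scale0r.
  rewrite /contrB; congr (_ + _).
  by apply: eq_fsum => j; rewrite /H; congr (_ *: B _ _); rewrite ?natrD; lra.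
(* The pole contributes x0 (1/x0) = 1, which survives the derivatives only for m = n = 0. It cancels
   against the -1 in [Kactual_diff]. *)
pose d : rat := ((m == 0%N) && (n == 0%N))%:R.
have e4 : ratr (b m * c n) *:
    binmul (- 2^-1 - m%:R) (fun p q => B p (q - (2^-1 - n%:R))) p q =
    fsum (fun j => ratr (b m * c n * gbinom (- 2^-1 - m%:R) j) *: H j).
  have [N NP] := vF (gbinom (- 2^-1 - m%:R)).
  have -> : binmul (- 2^-1 - m%:R) (fun p q => B p (q - (2^-1 - n%:R))) p q =
      fsum (fun j => ratr (gbinom (- 2^-1 - m%:R) j) *: H j).
    by apply: eq_fsum => j; rewrite /H; congr (_ *: B _ _); lra.
  rewrite (lin_fsum (scale_linear _ (@id_linear _ X)) (vanish_finsupp NP)).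
  by apply: eq_fsum => j; rewrite scalerA -rmorphM.
have hd : gbinom (- n.+1%:R) m + gprev (- n.+1%:R) m =
    (if n is n'.+1 then gbinom (- n%:R) m else 0) + d.
  rewrite -gbinom_prev /d; have -> : - n.+1%:R + 1 = - n%:R :> rat by lra.
  case: n {tB H B0 vF u v w e1 e2 e3 e4 d} => [|n].
    by rewrite oppr0 gbinom0l add0r andbT.
  by rewrite andbF addr0.
have uv j : u j + v j = b m * c n * gbinom (- 2^-1 - m%:R) j + w j - d * (j == 0%N)%:R.
  have -> : u j + v j = 'C(m + j, m)%:R * (if (m + j)%N is k.+1 then Kactual k n else 0).
    rewrite /u /v; case: (m) => [|m']; case: j => [|j].
    - by rewrite addr0 mulr0.
    - by rewrite !add0n !bin0 addr0.
    - by rewrite !addn0 !binn add0r.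
    - by rewrite (addSnnS m' j) addSn binS natrD mulrDl.
  have -> : w j = 'C(m + j, m)%:R * (if n is k.+1 then Kactual (m + j) k else 0).
    by rewrite /w; case: (n) => [|n'] //; rewrite mulr0.
  have := Kactual_diff (m + j) n.
  have := gbinomM (- 2^-1) m j.
  have -> : ((m + j == 0) && (n == 0))%N%:R = d * (j == 0%N)%:R.
    by rewrite /d addn_eq0 -andbA [(j == _) && _]andbC andbA -natrM mulnb.
  have : 'C(m + j, m)%:R * (d * (j == 0%N)%:R) = d * (j == 0%N)%:R.
    rewrite /d; case: (m) => [|m']; last by rewrite !mul0r mulr0.
    by rewrite bin0 mul1r.
  move: (d * _) (gbinom (- 2^-1 - m%:R) j) (b (m + j)%N) (b m) (c n) => x g1 g2 g3 g4.
  move: (if (m + j)%N is _.+1 then _ else _) (if n is _.+1 then _ else _) => k1 k2.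
  move=> cx g12 /eqP; rewrite subr_eq => /eqP ->; rewrite mulrDr mulrBr cx mulrA g12.
  by rewrite addrAC [g3 * g1 * g4]mulrAC.
rewrite e1 e2 e3 e4; clear e1 e2 e3 e4.
have ratrD2 F G : fsum (fun j => ratr (F j + G j) *: H j) =
    fsum (fun j => ratr (F j) *: H j) + fsum (fun j => ratr (G j) *: H j).
  rewrite -[X in X + _]scale1r -[X in _ + X]scale1r; apply: nsum_lin2 => // j.
  by rewrite !scale1r -scalerDl -rmorphD.
rewrite -[LHS]subr0; apply: addr_transpose; rewrite addr0 addrACA.
rewrite -scalerDl -rmorphD hd -ratrD2 rmorphD scalerDl addrCA -!addrA; congr (_ + _).
have -> : ratr d *: B0 = fsum (fun j => ratr (d * (j == 0)%N%:R) *: H j).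
  rewrite (@fsum1 _ _ 0%N) /=; last by move=> j /negPf ->; rewrite mulr0 rmorph0 scale0r.
  rewrite mulr1 /d /B0 /H; case: eqP => [->|_]; last by rewrite !rmorph0 !scale0r.
  case: eqP => [->|_]; last by rewrite !rmorph0 !scale0r.
  by congr (_ *: B _ _); rewrite !mulr0n; lra.
rewrite -!ratrD2; apply: eq_fsum => j; congr (ratr _ *: _); rewrite uv; lra.
Qed.

(** Induction on m + n: after multiplication by x1 - x2, [contrA_diff] and [contrB_diff] leave an
    elementary term and kernels of lower order. The exponent does not involve n, the derivation
    order belonging to v2; this is what keeps P independent of v2. *)
Lemma assoc_contr m n r A B : assoc r A B ->
  assoc (r + m%:R + 2^-1) (contrA m n A) (contrB m n B).
Proof.
move=> AB; have [N] := ubnP (m + n); elim: N m n => // N IH m n mnN.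
have [tA tB _] := AB; apply: assoc_div.
- exact: truncated_contrA.
- exact: truncated_contrB.
have ABm : assoc (r + m%:R + 2^-1)
    (fun q s => if m is m'.+1 then contrA m' n A q s else 0)
    (fun p q => if m is m'.+1 then contrB m' n B p q else 0).
  case: (m) mnN => [|m'] mnN; first exact: assoc0.
  by apply: (@assoc_raise' _ _ (r + m'%:R + 2^-1) _ 1); [lra | apply: IH; lia].
have ABn : assoc (r + m%:R + 2^-1)
    (fun q s => if n is n'.+1 then contrA m n' A q s else 0)
    (fun p q => if n is n'.+1 then contrB m n' B p q else 0).
  by case: (n) mnN => [|n'] mnN; [exact: assoc0 | apply: IH; lia].
have e0 : r + m%:R + 2^-1 + (- 2^-1 - m%:R) = r + 0%:R by lra.
have AB0 := assoc_shift e0 (assoc_mulx2 (2^-1 - n%:R) AB).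
apply: eq_assoc (assocD (assoc_lin (-1) ABm (assocZ (ratr (b m * c n)) AB0)) ABn).
  by move=> q s; rewrite contrA_diff // scaleN1r; congr (_ + _); rewrite addrC.
by move=> p q; rewrite contrB_diff // scaleN1r; congr (_ + _); rewrite addrC.
Qed.
End ContractionSeries.

(** The integrated form of [Kactual_der]: both sides are the coefficient of y^N x^(-m-i-1-N) in K_mi
    (x+y)^(-m-i-1), the left one by Taylor expansion of the kernel, whose value does not depend on
    the base point. *)
Lemma Kactual_vandermonde m i N :
  \sum_(l < N.+1) 'C(i + l, i)%:R * 'C(m + (N - l), m)%:R * Kactual (m + (N - l)) (i + l) =
  gbinom (- (m + i + 1)%:R) N * Kactual m i.
Proof.
elim: N m i => [|N IH] m i.
  by rewrite big_ord1 subnn !addn0 !binn gbinom0 !mul1r.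
apply: (@natr_inj_mul N); rewrite mulrA.
have e : - (m + i + 2)%:R + 1 = - (m + i + 1)%:R :> rat by rewrite !natrD; lra.
have := gbinomSl (- (m + i + 2)%:R) N; rewrite e => ->.
have IH1 := IH m.+1 i; have IH2 := IH m i.+1.
have e1 : (m.+1 + i + 1 = m + i + 2)%N by lia.
have e2 : (m + i.+1 + 1 = m + i + 2)%N by lia.
rewrite e1 in IH1; rewrite e2 in IH2.
move: (gbinom _ N) IH1 IH2 => g IH1 IH2.
transitivity (m.+1%:R * (g * Kactual m.+1 i) + i.+1%:R * (g * Kactual m i.+1)); last first.
  move: (Kactual_der m i); move: (- (m + i + 1)%:R) => d.
  move: (Kactual m.+1 i) (Kactual m i.+1) (Kactual m i) => k1 k2 k3 kd.
  by rewrite mulrAC -kd; ring.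
rewrite -IH1 -IH2; clear IH IH1 IH2 e e1 e2 g.
(* The factor N+1 is split as (N+1-l) + l; each half is absorbed by one of the two binomials and
   matches one of the induction hypotheses. *)
pose T (l : nat) : rat := 'C(i + l, i)%:R * 'C(m + (N.+1 - l), m)%:R *
  Kactual (m + (N.+1 - l)) (i + l).
transitivity (\sum_(l < N.+2) (N.+1 - l)%:R * T l + \sum_(l < N.+2) l%:R * T l).
  rewrite mulr_sumr -big_split; apply: eq_bigr => l _.
  by rewrite /= -mulrDl -natrD subnK // -ltnS.
rewrite big_ord_recr /= subnn mul0r addr0 [X in _ + X]big_ord_recl mul0r add0r.
rewrite !mulr_sumr; congr (_ + _); apply: eq_bigr => -[l /= lN] _.
  rewrite /T subSn // addnS addSn.
  have := mul_bin_left (m + (N - l)).+1 m.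
  have -> : ((m + (N - l)).+1 - m = (N - l).+1)%N by lia.
  move=> /(congr1 (fun n => n%:R : rat)); rewrite !natrM.
  move: (Kactual _ _) ('C(_, m.+1)%:R) ('C(_, m)%:R) => z x y e.
  have -> : m.+1%:R * ('C(i + l, i)%:R * x * z) = m.+1%:R * x * ('C(i + l, i)%:R * z) by ring.
  by rewrite e; ring.
have := mul_bin_left (i + l).+1 i.
have -> : ((i + l).+1 - i = l.+1)%N by lia.
move=> /(congr1 (fun n => n%:R : rat)); rewrite !natrM.
rewrite /T /bump /= add1n subSS addnS addSn.
move: (Kactual _ _) ('C(_, i.+1)%:R) ('C(_, i)%:R) => z x y e.
by rewrite !mulrA e.
Qed.

(** * Products and iterates of vertex operators *)

Section Pairs.
Variables (R : realType).
Local Notation C := R[i].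
Variables (h : lmodType C) (form : h -> h -> C).
Variable V : fock_module form HalfModes (U := C^o) (fun _ _ => 0).
Local Notation vac := (fov V (1 : C^o)).
Local Notation cre := (@cre R h form V).
Local Notation ann := (@ann R h form V).
Local Notation mono := (@mono R h form V).
Variable th : V -> V.
Hypothesis th_linear : linear th.
Hypothesis th_mono : forall l, th (mono l) = (-1) ^+ size l *: mono l.
Variable Z : V -> rat -> V -> V.
Hypothesis Zops : vops th (Knaive HalfModes) Z.
Let thC := th_cre th_linear th_mono.
Let thA := th_ann th_linear th_mono.

Lemma th_vertex u q v : th (Z u q v) = Z (th u) q (th v).
Proof.
move: u q v; suff H l q v : th (Z (mono l) q v) = Z (th (mono l)) q (th v).
  move=> u q v; move: u; apply: eq_on_mono => //.
    by apply: comp_linear => //; apply: (vo_linV Zops).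
  by apply: (comp_linear (f := fun u => Z u q (th v))) => //; apply: (vo_linV Zops).
elim: l q v => [|[a m] l IH] q v.
  rewrite th_mono scale1r -[mono [::]]/vac !(vo_vac Zops).
  by case: ifP => // _; apply: lin0.
have IHth q' v' : th (Z (th (mono l)) q' v') = Z (mono l) q' (th v').
  rewrite th_mono !(linZ (vo_linV Zops _ _)) (linZ th_linear) IH th_mono.
  by rewrite (linZ (vo_linV Zops _ _)) scalerA -expr2 sqrr_sign scale1r.
rewrite mono_cons thC (linN (vo_linV Zops _ _)) !(Zrec Zops) opprD (linD th_linear).
have [N1 v1] : exists N, vanish_from N (fun k => 'C(k, m)%:R *: cre a k (Z (mono l) (q - k%:R + m%:R) v)).
  have [B BP] := Y_trunc (vo_filt Zops) (mono l) v; have [N NP] := nat_large (q + m%:R - B).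
  exists N => k /NP kN; rewrite BP ?(lin0 (cre_linear (V := V) a k)) ?scaler0 //; lra.
have [N2 N2P] := ann_large v.
have v2 : vanish_from N2 (fun k => ratr (gbinom (- k.+1%:R) m) *:
    Z (th (mono l)) (q + k.+1%:R + m%:R) (ann a k v)).
  by move=> k /N2P ->; rewrite (lin0 (vo_linW Zops _ _)) scaler0.
rewrite (lin_fsum th_linear (vanish_finsupp v1)) (lin_fsum th_linear (vanish_finsupp v2)).
have opp_linear : linear (fun x : V => - x) by move=> c x y; rewrite opprD scalerN.
have [N3 v3] : exists N, vanish_from N (fun k =>
    'C(k, m)%:R *: cre a k (Z (th (mono l)) (q - k%:R + m%:R) (th v))).
  exists N1 => k /v1 /(congr1 th); rewrite (linZ th_linear) thC IH (lin0 th_linear).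
  by rewrite scalerN => /eqP; rewrite oppr_eq0 => /eqP.
rewrite (lin_fsum opp_linear (vanish_finsupp v3)).
have v4 : vanish_from N2 (fun k => ratr (gbinom (- k.+1%:R) m) *:
    Z (th (th (mono l))) (q + k.+1%:R + m%:R) (ann a k (th v))).
  move=> k kN; have := congr1 th (N2P k a kN); rewrite thA (lin0 th_linear) => /eqP.
  by rewrite oppr_eq0 => /eqP ->; rewrite (lin0 (vo_linW Zops _ _)) scaler0.
rewrite (lin_fsum opp_linear (vanish_finsupp v4)); congr (_ + _); apply: eq_fsum => k.
  by rewrite (linZ th_linear) thC IH scalerN.
rewrite (linZ th_linear) IHth thA (linN (vo_linW Zops _ _)) scalerN.
by rewrite (th_th th_linear th_mono).
Qed.

Variables (U : lmodType C) (act0 : h -> U -> U).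
Variable W : fock_module form IntModes act0.
Local Notation mo := (@fmo R h form IntModes U act0 W).
Variable Y : V -> rat -> W -> W.
Hypothesis Yops : vops th Kactual Y.
Let linV := vo_linV Yops.
Let linW := vo_linW Yops.
Let ZlinV := vo_linV Zops.
Let ZlinW := vo_linW Zops.
Implicit Types (v : V) (w : W) (p q s : rat) (a : h) (m i k : nat).

Definition pairA v1 v2 w q s : W := Y v1 s (Y v2 q w).
Definition pairB v1 v2 w p q : W := Y (Z v1 p v2) q w.

Lemma truncated_pairA v1 v2 w : truncated (pairA v1 v2 w).
Proof.
have [g1 v1g] := filt_ex v1; have [g2 v2g] := filt_ex v2; have [b wb] := filt_ex w.
exists (Num.min (- b - g2) (- b - g2 - g1)) => q s; rewrite !lt_min => H.
have f2 := vo_filt Yops q v2g wb; have f1 := vo_filt Yops s v1g f2; rewrite /pairA.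
case: H => /andP[H1 H2]; first by rewrite (filt_lt0 _ f2) ?(lin0 (linW _ _)) //; lra.
by rewrite (filt_lt0 _ f1) //; lra.
Qed.

Lemma truncated_pairB v1 v2 w : truncated (pairB v1 v2 w).
Proof.
have [g1 v1g] := filt_ex v1; have [g2 v2g] := filt_ex v2; have [b wb] := filt_ex w.
exists (Num.min (- g1 - g2) (- b - g2 - g1)) => p q; rewrite !lt_min => H.
have f2 := vo_filt Zops p v1g v2g; have f1 := vo_filt Yops q f2 wb; rewrite /pairB.
case: H => /andP[H1 H2]; first by rewrite (filt_lt0 _ f2) ?(lin0 (linV _ _)) //; lra.
by rewrite (filt_lt0 _ f1) //; lra.
Qed.

(** The recursion is applied once, to the outer operator. Its annihilation modes then cross
    Y(v2,x2): they act on [w], with [th v2] for the sign, or contract with v2, which yields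
    [contrA]. *)
Lemma pairA_cre a m v v2 w q s : pairA (cre a m v) v2 w q s =
  fsum (fun k : nat => ratr (gbinom (k%:R - 2^-1) m) *:
    mo a (cr IntModes k) (mulx1 (k%:R - 2^-1 - m%:R) (pairA v v2 w) q s)) +
  fsum (fun k : nat => ratr (gbinom (- (k.+1%:R + 2^-1)) m) *:
    mulx1 (- (k.+1%:R + 2^-1) - m%:R)
      (pairA (th v) (th v2) (mo a (an IntModes k) w)) q s) +
  fsum (fun i : nat => contrA m i (pairA (th v) (ann a i v2) w) q s) +
  fsum (fun i : nat => ratr (Kactual m i) *:
    mulx1 (- (m + i + 1)%:R) (pairA (ann a i v) v2 w) q s).
Proof.
rewrite /pairA (vo_rec Yops) -[in RHS]addrA -[RHS]addrA -[LHS]addrA; congr (_ + _).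
  by apply: eq_fsum => k; congr (_ *: mo _ _ (Y _ _ _)); rewrite /=; lra.
rewrite [RHS]addrA; congr (_ + _); last first.
  by apply: eq_fsum => i; congr (_ *: Y _ _ _); rewrite !natrD /=; lra.
have [I IP] := ann_large v2.
have [N1 v1] := rec_an_vanish (vo_filt Yops) a m (th v) s (Y v2 q w).
have [b wb] := filt_ex w; have [K KP] := nat_large b.
have aw k : (K <= k)%N -> mo a (an IntModes k) w = 0.
  by move=> /KP kb; rewrite (fmo_large a wb) // expo_an /=; lra.
pose F1 k := ratr (gbinom (- (k.+1%:R + 2^-1)) m) *:
  Y (th v) (s + (k.+1%:R + 2^-1) + m%:R) (Y (th v2) q (mo a (an IntModes k) w)).
pose F2 k (i : 'I_I) := ratr (gbinom (- (k.+1%:R + 2^-1)) m * gbinom (k%:R + 2^-1) i) *: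
  pairA (th v) (ann a i v2) w (q - (k%:R + 2^-1) + i%:R) (s + (k.+1%:R + 2^-1) + m%:R).
have e k : ratr (gbinom (- (k.+1%:R + 2^-1)) m) *:
    Y (th v) (s + (k.+1%:R + 2^-1) + m%:R) (mo a (an IntModes k) (Y v2 q w)) =
    F1 k + \sum_(i < I) F2 k i.
  rewrite (vo_com Yops) (linD (linW _ _)) scalerDr; congr (_ + _).
  rewrite (@nsumE _ I); last by move=> i /IP ->; rewrite (lin0 (linV _ _)) scaler0.
  rewrite (lin_sum (linW _ _)) scaler_sumr; apply: eq_bigr => i _.
  by rewrite (linZ (linW _ _)) scalerA -rmorphM.
rewrite (eq_fsum e) (@fsumD _ _ (iota 0 (maxn N1 K))); first last.
- apply: vanish_finsupp => k; rewrite geq_max => /andP[/v1 + /aw k0].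
  by rewrite e /F1 k0 (lin0 (linW _ _)) (lin0 (linW _ _)) scaler0 add0r.
- apply: vanish_finsupp => k; rewrite geq_max => /andP[_ /aw k0].
  by rewrite /F1 k0 (lin0 (linW _ _)) (lin0 (linW _ _)) scaler0.
congr (_ + _).
  by apply: eq_fsum => k; rewrite /F1 /mulx1; congr (_ *: Y _ _ _); lra.
rewrite [RHS](@nsumE _ I).
  rewrite fsum_bigsum // => i.
  have [N NP] := truncated_fsum (fun k => ratr (gbinom (- (k.+1%:R + 2^-1)) m *
      gbinom (k%:R + 2^-1) i)) (q - 2^-1 + i%:R)
     (fun k => s + (k.+1%:R + 2^-1) + m%:R) (truncated_pairA (th v) (ann a i v2) w).
  exists (iota 0 N); apply: vanish_finsupp => k /NP; rewrite /F2.
  by have -> : q - 2^-1 + i%:R - k%:R = q - (k%:R + 2^-1) + i%:R by lra.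
move=> i /IP i0; apply: fsum0 => k.
by rewrite i0 /pairA (lin0 (linV _ _)) (lin0 (linW _ _)) scaler0.
Qed.

End Pairs.

Section Exchange.
Variables (R : realType).
Local Notation C := R[i].
Variable X : lmodType C.
Implicit Types (p q : rat).

Lemma ratr_natE n : n%:R = ratr n%:R :> C.
Proof. by rewrite ratr_nat. Qed.

(** Taylor's formula: the sum over j of C(m+j,m) x0^j times the divided derivative of order m+j at
    x2 is the divided derivative of order m at x2 + x0. The recursion in V produces the left-hand
    side; [gbinomM] merges the binomials. *)
Lemma binmul_exchange m p q (x : nat -> rat) (L : nat -> X -> X)
    (B : nat -> rat -> rat -> X) J K :
  (forall k, linear (L k)) ->
  (forall k j y, (J <= j)%N -> B k (p - j%:R) y = 0) ->
  (forall k j, (K <= k)%N -> L k (B k (p - j%:R) (q - x k + (m + j)%:R)) = 0) ->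
  fsum (fun j : nat => 'C(m + j, m)%:R *: fsum (fun k : nat =>
    ratr (gbinom (x k) (m + j)) *: L k (B k (p - j%:R) (q - x k + (m + j)%:R)))) =
  fsum (fun k : nat => ratr (gbinom (x k) m) *: L k (binmul (x k - m%:R) (B k) p q)).
Proof.
move=> lL BJ BK.
pose F (j k : nat) := ratr ('C(m + j, m)%:R * gbinom (x k) (m + j)) *:
  L k (B k (p - j%:R) (q - x k + (m + j)%:R)).
have F0 j k : F j k != 0 -> (j \in iota 0 J) && (k \in iota 0 K).
  rewrite !mem_iota !add0n /=; apply: contra_neqT; rewrite negb_and -!leqNgt.
  case/orP => H; rewrite /F; last by rewrite BK // scaler0.
  by rewrite BJ // (lin0 (lL k)) scaler0.
transitivity (fsum (fun j => fsum (F j))).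
  apply: eq_fsum => j; rewrite (lin_fsum (scale_linear _ (@id_linear _ X)) (s := iota 0 K)).
    by apply: eq_fsum => k; rewrite /F (ratr_natE 'C(m + j, m)) scalerA -rmorphM.
  by apply: vanish_finsupp => k /BK ->; rewrite scaler0.
rewrite (fsum_exchange F0); apply: eq_fsum => k.
have vB : vanish_from J (fun j => ratr (gbinom (x k - m%:R) j) *:
    B k (p - j%:R) (q - (x k - m%:R) + j%:R)).
  by move=> j /BJ ->; rewrite scaler0.
rewrite (lin_fsum (lL k) (vanish_finsupp vB)).
rewrite (lin_fsum (scale_linear _ (@id_linear _ X)) (s := iota 0 J)); last first.
  by apply: vanish_finsupp => j /vB ->; apply: lin0.
apply: eq_fsum => j; rewrite /F gbinomM (linZ (lL k)) scalerA -rmorphM.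
by congr (_ *: L k (B k _ _)); rewrite natrD; lra.
Qed.

(** The two-variable analogue of [binmul_exchange], for contractions with v: C(k,i) x0^(k-i) comes
    from an annihilation mode meeting Z(v,x0), and C(m+j,m) x0^j from the recursion in V.
    [Kactual_vandermonde] sums them to a power of x2 + x0. *)
Lemma kernel_binmul m i p q (B : rat -> rat -> X) : truncated B ->
  fsum (fun j : nat => 'C(m + j, m)%:R *: fsum (fun k : nat =>
    ratr (Kactual (m + j) k * gbinom k%:R i) *:
      B (p - j%:R - k%:R + i%:R) (q + (m + j)%:R + k%:R + 1))) =
  ratr (Kactual m i) *: binmul (- (m + i + 1)%:R) B p q.
Proof.
move=> tB; have [N NP] := tB; have [M MP] := nat_large (p - N).
pose F (j l : nat) := ratr ('C(i + l, i)%:R * 'C(m + j, m)%:R * Kactual (m + j) (i + l)) *: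
  B (p - (j + l)%:R) (q + (m + i + 1)%:R + (j + l)%:R).
have F0 j l : (M <= j + l)%N -> F j l = 0.
  by move=> /MP H; rewrite /F NP ?scaler0 //; left; lra.
have vF j : vanish_from M (F j) by move=> l lM; apply: F0; apply: leq_trans lM (leq_addl _ _).
transitivity (fsum (fun j => fsum (F j))).
  apply: eq_fsum => j.
  pose G k := ratr (Kactual (m + j) k * gbinom k%:R i) *:
      B (p - j%:R - k%:R + i%:R) (q + (m + j)%:R + k%:R + 1).
  have [M' M'P] := nat_large (p - j%:R + i%:R - N).
  have vG : vanish_from M' G by move=> k /M'P H; rewrite /G NP ?scaler0 //; left; lra.
  rewrite -/(fsum G) (nsum_shift (m := i) vG); last first.
    by move=> k ki; rewrite /G gbinom_nat bin_small // mulr0 rmorph0 scale0r.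
  rewrite (lin_fsum (scale_linear _ (@id_linear _ X)) (s := iota 0 M')); last first.
    by apply: vanish_finsupp => k kM; apply: vG; apply: leq_trans kM (leq_addl _ _).
  apply: eq_fsum => l; rewrite /G /F gbinom_nat (ratr_natE 'C(m + j, m)) scalerA -rmorphM.
  by congr (ratr _ *: B _ _); [|rewrite !natrD; lra|rewrite !natrD; lra];
    move: (Kactual _ _) => c; ring.
rewrite (nsum_diag F0).
have vB : vanish_from M (fun n => ratr (gbinom (- (m + i + 1)%:R) n) *:
    B (p - n%:R) (q - - (m + i + 1)%:R + n%:R)).
  by move=> n /MP H; rewrite NP ?scaler0 //; left; lra.
rewrite (lin_fsum (scale_linear _ (@id_linear _ X)) (vanish_finsupp vB)).
apply: eq_fsum => n; rewrite scalerA -rmorphM mulrC -Kactual_vandermonde.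
rewrite rmorph_sum scaler_suml (reindex_inj rev_ord_inj) /=; apply: eq_bigr => l _.
have ln : (l <= n)%N by rewrite -ltnS.
rewrite /F subSS; have -> : (n - (n - l) = l)%N by lia.
by rewrite subnK // opprK.
Qed.
End Exchange.

Section PairB.
Variables (R : realType).
Local Notation C := R[i].
Variables (h : lmodType C) (form : h -> h -> C).
Variable V : fock_module form HalfModes (U := C^o) (fun _ _ => 0).
Local Notation vac := (fov V (1 : C^o)).
Local Notation cre := (@cre R h form V).
Local Notation ann := (@ann R h form V).
Local Notation mono := (@mono R h form V).
Variable th : V -> V.
Hypothesis th_linear : linear th.
Hypothesis th_mono : forall l, th (mono l) = (-1) ^+ size l *: mono l.
Variable Z : V -> rat -> V -> V.
Hypothesis Zops : vops th (Knaive HalfModes) Z.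
Variables (U : lmodType C) (act0 : h -> U -> U).
Variable W : fock_module form IntModes act0.
Local Notation mo := (@fmo R h form IntModes U act0 W).
Variable Y : V -> rat -> W -> W.
Hypothesis Yops : vops th Kactual Y.
Let linV := vo_linV Yops.
Let linW := vo_linW Yops.
Let ZlinV := vo_linV Zops.
Let ZlinW := vo_linW Zops.
Implicit Types (v : V) (w : W) (p q s : rat) (a : h) (m i k : nat).
Local Notation pairB := (@pairB R h form V Z U act0 W Y).

Lemma ann_Z a i v q v2 I : (forall j, (I <= j)%N -> ann a j v = 0) ->
  ann a i (Z v q v2) = Z (th v) q (ann a i v2) +
    \sum_(j < I) ratr (gbinom i%:R j) *: Z (ann a j v) (q - i%:R + j%:R) v2.
Proof.
move=> v0; have := vo_com Zops a i v q v2; rewrite -[fmo a _ _]/(ann a i _) => ->.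
congr (_ + _); rewrite (@nsumE _ I) /=.
  by apply: eq_bigr => j _; rewrite addr0.
by move=> j /v0 ->; rewrite (lin0 (ZlinV _ _)) scaler0.
Qed.

Lemma filt_th g v : filt g v -> filt g (th v).
Proof.
move: v; apply: filt_mono_ind.
  exact: (linear_subspace_pre th_linear (filt_subspace V g)).
move=> l lg; rewrite th_mono; apply: subspaceZ; first exact: filt_subspace.
exact: filt_mono lg (mono_filt V l).
Qed.

(** The recursion in V turns the creation mode of order m into those of order m+j with weights
    C(m+j,m) x0^j, besides annihilation modes on v2; each of the former is expanded by the recursion
    in W. Resumming over j gives the terms of [pairA_cre] with x1 replaced by x2 + x0. *)
Lemma pairB_cre a m v v2 w p q : pairB (cre a m v) v2 w p q =
  fsum (fun k : nat => ratr (gbinom (k%:R - 2^-1) m) *: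
    mo a (cr IntModes k) (binmul (k%:R - 2^-1 - m%:R) (pairB v v2 w) p q)) +
  fsum (fun k : nat => ratr (gbinom (- (k.+1%:R + 2^-1)) m) *:
    binmul (- (k.+1%:R + 2^-1) - m%:R)
      (pairB (th v) (th v2) (mo a (an IntModes k) w)) p q) +
  fsum (fun i : nat => contrB m i (pairB (th v) (ann a i v2) w) p q) +
  fsum (fun i : nat => ratr (Kactual m i) *:
    binmul (- (m + i + 1)%:R) (pairB (ann a i v) v2 w) p q).
Proof.
have tB x y z := truncated_pairB Zops Yops x y z.
have [g vg] := filt_ex v; have [g2 v2g] := filt_ex v2.
have [J JP] := nat_large (p + g + g2).
have Zx0 x p' j : filt g x -> p' <= p -> (J <= j)%N -> Z x (p' - j%:R) v2 = 0.
  move=> xg p'p /JP jJ; apply: (filt_lt0 _ (vo_filt Zops _ xg v2g)); lra.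
have Zv0 j : (J <= j)%N -> Z v (p - j%:R) v2 = 0 by apply: Zx0.
have Zth0 j : (J <= j)%N -> Z (th v) (p - j%:R) (th v2) = 0.
  by move=> jJ; rewrite -(th_vertex th_linear th_mono Zops) Zv0 // (lin0 th_linear).
have [I2 I2P] := ann_large v2; have [I1 I1P] := ann_large v.
have [b wb] := filt_ex w; have [K KP] := nat_large b.
have aw k : (K <= k)%N -> mo a (an IntModes k) w = 0.
  by move=> /KP kb; rewrite (fmo_large a wb) // expo_an /=; lra.
have Yv0 q' w' : Y 0 q' w' = 0 := lin0 (linV q' w').
have Yw0 v' q' : Y v' q' 0 = 0 := lin0 (linW v' q').
(* For fixed j: T1 has creation modes outside, T2 annihilation modes on w, T3 the contractions with
   v2 and T4 those with v, the last two obtained by letting the annihilation mode cross Z(v,x0). *)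
pose T1 j := fsum (fun k : nat => ratr (gbinom (k%:R - 2^-1) (m + j)) *:
  mo a (cr IntModes k) (pairB v v2 w (p - j%:R) (q - (k%:R - 2^-1) + (m + j)%:R))).
pose T2 j := fsum (fun k : nat => ratr (gbinom (- (k.+1%:R + 2^-1)) (m + j)) *:
  pairB (th v) (th v2) (mo a (an IntModes k) w) (p - j%:R)
    (q - - (k.+1%:R + 2^-1) + (m + j)%:R)).
pose T3 j (i : 'I_I2) := ratr (Kactual (m + j) i) *:
  pairB (th v) (ann a i v2) w (p - j%:R) (q + (m + j)%:R + i%:R + 1).
pose T4 j (i : 'I_I1) := fsum (fun k => ratr (Kactual (m + j) k * gbinom k%:R i) *:
  pairB (ann a i v) v2 w (p - j%:R - k%:R + i%:R) (q + (m + j)%:R + k%:R + 1)).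
have T4fin j (i : 'I_I1) : exists s : seq nat, finsupp_in s (fun k =>
    ratr (Kactual (m + j) k * gbinom k%:R i) *:
    pairB (ann a i v) v2 w (p - j%:R - k%:R + i%:R) (q + (m + j)%:R + k%:R + 1)).
  have [N NP] := truncated_fsum (fun k => ratr (Kactual (m + j) k * gbinom k%:R i))
    (p - j%:R + i%:R) (fun k => q + (m + j)%:R + k%:R + 1) (tB (ann a i v) v2 w).
  exists (iota 0 N); apply: vanish_finsupp => k /NP.
  by have -> : p - j%:R + i%:R - k%:R = p - j%:R - k%:R + i%:R by lra.
have step j : Y (cre a (m + j) (Z v (p - j%:R) v2)) q w =
    T1 j + T2 j + (\sum_(i < I2) T3 j i + \sum_(i < I1) T4 j i).
  rewrite (vo_rec Yops); congr (_ + _ + _).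
    apply: eq_fsum => k; rewrite (th_vertex th_linear th_mono Zops) /pairB.
    by congr (_ *: Y _ _ _); rewrite /=; lra.
  pose G3 k := ratr (Kactual (m + j) k) *:
    pairB (th v) (ann a k v2) w (p - j%:R) (q + (m + j)%:R + k%:R + 1).
  have v3 : vanish_from I2 G3.
    by move=> k /I2P; rewrite /G3 /pairB => ->; rewrite (lin0 (ZlinW _ _)) Yv0 scaler0.
  rewrite -(nsumE v3) /T4 -fsum_bigsum //.
  have e k : ratr (Kactual (m + j) k) *:
      Y (ann a k (Z v (p - j%:R) v2)) (q + (m + j)%:R + k%:R + 1) w =
      G3 k + \sum_(i < I1) ratr (Kactual (m + j) k * gbinom k%:R i) *:
        pairB (ann a i v) v2 w (p - j%:R - k%:R + i%:R) (q + (m + j)%:R + k%:R + 1).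
    rewrite (@ann_Z a k v (p - j%:R) v2 I1 (fun j jI => I1P j a jI)).
    rewrite (linD (linV _ w)) scalerDr; congr (_ + _).
    rewrite (lin_sum (linV _ w)) scaler_sumr; apply: eq_bigr => i _.
    by rewrite (linZ (linV _ w)) scalerA -rmorphM.
  have [N NP] := ann_large (Z v (p - j%:R) v2).
  rewrite (eq_fsum e) (@fsumD _ _ (iota 0 (maxn N I2))) //.
  - by apply: vanish_finsupp => k; rewrite geq_max => /andP[_ /v3].
  - apply: vanish_finsupp => k; rewrite geq_max => /andP[kN /v3 k0].
    have := e k; rewrite k0 add0r => <-.
    by rewrite NP // Yv0 scaler0.
have vS : vanish_from (m + J) (fun k => 'C(k, m)%:R *: cre a k (Z v (p - k%:R + m%:R) v2)).
  move=> k mJk; have -> : p - k%:R + m%:R = p - (k - m)%:R.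
    by rewrite natrB; [lra | lia].
  by rewrite Zv0 ?(lin0 (cre_linear (V := V) a k)) ?scaler0 //; lia.
rewrite {1}/pairB (Zrec Zops) (linD (linV q w)) (nsum_shift (m := m) vS); last first.
  by move=> k km; rewrite bin_small // scale0r.
rewrite (@nsumE _ J); last by move=> j jJ; apply: vS; lia.
rewrite [X in _ + Y X q w = _](@nsumE _ I2); last first.
  by move=> k /I2P ->; rewrite (lin0 (ZlinW _ _)) scaler0.
rewrite !(lin_sum (linV q w)).
have eS j : Y ('C(m + j, m)%:R *: cre a (m + j) (Z v (p - (m + j)%:R + m%:R) v2)) q w =
    'C(m + j, m)%:R *: T1 j + 'C(m + j, m)%:R *: T2 j +
    (\sum_(i < I2) 'C(m + j, m)%:R *: T3 j i + \sum_(i < I1) 'C(m + j, m)%:R *: T4 j i).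
  have -> : p - (m + j)%:R + m%:R = p - j%:R by rewrite natrD; lra.
  by rewrite (linZ (linV q w)) step !scalerDr !scaler_sumr.
under eq_bigr => j _ do rewrite eS.
rewrite !big_split /= -!addrA; congr (_ + (_ + _)).
- have vT : vanish_from J (fun j => 'C(m + j, m)%:R *: T1 j).
    move=> j jJ; rewrite /T1 fsum0 ?scaler0 // => k.
    by rewrite /pairB Zv0 // Yv0 (lin0 (@fmo_linear _ _ _ _ _ _ W _ _)) scaler0.
  have [N NP] := tB v v2 w; have [K1 K1P] := nat_large (p + q + 2^-1 + m%:R - N).
  rewrite -(nsumE vT); apply: (@binmul_exchange _ _ m p q (fun k => k%:R - 2^-1)
    (fun k => mo a (cr IntModes k)) (fun _ => pairB v v2 w) J K1).
  + by move=> k; apply: fmo_linear.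
  + by move=> _ j y jJ; rewrite /pairB Zv0 // Yv0.
  + move=> k j /K1P kK; rewrite NP ?(lin0 (@fmo_linear _ _ _ _ _ _ W _ _)) //.
    by right; rewrite natrD; lra.
- have vT : vanish_from J (fun j => 'C(m + j, m)%:R *: T2 j).
    move=> j jJ; rewrite /T2 fsum0 ?scaler0 // => k.
    by rewrite /pairB Zth0 // Yv0 scaler0.
  rewrite -(nsumE vT); apply: (@binmul_exchange _ _ m p q (fun k => - (k.+1%:R + 2^-1))
    (fun _ x => x) (fun k => pairB (th v) (th v2) (mo a (an IntModes k) w)) J K).
  + by move=> k; apply: id_linear.
  + by move=> k j y jJ; rewrite /pairB Zth0 // Yv0.
  + by move=> k j /aw k0; rewrite /pairB k0 Yw0.
rewrite addrCA [RHS]addrC; congr (_ + _).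
- rewrite [RHS](@nsumE _ I1); last first.
    move=> i /I1P i0; rewrite /binmul fsum0 ?scaler0 // => k.
    by rewrite /pairB i0 (lin0 (ZlinV _ _)) Yv0 scaler0.
  rewrite exchange_big /=; apply: eq_bigr => i _.
  have vT : vanish_from J (fun j => 'C(m + j, m)%:R *: T4 j i).
    move=> j jJ; rewrite /T4 fsum0 ?scaler0 // => k.
    have [ki|ik] := ltnP k i.
      by rewrite gbinom_nat bin_small // mulr0 rmorph0 scale0r.
    have -> : p - j%:R - k%:R + i%:R = p - k%:R + i%:R - j%:R by lra.
    rewrite /pairB Zx0 ?Yv0 ?scaler0 //.
      by apply: filt_mono (ann_filt a i vg); have := ler0n rat i; lra.
    by move: ik; rewrite -(ler_nat rat); lra.
  by rewrite -(nsumE vT); apply: kernel_binmul.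
rewrite [RHS](@nsumE _ I2); last first.
  move=> i /I2P i0; rewrite /contrB fsum0.
    by rewrite /pairB i0 (lin0 (ZlinW _ _)) Yv0 scaler0 addr0.
  by move=> k; rewrite /pairB i0 (lin0 (ZlinW _ _)) Yv0 scaler0.
(* The pole part of [contrB] is the annihilation part of the recursion in V; its regular part is
   T3. *)
rewrite /contrB big_split addrC; congr (_ + _).
  by apply: eq_bigr => i _; rewrite (linZ (linV _ w)).
rewrite exchange_big /=; apply: eq_bigr => i _.
rewrite [RHS](@nsumE _ J); last first.
  move=> j jJ; rewrite /pairB.
  have ag : filt g2 (ann a i v2).
    by apply: filt_mono (ann_filt a i v2g); have := ler0n rat i; lra.
  rewrite (filt_lt0 _ (vo_filt Zops _ (filt_th vg) ag)) ?Yv0 ?scaler0 //.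
  by have := JP j jJ; lra.
apply: eq_bigr => j _; rewrite /T3 scalerA; congr (_ *: _).
by rewrite (ratr_natE _ 'C(m + j, m)) -rmorphM.
Qed.
End PairB.

Lemma assoc_nsum (R : realType) (X : lmodType R[i]) r n (A B : nat -> rat -> rat -> X) :
  (forall k q s, (n <= k)%N -> A k q s = 0) ->
  (forall k p q, (n <= k)%N -> B k p q = 0) ->
  (forall k, (k < n)%N -> assoc r (A k) (B k)) ->
  assoc r (fun q s => fsum (fun k => A k q s)) (fun p q => fsum (fun k => B k p q)).
Proof.
move=> A0 B0 AB; apply: eq_assoc (assoc_sum AB) => p q; apply/esym/nsumE => k.
  exact: A0.
exact: B0.
Qed.

(** * Weak associativity by induction on the length of v1 *)

Section Associativity.
Variables (R : realType).
Local Notation C := R[i].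
Variables (h : lmodType C) (form : h -> h -> C).
Variable V : fock_module form HalfModes (U := C^o) (fun _ _ => 0).
Local Notation vac := (fov V (1 : C^o)).
Local Notation cre := (@cre R h form V).
Local Notation ann := (@ann R h form V).
Local Notation mono := (@mono R h form V).
Variable th : V -> V.
Hypothesis th_linear : linear th.
Hypothesis th_mono : forall l, th (mono l) = (-1) ^+ size l *: mono l.
Variable Z : V -> rat -> V -> V.
Hypothesis Zops : vops th (Knaive HalfModes) Z.
Variables (U : lmodType C) (act0 : h -> U -> U).
Variable W : fock_module form IntModes act0.
Local Notation mo := (@fmo R h form IntModes U act0 W).
Variable Y : V -> rat -> W -> W.
Hypothesis Yops : vops th Kactual Y.
Let linV := vo_linV Yops.
Let linW := vo_linW Yops.
Let ZlinV := vo_linV Zops.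
Let ZlinW := vo_linW Zops.
Implicit Types (v : V) (w : W) (p q s : rat) (a : h) (m i k : nat).
Local Notation pairA := (@pairA R h form V U act0 W Y).
Local Notation pairB := (@pairB R h form V Z U act0 W Y).

(** Here r is the length of v1 in the induction, so that each creation mode adds 1/2 to the
    exponent; it is exchanged for the parity only at the end. *)
Definition weakly_assoc (r : nat) v1 w (P : nat) : Prop :=
  forall v2, assoc (P%:R + r%:R / 2) (pairA v1 v2 w) (pairB v1 v2 w).

Lemma weakly_assoc_mono r v1 w P P' : (P <= P')%N ->
  weakly_assoc r v1 w P -> weakly_assoc r v1 w P'.
Proof.
move=> PP' H v2; apply: (@assoc_raise' _ _ (P%:R + r%:R / 2) _ (P' - P)) => //.
by rewrite natrB //; lra.
Qed.

Lemma weakly_assoc_subspace r : subspace (fun v1 => forall w, exists P, weakly_assoc r v1 w P).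
Proof.
split=> [w|c x y IHx IHy w].
  exists 0%N => v2; apply: eq_assoc (assoc0 _ _) => q s.
    by rewrite /pairA (lin0 (linV _ _)).
  by rewrite /pairB (lin0 (ZlinV _ _)) (lin0 (linV _ _)).
have [P xP] := IHx w; have [P' yP] := IHy w; exists (maxn P P') => v2.
have xP2 := weakly_assoc_mono (leq_maxl P P') xP v2.
have yP2 := weakly_assoc_mono (leq_maxr P P') yP v2.
apply: eq_assoc (assoc_lin c xP2 yP2) => q s; first by rewrite /pairA linV.
by rewrite /pairB ZlinV linV.
Qed.

Lemma weakly_assoc_bound r (v : nat -> V) (w : nat -> W) n :
  (forall k, (k < n)%N -> exists P, weakly_assoc r (v k) (w k) P) ->
  exists P, forall k, (k < n)%N -> weakly_assoc r (v k) (w k) P.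
Proof.
elim: n => [|n IH] H; first by exists 0%N.
have [P HP] := IH (fun k kn => H k (ltnW kn)); have [P' HP'] := H n (ltnSn n).
exists (maxn P P') => k; rewrite ltnS leq_eqVlt => /orP[/eqP ->|kn].
  exact: weakly_assoc_mono (leq_maxr P P') HP'.
exact: weakly_assoc_mono (leq_maxl P P') (HP k kn).
Qed.

Lemma weakly_assoc_vac w : weakly_assoc 0 vac w 0.
Proof.
move=> v2; split.
- exact: (truncated_pairA Yops).
- exact: (truncated_pairB Zops Yops).
have -> : 0%:R + 0%:R / 2 = 0 :> rat by rewrite mul0r addr0.
move=> p q; rewrite binmul0 /expand /mulx1 /pairA /pairB (vo_vac Zops).
have [->|p0] := eqVneq p 0.
  rewrite (@fsum1 _ _ 0%N) /=.
    by rewrite gbinom0 rmorph1 scale1r (vo_vac Yops) !subr0 ?add0r eqxx.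
  by move=> k /negPf k0; rewrite add0r gbinom_nat binn (vo_vac Yops) subr0 pnatr_eq0 k0 scaler0.
rewrite (lin0 (linV _ _)); apply: fsum0 => k; rewrite (vo_vac Yops) subr0.
case: eqVneq => [pk|]; last by rewrite scaler0.
rewrite pk gbinom0l; case: k pk => [|k] pk; last by rewrite rmorph0 scale0r.
by move: p0; rewrite -pk addr0 eqxx.
Qed.

(** The last hypothesis allows the annihilated vector to be 0, which covers r = 0, where [r.-1]
    would not lower the length. *)
Lemma weakly_assoc_cre r a m v w :
  (forall w', exists P, weakly_assoc r v w' P) ->
  (forall w', exists P, weakly_assoc r (th v) w' P) ->
  (forall i, ann a i v = 0 \/ exists P, weakly_assoc r.-1 (ann a i v) w P /\ (0 < r)%N) ->
  exists P, weakly_assoc r.+1 (cre a m v) w P.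
Proof.
move=> IHv IHth IHann.
have [b wb] := filt_ex w; have [K KP] := nat_large b.
have aw k : (K <= k)%N -> mo a (an IntModes k) w = 0.
  by move=> /KP kb; rewrite (fmo_large a wb) // expo_an /=; lra.
have Yv0 q' w' : Y 0 q' w' = 0 := lin0 (linV q' w').
have Yw0 v' q' : Y v' q' 0 = 0 := lin0 (linW v' q').
have [P1 H1] := IHv w.
have [P2 H2] := @weakly_assoc_bound r (fun=> th v) (fun k => mo a (an IntModes k) w) K
  (fun k _ => IHth _).
have [P3 H3] := IHth w.
have [I1 I1P] := ann_large v.
have [P4 H4] : exists P, forall i, (i < I1)%N -> forall v2,
    assoc (P%:R + r%:R / 2 - 2^-1) (pairA (ann a i v) v2 w) (pairB (ann a i v) v2 w).
  have [r0|r0] := posnP r.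
    exists 0%N => i _ v2; have [v0|[P [_]]] := IHann i; last by rewrite r0.
    rewrite v0; apply: eq_assoc (assoc0 _ _) => q s; first by rewrite /pairA Yv0.
    by rewrite /pairB (lin0 (ZlinV _ _)) Yv0.
  have [|P HP] := @weakly_assoc_bound r.-1 (fun i => ann a i v) (fun=> w) I1.
    move=> i _; have [v0|[P []]] := IHann i; last by exists P.
    rewrite v0; have [sub0 _] := weakly_assoc_subspace r.-1; exact: sub0.
  exists P => i iI v2; have := HP i iI v2.
  by have -> : P%:R + r.-1%:R / 2 = P%:R + r%:R / 2 - 2^-1 :> rat;
    rewrite // -{2}(prednK r0) -natr1; lra.
(* The negative powers x1^(-k-3/2-m) with k < K and x1^(-m-i-1) with i < I1 lower the admissible
   exponent, which accounts for K, I1 and m; the powers x1^(k-1/2-m) of the creation part cost at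
   most m. All of these are fixed before v2 is introduced. *)
pose P := (P1 + P2 + P3 + P4 + K + m + I1 + 2)%N.
have : (P1 + P2 + P3 + P4 + K + m + I1 + 2 <= P)%N by [].
move: P => P PE; exists P => v2.
have [I2 I2P] := ann_large v2.
have R1 : assoc (P%:R + r.+1%:R / 2)
   (fun q s => fsum (fun k : nat => ratr (gbinom (k%:R - 2^-1) m) *:
    mo a (cr IntModes k) (mulx1 (k%:R - 2^-1 - m%:R) (pairA v v2 w) q s)))
   (fun p q => fsum (fun k : nat => ratr (gbinom (k%:R - 2^-1) m) *:
    mo a (cr IntModes k) (binmul (k%:R - 2^-1 - m%:R) (pairB v v2 w) p q))).
  have [NA NAP] := truncated_pairA Yops v v2 w.
  have [NB NBP] := truncated_pairB Zops Yops v v2 w.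
  pose N := Num.min (Num.min NA NB) (Num.min NA NB - 2^-1 - m%:R).
  have NE (k : nat) x y : x < N \/ x + y < N + k%:R ->
      (x < NA \/ x + (y - (k%:R - 2^-1 - m%:R)) < NA) /\
      (x < NB \/ x + (y - (k%:R - 2^-1 - m%:R)) < NB).
    have n1 : N <= NA by rewrite !ge_min lexx.
    have n2 : N <= NB by rewrite !ge_min lexx !orbT.
    have nn : N <= Num.min NA NB - 2^-1 - m%:R by rewrite ge_min lexx orbT.
    have n3 : Num.min NA NB <= NA by rewrite ge_min lexx.
    have n4 : Num.min NA NB <= NB by rewrite ge_min lexx orbT.
    move: (Num.min NA NB) N nn n1 n2 n3 n4 => N' N nn n1 n2 n3 n4.
    by case=> H; split; [left|left|right|right]; lra.
  apply: (@assoc_fsum _ _ _ _ _ N).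
  - move=> k; apply: assocZ; apply: assoc_map; first exact: fmo_linear.
    have [n /(congr1 (fun n => n%:R : rat))] : exists n, (n + P1 + m = P + k)%N.
      by exists (P - P1 + k - m)%N; lia.
    rewrite !natrD => e; apply: (@assoc_shift _ _ _ _ _ n _ _ _ (H1 v2)); lra.
  - move=> k p q /NE[/NAP A0 _].
    by rewrite /mulx1 A0 (lin0 (@fmo_linear _ _ _ _ _ _ W _ _)) scaler0.
  - move=> k p q /NE[_ H]; rewrite /binmul fsum0.
      by rewrite (lin0 (@fmo_linear _ _ _ _ _ _ W _ _)) scaler0.
    move=> j; have j0 := ler0n rat j; rewrite NBP ?scaler0 //.
    by case: H => H; [left|right]; lra.
have R2 : assoc (P%:R + r.+1%:R / 2)
   (fun q s => fsum (fun k : nat => ratr (gbinom (- (k.+1%:R + 2^-1)) m) *: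
    mulx1 (- (k.+1%:R + 2^-1) - m%:R)
      (pairA (th v) (th v2) (mo a (an IntModes k) w)) q s))
   (fun p q => fsum (fun k : nat => ratr (gbinom (- (k.+1%:R + 2^-1)) m) *:
    binmul (- (k.+1%:R + 2^-1) - m%:R)
      (pairB (th v) (th v2) (mo a (an IntModes k) w)) p q)).
  apply: (@assoc_nsum _ _ _ K) => [k q s kK|k p q kK|k kK].
  - by rewrite /mulx1 /pairA aw // !Yw0 scaler0.
  - by rewrite /binmul fsum0 ?scaler0 // => j; rewrite /pairB aw // Yw0 scaler0.
  apply: assocZ.
  have [n /(congr1 (fun n => n%:R : rat))] : exists n, (n + P2 + k + 1 + m = P)%N.
    by exists (P - P2 - k - 1 - m)%N; lia.
  rewrite !natrD => e; apply: (@assoc_shift _ _ _ _ _ n _ _ _ (H2 k kK (th v2))); lra.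
have R3 : assoc (P%:R + r.+1%:R / 2)
   (fun q s => fsum (fun i : nat => contrA m i (pairA (th v) (ann a i v2) w) q s))
   (fun p q => fsum (fun i : nat => contrB m i (pairB (th v) (ann a i v2) w) p q)).
  apply: (@assoc_nsum _ _ _ I2) => [i q s /I2P i0|i p q /I2P i0|i iI].
  - by apply: fsum0 => k; rewrite /pairA i0 Yv0 Yw0 scaler0.
  - rewrite /contrB fsum0.
      by rewrite /pairB i0 (lin0 (ZlinW _ _)) Yv0 scaler0 addr0.
    by move=> k; rewrite /pairB i0 (lin0 (ZlinW _ _)) Yv0 scaler0.
  have [n /(congr1 (fun n => n%:R : rat))] : exists n, (n + P3 + m = P)%N.
    by exists (P - P3 - m)%N; lia.
  rewrite !natrD => e.
  apply: (@assoc_raise' _ _ _ _ n _ _ _ (assoc_contr m i (H3 (ann a i v2)))); lra.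
have R4 : assoc (P%:R + r.+1%:R / 2)
   (fun q s => fsum (fun i : nat => ratr (Kactual m i) *:
    mulx1 (- (m + i + 1)%:R) (pairA (ann a i v) v2 w) q s))
   (fun p q => fsum (fun i : nat => ratr (Kactual m i) *:
    binmul (- (m + i + 1)%:R) (pairB (ann a i v) v2 w) p q)).
  apply: (@assoc_nsum _ _ _ I1) => [i q s /I1P i0|i p q /I1P i0|i iI].
  - by rewrite /mulx1 /pairA i0 Yv0 scaler0.
  - rewrite /binmul fsum0 ?scaler0 // => j.
    by rewrite /pairB i0 (lin0 (ZlinV _ _)) Yv0 scaler0.
  apply: assocZ.
  have [n /(congr1 (fun n => n%:R : rat))] : exists n, (n + P4 + m + i = P)%N.
    by exists (P - P4 - m - i)%N; lia.
  rewrite !natrD => e; apply: (@assoc_shift _ _ _ _ _ n _ _ _ (H4 i iI v2)); lra.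
apply: eq_assoc (assocD (assocD (assocD R1 R2) R3) R4) => p q.
  by rewrite (pairA_cre Yops).
by rewrite (pairB_cre th_linear th_mono Zops Yops).
Qed.

Lemma weak_associativity r v1 w : lspan_len (eq r) v1 -> exists P, weakly_assoc r v1 w P.
Proof.
move=> v1r; move: r v1 v1r w; apply: ltn_ind => r IH v1.
move: v1; apply: lspan_min; first exact: weakly_assoc_subspace.
move=> _ [[|[a m] l] rE ->] w; first by exists 0%N; rewrite rE; apply: weakly_assoc_vac.
have lr : lspan_len (eq (size l)) (mono l) by apply: lspan_len_mono.
have IHl v : lspan_len (eq (size l)) v -> forall w, exists P, weakly_assoc (size l) v w P.
  by apply: IH; rewrite rE.
rewrite mono_cons rE; apply: weakly_assoc_cre => [||i].
- exact: IHl.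
- by apply: IHl; rewrite th_mono; apply: subspaceZ => //; apply: lspan_len_subspace.
have al := @lspan_len_ann _ _ _ _ _ (fun n => n.+1 = size l) a i _ (fun n e => esym e) lr.
have [l0|l0] := posnP (size l).
  left; move: al; rewrite l0; move: (ann a i (mono l)); apply: lspan_min => //.
    by split=> // c x y -> ->; rewrite scaler0 addr0.
  by move=> x [l'] .
right; have al' : lspan_len (eq (size l).-1) (ann a i (mono l)).
  by apply: lspan_len_sub al => n <-.
have lr' : ((size l).-1 < r)%N by rewrite rE /= prednK.
by have [P HP] := IH _ lr' _ al' w; exists P.
Qed.
End Associativity.

Lemma natr_odd_half n : n%:R = (odd n)%:R + 2 * n./2%:R :> rat.
Proof. by rewrite -{1}[n]odd_double_half -mul2n natrD natrM. Qed.

Lemma half_integer_parity (n : nat) (x : rat) : x - n%:R / 2 \is a Num.int ->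
  parity x = odd n :> nat.
Proof.
move=> xn; rewrite /parity.
have x_int : (x \is a Num.int) = ((odd n)%:R / 2 \is a @Num.int rat).
  have -> : x = (odd n)%:R / 2 + (n./2%:R + (x - n%:R / 2)).
    by have := natr_odd_half n; lra.
  by rewrite rpredDr // rpredD // rpred_nat.
by rewrite x_int; case: (odd n); last rewrite mul0r rpred0.
Qed.

(** * The twisted module *)

Section TwistedModule.
Variables (R : realType).
Local Notation C := R[i].
Variables (h : lmodType C) (form : h -> h -> C).
Variable V : fock_module form HalfModes (U := C^o) (fun _ _ => 0).
Local Notation vac := (fov V (1 : C^o)).
Local Notation mono := (@mono R h form V).
Variable th : V -> V.
Hypothesis th_linear : linear th.
Hypothesis th_mono : forall l, th (mono l) = (-1) ^+ size l *: mono l.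
Variable Z : V -> rat -> V -> V.
Hypothesis Zops : vops th (Knaive HalfModes) Z.
Variables (U : lmodType C) (act0 : h -> U -> U).
Variable W : fock_module form IntModes act0.
Variable Y : V -> rat -> W -> W.
Hypothesis Yops : vops th Kactual Y.
Let linV := vo_linV Yops.
Let linW := vo_linW Yops.
Implicit Types (v : V) (w : W) (p q s : rat).

Lemma parity_wt_list (l : seq (h * nat)) : parity (wt_list l) = odd (size l).
Proof.
apply: half_integer_parity; elim: l => [|x l IH].
  by rewrite /wt_list big_nil mul0r subr0 rpred0.
rewrite /wt_list big_cons -/(wt_list l) /=.
have -> : 2^-1 + x.2%:R + wt_list l - (size l).+1%:R / 2 =
  x.2%:R + (wt_list l - (size l)%:R / 2) :> rat by lra.
by rewrite rpredD // rpred_nat.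
Qed.

Lemma weight_parity n v : wspace (ratr n) v ->
  lspan_len (fun k => odd k = ~~ (n \is a Num.int)) v.
Proof.
move=> /weight_lspan_len; move: v; apply: lspan_min; first exact: lspan_len_subspace.
move=> _ [l <- ->]; apply: lspan_len_mono.
by have := parity_wt_list l; rewrite /parity; case: (odd _); case: (_ \is a _).
Qed.

Lemma th_parity n v : wspace (ratr n) v -> th v = (-1) ^+ parity n *: v.
Proof.
move=> /weight_lspan_len; move: v; apply: lspan_min.
  by apply: eq_lin_subspace => //; apply/scale_linear/id_linear.
by move=> _ [l <- ->]; rewrite th_mono parity_wt_list signr_odd.
Qed.

Lemma weakly_assoc_parity n v w : wspace (ratr n) v ->
  exists P, weakly_assoc Z Y (parity n) v w P.
Proof.
move=> /weight_lspan_len vn; move: v vn w; apply: lspan_min.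
  exact: (weakly_assoc_subspace Zops Yops).
move=> _ [l <- ->] w; rewrite parity_wt_list.
have [P HP] := weak_associativity th_linear th_mono Zops Yops w
  (lspan_len_mono V (Q := eq (size l)) (l := l) erefl).
(* Half the length is half its parity plus an integer, and that integer is moved into P. *)
exists (P + (size l)./2)%N => v2; have := HP v2; congr (assoc _ _ _).
have := natr_odd_half (size l); rewrite natrD; lra.
Qed.

Lemma Y_int n v q w : wspace (ratr n) v -> Y v q w != 0 ->
  q + (parity n)%:R / 2 \is a Num.int.
Proof. by move=> /weight_parity vn /(vo_int Yops vn). Qed.

Lemma Y_half_int v q w : Y v q w != 0 -> q *+ 2 \is a Num.int.
Proof.
apply: contraNT => q2; apply/eqP; move: v; apply: mono_span.
  split=> [|c x y x0 y0]; first exact: lin0 (linV q w).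
  by rewrite linV x0 y0 scaler0 addr0.
move=> l; apply/eqP; apply: contraNT q2.
move=> /(vo_int Yops (lspan_len_mono V (Q := fun k => odd k = odd (size l)) erefl)) /= qi.
have -> : q *+ 2 = (q + (odd (size l))%:R * 2^-1) * 2%:R - (odd (size l))%:R by lra.
by rewrite rpredB ?rpredM ?rpred_nat.
Qed.

Definition fock_vertex_algebra : va_data R :=
  @VaData R V (fun n => wspace (W := V) (ratr n)) vac (@fwt _ _ _ _ _ _ V) Z.

(** Once the two series are equal, each lends the other its bound: p is bounded below on the iterate
    side and q on the product side. Integrality holds because the half powers of Y(v1,x1) and
    Y(v2,x2) are exactly compensated by the parity factors. *)
Lemma assoc_laurent n1 n2 (v1 v2 : V) w P :
  wspace (ratr n1) v1 -> wspace (ratr n2) v2 ->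
  weakly_assoc Z Y (parity n1) v1 w P ->
  let lhs := @assoc_product R fock_vertex_algebra W Y v1 v2 w P (parity n1) (parity n2) in
  let rhs := @assoc_iterate R fock_vertex_algebra W Y v1 v2 w P (parity n1) (parity n2) in
  [/\ laurent2 lhs, laurent2 rhs & forall p q, lhs p q = rhs p q].
Proof.
move=> v1n v2n /(_ v2) [[NA NAP] tB AB]; set d1 := parity n1; set d2 := parity n2.
move=> lhs rhs; pose r : rat := P%:R + d1%:R / 2.
have lhsE p q : lhs p q = expand (mulx1 r (pairA Y v1 v2 w)) p (q - d2%:R / 2).
  by apply: eq_fsum => k; congr (_ *: Y v1 _ (Y v2 _ w)); rewrite /r; lra.
have rhsE p q : rhs p q = binmul r (pairB Z Y v1 v2 w) p (q - d2%:R / 2).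
  by apply: eq_fsum => k; congr (_ *: Y _ _ w); rewrite /r; lra.
have lr p q : lhs p q = rhs p q by rewrite lhsE rhsE AB.
have [NB NBP] := truncated_binmul r tB.
have [N NP] := nat_large (- Num.min NB NA).
have Llhs : laurent2 lhs.
  exists (- N%:Z) => p q lpq.
  have pN : NB <= p.
    by rewrite leNgt; apply: contra lpq => pN; rewrite lr rhsE NBP //; left.
  have qN : NA <= q.
    rewrite leNgt; apply: contra lpq => qN; rewrite lhsE; apply/eqP/fsum0 => k.
    rewrite /mulx1 NAP ?scaler0 //; left.
    have := (ler0n rat k, ler0n rat d2) => -[k0 d0]; lra.
  have : (p \is a Num.int) && (q \is a Num.int).
    apply: contraNT lpq; rewrite negb_and => pq; apply/eqP/fsum0 => k; apply/eqP.
    apply: contraLR pq; rewrite scaler_eq0 negb_or negb_or !negbK => /andP[_ Y1].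
    have := Y_int v1n Y1; have -> : p + k%:R - P%:R - (parity n1)%:R / 2 + (parity n1)%:R / 2 =
      p + (k%:R - P%:R) by lra.
    rewrite rpredDr; last by rewrite rpredB // rpred_nat.
    move=> ->; have /(Y_int v2n) : Y v2 (q - k%:R - d2%:R / 2) w != 0.
      by apply: contraNneq Y1 => ->; rewrite (lin0 (linW _ _)).
    by rewrite subrK rpredBr // rpred_nat.
  have NNP : (- N%:Z)%:~R <= Num.min NB NA.
    by have := NP N (leqnn N); rewrite rmorphN /=; lra.
  move: NNP; rewrite le_min => /andP[n1' n2'] /andP[-> ->].
  by split => //; [apply: le_trans pN | apply: le_trans qN].
split=> //; case: Llhs => N' N'P; exists N' => p q; rewrite -lr; exact: N'P.
Qed.

Theorem fock_twisted_module :
  @canonically_Z2_twisted_module R fock_vertex_algebra W (wspace (W := W))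
    (@fwt _ _ _ _ _ _ W) (fun _ => 0) Y.
Proof.
exists th; first by split=> // n v; apply: th_parity.
split.
- split=> //.
  + move=> n v vn; rewrite (th_parity vn); exact: lspanZ.
  + exact: (th_th th_linear th_mono).
  + exact: (th_vertex th_linear th_mono Zops).
- exact: wspace_graded.
- exact: linV.
- exact: linW.
- exact: Y_half_int.
- exact: fwt_linear.
- by move=> c x y; rewrite scaler0 addr0.
- by move=> m w _; apply: lspan0.
- by exists 0 => m w; apply: wspace_ge0.
- by move=> m w; apply: wspace_eigen.
- by move=> u q w; apply/eqP; rewrite (vo_wt Yops) subr_eq -addrA addrC.
- exact: vo_vac Yops.
- move=> u q w; have := Y_derivative th_linear th_mono Zops Yops Kactual_der u q w.
  rewrite /dseries => ->; congr (Y _ q w).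
  by rewrite /va_D /dseries /= add0r rmorph1 scale1r.
- move=> n1 v1 w v1n; have [P HP] := weakly_assoc_parity w v1n; exists P => n2 v2 v2n.
  exact: assoc_laurent.
Qed.
End TwistedModule.

(** * Transfer to the concrete modules *)

Lemma mono_multilin (R : realType) (h : lmodType R[i]) (form : h -> h -> R[i])
    (V : fock_module form HalfModes (U := R[i]^o) (fun _ _ => 0)) : multilin (mono V).
Proof.
move=> c a b i l1 l2; elim: l1 => [|[x m] l1 IH] /=.
  by rewrite !mono_cons; apply: fmo_linear_l.
by rewrite !mono_cons IH; apply: cre_linear.
Qed.

Section Instance.
Variables (R : realType).
Local Notation C := R[i].
Variables (h : lmodType C) (form : h -> h -> C).
Hypothesis formDr : forall a c b b', form a (c *: b + b') = c * form a b + form a b'.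
Hypothesis formDl : forall a a' c b, form (c *: a + a') b = c * form a b + form a' b.

Section Naive.
Variables (s : sector) (U : lmodType C) (act0 : h -> U -> U).
Let W : fock_module form s act0 := concrete_fock form s act0.

(** The original sum runs over tuples with the exponent condition in the index set; widening it to
    all lists turns both conditions into the test inside [fterm]. *)
Lemma nord_fieldsE l q w : @nord_fields R h form s U act0 l q w = NF (W := W) l q w.
Proof.
pose P : set (seq int) := [set t | size t = size l /\ expo_fields s t l = q]%classic.
rewrite /NF /nf /fsum -(@fsbig_widen _ _ _ _ P); first last.
- move=> t [_ tP] /=; rewrite /fterm; case: andP => // -[/eqP sz /eqP e].
  by case: tP.
- by [].
rewrite (@reindex_fsbig _ _ _ ((size l).-tuple int) (seq int) (@tval _ _)
  [set n | expo_fields s n l = q]%classic); last first.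
  split=> [n e|t t' _ _ /val_inj //|t [sz e]] /=; first by split; rewrite ?size_tuple.
  by exists (Tuple (introT eqP sz)).
apply: eq_fsbigr => n /set_mem /= e.
rewrite /fterm size_tuple /expo_fields e !eqxx /= /coef_fields; congr (_ *: _).
by rewrite fnord_unlock.
Qed.

(** The definite description is inhabited: the fields are multilinear in the monomial, so
    [mono_lift] extends them to V for each q and w. *)
Lemma naive_vertexP : is_naive_vertex (@naive_vertex R h form s U act0).
Proof.
apply: xgetPex.
have /choice[L LP] (x : rat * W) : exists L : vertex_space form -> W,
    linear L /\ forall l, L (monomial form l) = NF l x.1 x.2.
  exact/(mono_lift formDr formDl)/(NF_multilin formDr formDl).
exists (fun v q w => L (q, w) v); split=> [q w|l q w]; first by case: (LP (q, w)).
by have [_ ->] := LP (q, w); rewrite nord_fieldsE.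
Qed.
End Naive.

Variables (M : nat) (e ebar : M.-tuple h).
Hypothesis dual_basis : forall a, a = \sum_(i < M)
  (form (tnth ebar i) a *: tnth e i + form (tnth e i) a *: tnth ebar i).
Variables (U : lmodType C) (act0 : h -> U -> U).

Lemma vertex_W_twisted :
  @canonically_Z2_twisted_module R (vertex_algebra form) (fock form IntModes act0)
    (@weight_space R _ form IntModes U act0) (@weight_op R _ form IntModes U act0)
    (fun _ => 0) (@vertex_W R _ form M e ebar U act0).
Proof.
pose V : fock_module form HalfModes (U := C^o) (fun _ _ => 0) :=
  concrete_fock form HalfModes (fun _ _ => 0).
pose W : fock_module form IntModes act0 := concrete_fock form IntModes act0.
have [th [th_linear th_mono]] : exists th : V -> V, linear th /\
    forall l, th (mono V l) = (-1) ^+ size l *: mono V l.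
  apply: (mono_lift formDr formDl (f := fun l => (-1) ^+ size l *: mono V l)).
  move=> c a b i l1 l2; rewrite !size_cat /= mono_multilin.
  by rewrite scalerDr !scalerA mulrC.
have ops s (U' : lmodType C) (act' : h -> U' -> U') : vops th (Knaive s)
    (@naive_vertex R h form s U' act' : V -> rat -> concrete_fock form s act' -> _).
  have [lin nE] := naive_vertexP s act'.
  by apply: naive_vops => // l q w; rewrite -nord_fieldsE; apply: nE.
exact: (fock_twisted_module th_linear th_mono (ops HalfModes (C^o : lmodType C) (fun _ _ => 0))
  (actual_vops dual_basis th_linear th_mono (ops IntModes U act0))).
Qed.
End Instance.

(** Write a = x + y along the polarization. The coordinate of x on e_i is its pairing with ebar_i,
    and y drops out of that pairing because q is isotropic; the same holds with the roles
    exchanged. *)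
Lemma dual_basis_expansion (F : fieldType) (h : vectType F) (form : {symmetric h})
    (p q : {vspace h}) (M : nat) (e ebar : M.-tuple h) (a : h) :
  (p + q = fullv)%VS -> (p <= orthov form p)%VS -> (q <= orthov form q)%VS ->
  basis_of p e -> basis_of q ebar ->
  (forall i j : 'I_M, form (tnth e i) (tnth ebar j) = (i == j)%:R) ->
  a = \sum_(i < M) (form (tnth ebar i) a *: tnth e i + form (tnth e i) a *: tnth ebar i).
Proof.
move=> pq p0 q0 ep ebq dual.
have sym u v : form u v = form v u by rewrite hermC mul1r.
have [x xp [y yq ->]] : exists2 x, x \in p & exists2 y, y \in q & a = x + y.
  by apply/memv_addP; rewrite pq memvf.
have pp u v : u \in p -> v \in p -> form u v = 0.
  by move=> up vp; move/orthovP: p0; apply.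
have qq u v : u \in q -> v \in q -> form u v = 0.
  by move=> up vp; move/orthovP: q0; apply.
have coordE (f : M.-tuple h) u (P : {vspace h}) z (i : 'I_M) : basis_of P f -> z \in P ->
    (forall j, form u (tnth f j) = (i == j)%:R) -> coord f i z = form u z.
  move=> fP zP uf; have nE (j : 'I_M) : f`_j = tnth f j by rewrite (tnth_nth 0).
  rewrite {2}(coord_basis fP zP) linear_sumr (bigD1 i) //= big1 => [|j ji].
    by rewrite linearZr_LR nE /= uf eqxx /= mulr1 addr0.
  by rewrite linearZr_LR nE /= uf eq_sym (negPf ji) /= mulr0.
have ein i : tnth e i \in p by apply: (basis_mem ep); apply: mem_tnth.
have ebin i : tnth ebar i \in q by apply: (basis_mem ebq); apply: mem_tnth.
rewrite {1}(coord_basis ep xp) {1}(coord_basis ebq yq) -big_split /=.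
apply: eq_bigr => i _; rewrite -!tnth_nth !linearDr /=.
rewrite [form (tnth e i) x]pp // [form (tnth ebar i) y]qq // addr0 add0r.
congr (_ *: _ + _ *: _).
  by apply: coordE ep xp _ => j; rewrite sym dual eq_sym.
by apply: coordE ebq yq _ => j; rewrite dual.
Qed.

Theorem theorem5p7 (R : realType) (M : nat)
    (form : {symmetric 'rV[R[i]]_(2 * M)})
    (p q : {vspace 'rV[R[i]]_(2 * M)})
    (e ebar : M.-tuple 'rV[R[i]]_(2 * M))
    (U : lmodType R[i])
    (act : {bilinear 'rV[R[i]]_(2 * M) -> U -> U}) :
  nondegenerate form ->
  (p + q = fullv)%VS -> (p :&: q = 0)%VS ->
  maximal_isotropic form p -> maximal_isotropic form q ->
  basis_of p e -> basis_of q ebar ->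
  (forall i j : 'I_M, form (tnth e i) (tnth ebar j) = (i == j)%:R) ->
  exists D_W : fock form IntModes act -> fock form IntModes act,
    @canonically_Z2_twisted_module R (vertex_algebra form)
      (fock form IntModes act)
      (@weight_space R _ form IntModes U act)
      (@weight_op R _ form IntModes U act)
      D_W
      (@vertex_W R _ form M e ebar U act).
Proof.
(* The zero map serves as D_W: it is linear and of weight 1, since 0 lies in every weight space. *)
move=> _ pq _ [p0 _] [q0 _] ep ebq dual; exists (fun _ => 0).
apply: vertex_W_twisted => [a c b b'|a a' c b|a].
- by rewrite linearPr.
- by rewrite linearPl.
- exact: (dual_basis_expansion a pq p0 q0 ep ebq dual).
Qed.
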